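(* For each integer $t \ge 1$, let $p_t(n)$ be the $t$-multipartition function, defined by $\sum_{n=0}^{\infty} p_t(n) q^n = \prod_{i=1}^{\infty} (1-q^i)^{-t}$, and let $$\delta_t = \lim_{x\to\infty} \frac{\#\{n \le x : p_t(n) \text{ is odd}\}}{x}$$ be its odd density, whenever this limit exists. Then both of the following hold. (i) Suppose there exists a positive integer $A \equiv \pm 1 \pmod 6$ such that $\delta_A > 0$, and assume that $\delta_i$ exists for all positive integers $i \le A$ with $i \equiv \pm 1 \pmod 6$. Then $\delta_1 > 0$. (ii) Suppose there exists a positive integer $A \equiv 3 \pmod 6$ such that $\delta_A > 0$, and assume that $\delta_i$ exists for all positive integers $i \le A$ with $i \equiv 3 \pmod 6$. Then $\delta_3 > 0$.
   Context: The product $\prod_{i=1}^{\infty}(1-q^i)^{-t}$ is understood as a formal power series in $q$ with integer coefficients; $p_1(n) = p(n)$ is the ordinary partition function. In the count $\#\{n \le x : p_t(n) \text{ is odd}\}$, $n$ ranges over nonnegative integers. The assertion $\delta_A > 0$ means that the limit defining $\delta_A$ exists and is positive. *)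

(* Defs.v *)
From HB Require Import structures.
From mathcomp Require Import all_boot all_order all_algebra.
From mathcomp Require Import all_classical all_reals all_analysis.
Set Implicit Arguments.
Unset Strict Implicit.
Unset Printing Implicit Defensive.
Import Order.TTheory GRing.Theory Num.Theory.
Import numFieldNormedType.Exports.
Local Open Scope classical_set_scope.
Local Open Scope ring_scope.

(* [f n] is the coefficient of q^n. *)
Definition fps := nat -> int.

Definition fps_one : fps := fun n => (n == 0)%N%:R.

Definition fps_mul (f g : fps) : fps :=
  fun n => \sum_(i < n.+1) f i * g (n - i)%N.

Definition fps_exp (f : fps) (t : nat) : fps := iter t (fps_mul f) fps_one.

(* First [n] coefficients of the inverse of a series with constant term 1, from
   g_0 = 1 and g_n = - \sum_(0 < k <= n) f_k g_(n-k). *)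
Fixpoint fps_inv_seq (f : fps) (n : nat) : seq int :=
  if n is m.+1 then
    let s := fps_inv_seq f m in
    rcons s (if m == 0%N then 1 else - \sum_(k < m) f k.+1 * s`_(m - k.+1))
  else [::].

(* Meaningful only when [f 0 = 1]; see [fps_mulV]. *)
Definition fps_inv (f : fps) : fps := fun n => (fps_inv_seq f n.+1)`_n.

Definition one_sub_q (i : nat) : fps := fun n => (n == 0)%N%:R - (n == i)%:R.

Definition fps_partial_prod (F : nat -> fps) (m : nat) : fps :=
  \big[fps_mul/fps_one]_(1 <= i < m.+1) F i.

(* Convergence of \prod_(i >= 1) F i to [G] in the q-adic topology: every
   coefficient of the partial products is eventually that of [G]. *)
Definition fps_prod_cvg (F : nat -> fps) (G : fps) : Prop :=
  forall n : nat, exists N : nat, forall m : nat,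
    (N <= m)%N -> fps_partial_prod F m n = G n.

(* The [i]-th factor is 1 modulo q^i, so the coefficient of q^n in the infinite
   product is already that of the product over 1 <= i <= n; see
   [multipartition_prod]. *)
Definition multipartition (t : nat) : fps :=
  fun n => fps_partial_prod (fun i => fps_inv (fps_exp (one_sub_q i) t)) n n.

(* Every natural number n <= x is at most [Num.truncn x]; the ordinal bound only
   makes the set finite. *)
Definition odd_count (R : realType) (t : nat) (x : R) : nat :=
  #|[set n : 'I_(Num.truncn x).+1 | (n%:R <= x) &&
                                     ~~ (2 %| multipartition t n)%Z]|.

Definition odd_ratio (R : realType) (t : nat) (x : R) : R :=
  (odd_count t x)%:R / x.

Definition odd_density_exists (R : realType) (t : nat) : Prop :=
  cvg (odd_ratio t x @[x --> +oo%R] : set_system R).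

(* Junk value when the limit does not exist. *)
Definition odd_density (R : realType) (t : nat) : R :=
  lim (odd_ratio t x @[x --> +oo%R]).

Definition odd_density_pos (R : realType) (t : nat) : Prop :=
  odd_density_exists R t /\ 0 < odd_density R t.

Lemma size_fps_inv_seq f n : size (fps_inv_seq f n) = n.
Proof. by elim: n => //= n IH; rewrite size_rcons IH. Qed.

Lemma nth_fps_inv_seq f n k : (k < n)%N -> (fps_inv_seq f n)`_k = fps_inv f k.
Proof.
elim: n => // n IH; rewrite ltnS leq_eqVlt => /orP[/eqP -> //|kn].
by rewrite /= nth_rcons size_fps_inv_seq kn IH.
Qed.

Lemma fps_inv0 f : fps_inv f 0 = 1.
Proof. by []. Qed.

Lemma fps_invS f n :
  fps_inv f n.+1 = - \sum_(k < n.+1) f k.+1 * fps_inv f (n - k)%N.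
Proof.
rewrite {1}/fps_inv [fps_inv_seq f n.+2]/= -/(fps_inv_seq f n.+1).
rewrite nth_rcons size_fps_inv_seq ltnn eqxx /=; congr (- _).
apply: eq_bigr => k _; rewrite subSS -[rcons _ _]/(fps_inv_seq f n.+1).
by rewrite nth_fps_inv_seq // ltnS leq_subr.
Qed.

Lemma fps_mulV f : f 0%N = 1 -> fps_mul f (fps_inv f) =1 fps_one.
Proof.
move=> f0 [|n]; rewrite /fps_mul /fps_one; first by rewrite big_ord1 f0 mul1r.
rewrite big_ord_recl /= f0 mul1r subn0 fps_invS /bump /=.
by under [X in _ + X]eq_bigr => i _ do rewrite add1n subSS; rewrite addNr.
Qed.

Definition fps_eq_upto (n : nat) (f g : fps) :=
  forall k : nat, (k <= n)%N -> f k = g k.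

Lemma fps_eq_upto_mul n f g f' g' : fps_eq_upto n f f' -> fps_eq_upto n g g' ->
  fps_eq_upto n (fps_mul f g) (fps_mul f' g').
Proof.
move=> ff gg k kn; apply: eq_bigr => i _.
rewrite ff ?gg //; first exact: leq_trans (leq_subr _ _) kn.
by apply: leq_trans kn; rewrite -ltnS.
Qed.

Lemma fps_mul11 : fps_mul fps_one fps_one =1 fps_one.
Proof.
move=> n; rewrite /fps_mul big_ord_recl big1 ?addr0 /fps_one ?mul1r ?subn0 //.
by move=> i _; rewrite mul0r.
Qed.

Lemma fps_exp_one_sub_q n i t : (n < i)%N ->
  fps_eq_upto n (fps_exp (one_sub_q i) t) fps_one.
Proof.
move=> ni; elim: t => [//|t IH] k kn; rewrite /fps_exp iterS -fps_mul11.
apply: (fps_eq_upto_mul _ IH) kn => j jn.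
by rewrite /one_sub_q /fps_one (ltn_eqF (leq_ltn_trans jn ni)) subr0.
Qed.

Lemma fps_inv_upto n f : fps_eq_upto n f fps_one ->
  fps_eq_upto n (fps_inv f) fps_one.
Proof.
move=> f1 [|k] kn; first exact: fps_inv0.
rewrite fps_invS big1 ?oppr0 // => j _.
by rewrite f1 ?mul0r // (leq_trans _ kn).
Qed.

Lemma fps_exp_one_sub_q0 i t : (0 < i)%N -> fps_exp (one_sub_q i) t 0%N = 1.
Proof. by move=> i0; rewrite (@fps_exp_one_sub_q 0 i t i0 0%N). Qed.

Lemma multipartition_prod t :
  fps_prod_cvg (fun i => fps_inv (fps_exp (one_sub_q i) t)) (multipartition t).
Proof.
move=> n; exists n => m nm; rewrite /multipartition.
set F := fun i => fps_inv (fps_exp (one_sub_q i) t).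
rewrite /fps_partial_prod.
have -> : index_iota 1 m.+1 = index_iota 1 n.+1 ++ iota n.+1 (m - n).
  by rewrite /index_iota !subn1 /= -{1}(subnKC nm) iotaD add1n.
suff H : fps_eq_upto n
   (\big[fps_mul/fps_one]_(i <- index_iota 1 n.+1 ++ iota n.+1 (m - n)) F i)
   (\big[fps_mul/fps_one]_(1 <= i < n.+1) F i) by exact: H.
elim: (index_iota 1 n.+1) => [|i s IH] /=; last first.
  by rewrite !big_cons; apply: fps_eq_upto_mul IH.
have : all (fun i => n < i)%N (iota n.+1 (m - n)).
  by apply/allP => i; rewrite mem_iota => /andP[].
rewrite big_nil; elim: (iota _ _) => [|i s IH] /=; first by rewrite big_nil.
move=> /andP[ni sn] k kn; rewrite big_cons -fps_mul11.
apply: fps_eq_upto_mul (IH sn) _ kn.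
by apply: fps_inv_upto; exact: fps_exp_one_sub_q.
Qed.

(* Main.v *)
(* Let [l = 2m + 1] be an odd prime and [A = l t] with [6 | t m (m + 1)]. In
   characteristic 2 let [eta = Z^(l^2) prod_n (1 - Z^(24 l^2 n))], so that the
   expansion of [eta^-k] has the coefficients [p_k(n) mod 2]. The two theta
   series A, B attached to the points of the [l]-torsion plane satisfy addition
   formulas, so their values along each of the [l + 1] lines C are governed by
   division polynomials over [F[1/eta]]. Hence the trace
     [T = sum_C (eta^(m-1) / prod_(1 <= k <= m) B_C(k))^t]
   is rational in [1/eta] and integral over [F[1/eta]], that is, a polynomial in
   [1/eta]. On the other hand the Jacobi triple product evaluates the products of
   the B_C(k): up to constants, the summand of the line at infinity is
   [eta(Z^l)^-t] and the others are [eta(zeta Z^(1/l))^-t]. Comparing coefficients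
   shows that if [p_A(n)] is odd, then one of [p_t(n/l)],
   [p_t(l n - t(l^2-1)/24)] and [p_(A-24j)(n-j)], [j > 0], is odd.
   Each of these maps is injective and at most linear in [n], so by strong
   induction on A the function [p_A] is even on a set of density one as soon as
   [p_1] (when A is prime to 6), resp. [p_3] (when A = 3 mod 6), is. *)
Require Import Defs.
From HB Require Import structures.
From mathcomp Require Import all_boot all_order all_algebra.
From mathcomp Require Import cyclic fraction finfield.
From mathcomp Require Import all_classical all_reals all_analysis.
From mathcomp Require Import zify ring lra.
Set Implicit Arguments.
Unset Strict Implicit.
Unset Printing Implicit Defensive.
Import Order.TTheory GRing.Theory Num.Theory.
Import numFieldNormedType.Exports.
Local Open Scope classical_set_scope.
Local Open Scope ring_scope.

(** * Formal power series *)

(** The quotient [W = A / B] serves as a coordinate on points up to sign. The nonzero [l]-torsion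
    points up to sign, [m] on each of the [l + 1] lines, have distinct coordinates, as their leading
    terms show. Their number [m (l + 1)] is the degree of a monic division polynomial over
    [F[1/eta]], so they are exactly its roots, and any rational expression in [W] summed over all
    roots is rational in [1/eta]. The summand of [T] must thus be written through [W] alone. The
    division polynomials only give the product of the [B_C(k)] up to a power of one [B_C(k)], with
    exponent [1^2 + ... + m^2 = m (m + 1) l / 6]; what can be corrected is a multiple of [l], and
    this is the source of the condition [6 | t m (m + 1)]. For [l >= 5] it always holds; for [l = 3]
    it demands [3 | t], which is why odd multiples of 3 descend to [p_3]. Characteristic 2 enters
    through Frobenius: a square of a double theta series is again a double theta series, after the
    change of variables [x = N + M], [y = N - M]. *)

Record powser (F : fieldType) := PowSer { coefs : nat -> F }.

Section PowSer.
Variable F : fieldType.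
Local Notation S := (powser F).
Implicit Types (f g h : S) (n k : nat).

HB.instance Definition _ := gen_eqMixin S.
HB.instance Definition _ := gen_choiceMixin S.

Lemma powserP f g : (forall n, coefs f n = coefs g n) -> f = g.
Proof. by case: f g => f [g] /= /funext ->. Qed.

Definition powser_zero : S := PowSer (fun=> 0).
Definition powser_add f g : S := PowSer (fun n => coefs f n + coefs g n).
Definition powser_opp f : S := PowSer (fun n => - coefs f n).

Fact powser_addA : associative powser_add.
Proof. by move=> f g h; apply: powserP => n /=; rewrite addrA. Qed.
Fact powser_addC : commutative powser_add.
Proof. by move=> f g; apply: powserP => n /=; rewrite addrC. Qed.
Fact powser_add0 : left_id powser_zero powser_add.
Proof. by move=> f; apply: powserP => n /=; rewrite add0r. Qed.
Fact powser_addN : left_inverse powser_zero powser_opp powser_add.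
Proof. by move=> f; apply: powserP => n /=; rewrite addNr. Qed.
HB.instance Definition _ :=
  GRing.isZmodule.Build S powser_addA powser_addC powser_add0 powser_addN.

Lemma coefs0 n : coefs (0 : S) n = 0. Proof. by []. Qed.
Lemma coefsD f g n : coefs (f + g) n = coefs f n + coefs g n. Proof. by []. Qed.
Lemma coefsB f g n : coefs (f - g) n = coefs f n - coefs g n. Proof. by []. Qed.

Definition trunc n f : {poly F} := \poly_(i < n) coefs f i.

Definition powser_mul f g : S :=
  PowSer (fun n => \sum_(i < n.+1) coefs f i * coefs g (n - i)).
Definition powser_of_poly (p : {poly F}) : S := PowSer (fun n => p`_n).

Lemma coef_trunc n f k : (k < n)%N -> (trunc n f)`_k = coefs f k.
Proof. by move=> kn; rewrite coef_poly kn. Qed.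

(** Transfers the ring axioms from polynomials: each one is checked coefficient by coefficient on
    truncations. *)
Lemma powser_mul_trunc n f g k : (k < n)%N ->
  coefs (powser_mul f g) k = (trunc n f * trunc n g)`_k.
Proof.
move=> kn; rewrite coefM; apply: eq_bigr => i _; rewrite !coef_trunc //.
  exact: leq_ltn_trans (leq_subr _ _) kn.
exact: leq_trans (ltn_ord i) kn.
Qed.

Fact powser_mulA : associative powser_mul.
Proof.
move=> f g h; apply: powserP => n.
have E a b c : coefs (powser_mul a (powser_mul b c)) n =
    (trunc n.+1 a * (trunc n.+1 b * trunc n.+1 c))`_n.
  rewrite coefM; apply: eq_bigr => i _; rewrite coef_trunc //.
  by rewrite (@powser_mul_trunc n.+1) ?ltnS ?leq_subr.
have C a b : powser_mul a b = powser_mul b a.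
  by apply: powserP => k; rewrite !(@powser_mul_trunc k.+1) // mulrC.
by rewrite [powser_mul (powser_mul f g) h]C !E mulrA mulrC.
Qed.
Fact powser_mulC : commutative powser_mul.
Proof.
by move=> f g; apply: powserP => n; rewrite !(@powser_mul_trunc n.+1) // mulrC.
Qed.
Fact powser_mul1 : left_id (powser_of_poly 1) powser_mul.
Proof.
move=> f; apply: powserP => n /=; rewrite big_ord_recl big1 => [|i _].
  by rewrite addr0 coef1 mul1r subn0.
by rewrite coef1 mul0r.
Qed.
Fact powser_mulDl : left_distributive powser_mul +%R.
Proof.
move=> f g h; apply: powserP => n /=; rewrite -big_split /=.
by apply: eq_bigr => i _; rewrite mulrDl.
Qed.
Fact powser_oner_neq0 : powser_of_poly 1 != 0.
Proof.
apply/eqP => /(congr1 (fun f => coefs f 0)) /=; rewrite coef1 => /eqP.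
by rewrite oner_eq0.
Qed.
HB.instance Definition _ := GRing.Zmodule_isComNzRing.Build S
  powser_mulA powser_mulC powser_mul1 powser_mulDl powser_oner_neq0.

Lemma coefsM f g n :
  coefs (f * g) n = \sum_(i < n.+1) coefs f i * coefs g (n - i).
Proof. by []. Qed.

Lemma coefs1 n : coefs (1 : S) n = (n == 0%N)%:R. Proof. exact: coef1. Qed.

(** Inverses are chosen classically; they complete the integral domain structure on which the
    fraction field is built. *)
Definition powser_unit : pred S := fun f => `[< exists g, g * f = 1 >].
Definition powser_inv f : S :=
  if pselect (exists g, g * f = 1) is left e then projT1 (cid e) else f.
Fact powser_mulVr : {in powser_unit, left_inverse 1 powser_inv *%R}.
Proof.
move=> f /asboolP fU; rewrite /powser_inv; case: pselect => // e.
exact: (projT2 (cid e)).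
Qed.
Fact powser_unitP f g : g * f = 1 -> f \in powser_unit.
Proof. by move=> gf; apply/asboolP; exists g. Qed.
Fact powser_invN : {in [predC powser_unit], powser_inv =1 id}.
Proof.
move=> f fN; rewrite /powser_inv; case: pselect => // e.
by case/negP: fN; apply/asboolP.
Qed.
HB.instance Definition _ := GRing.ComNzRing_hasMulInverse.Build S
  powser_mulVr powser_unitP powser_invN.

(* When [c != 0], [f] has order [k] and leading coefficient [c]. *)
Definition lead_at f k (c : F) :=
  coefs f k = c /\ forall j, (j < k)%N -> coefs f j = 0.

Lemma lead_atM f g j k c d :
  lead_at f j c -> lead_at g k d -> lead_at (f * g) (j + k) (c * d).
Proof.
move=> [<- f0] [<- g0]; split => [|n nk].
  rewrite coefsM (bigD1 (Ordinal (leq_addr k j : (j < (j + k).+1)%N))) //=.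
  rewrite addKn big1 ?addr0 // => i ij; case: (ltnP i j) => [/f0 -> |ji].
    by rewrite mul0r.
  have {}ji : (j < i)%N by rewrite ltn_neqAle ji andbT eq_sym.
  by rewrite g0 ?mulr0 //; have := ltn_ord i; lia.
rewrite coefsM big1 // => i _; case: (ltnP i j) => [/f0 -> |ji].
  by rewrite mul0r.
by rewrite g0 ?mulr0 //; have := ltn_ord i; lia.
Qed.

Lemma lead_at1 : lead_at 1 0 1.
Proof. by split; rewrite ?coefs1. Qed.

Lemma lead_at_neq0 f k c : lead_at f k c -> c != 0 -> f != 0.
Proof. by case=> <- _; apply: contraNneq => ->. Qed.

Lemma lead_at_ex f : f != 0 -> exists k, exists2 c, c != 0 & lead_at f k c.
Proof.
move=> f0; have ex : exists k, coefs f k != 0.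
  apply: contrapT => H; case/eqP: f0; apply: powserP => n; apply/eqP.
  by apply/negPn/negP => fn; apply: H; exists n.
case: (ex_minnP ex) => k fk kmin; exists k, (coefs f k) => //; split=> // j jk.
by apply/eqP; apply: contraTT jk => /kmin; rewrite -leqNgt.
Qed.

Fact powser_integral f g : f * g = 0 -> (f == 0) || (g == 0).
Proof.
move=> fg; apply/norP => -[/lead_at_ex[j [c c0 lf]] /lead_at_ex[k [d d0 lg]]].
have := lead_at_neq0 (lead_atM lf lg) (mulf_neq0 c0 d0).
by rewrite fg eqxx.
Qed.
HB.instance Definition _ := GRing.ComUnitRing_isIntegral.Build S powser_integral.

Lemma lead_at_prod (I : Type) (r : seq I) (P : pred I) (f : I -> S)
    (k : I -> nat) (c : I -> F) :
  (forall i, P i -> lead_at (f i) (k i) (c i)) ->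
  lead_at (\prod_(i <- r | P i) f i) (\sum_(i <- r | P i) k i)
          (\prod_(i <- r | P i) c i).
Proof.
move=> H; elim/big_rec3: _ => [|i c' k' f' Pi IH]; first exact: lead_at1.
by apply: lead_atM => //; apply: H.
Qed.

Lemma coefs_sum (I : Type) (r : seq I) (P : pred I) (f : I -> S) n :
  coefs (\sum_(i <- r | P i) f i) n = \sum_(i <- r | P i) coefs (f i) n.
Proof. by elim/big_rec2: _ => // i y x _ <-. Qed.

Lemma lead_at_inj f j k c d :
  lead_at f j c -> lead_at f k d -> c != 0 -> d != 0 -> j = k /\ c = d.
Proof.
move=> [<- f0] [<- g0] c0 d0.
case: (ltngtP j k) => [/g0 /eqP|/f0 /eqP|-> //]; last by rewrite (negPf d0).
by rewrite (negPf c0).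
Qed.

Definition mono (c : F) k : S := PowSer (fun n => c *+ (n == k)).

Lemma coefs_monoM c k f n :
  coefs (mono c k * f) n = if (n < k)%N then 0 else c * coefs f (n - k).
Proof.
rewrite coefsM; case: ltnP => nk.
  rewrite big1 // => i _ /=; rewrite (ltn_eqF (leq_trans (ltn_ord i) nk)).
  by rewrite mul0r.
rewrite (bigD1 (Ordinal (nk : (k < n.+1)%N))) //= eqxx mulr1n big1 ?addr0 //.
by move=> i ik; rewrite [_ == k :> nat](negPf ik) mul0r.
Qed.

Lemma monoM c d j k : mono c j * mono d k = mono (c * d) (j + k).
Proof.
apply: powserP => n; rewrite coefs_monoM /=; case: ltnP => nj.
  by rewrite ltn_eqF // (leq_trans nj) ?leq_addr.
by rewrite -mulrnAr; congr (_ * (_ *+ nat_of_bool _)); lia.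
Qed.

Lemma mono1 : mono 1 0 = 1.
Proof. by apply: powserP => n; rewrite coefs1. Qed.

Lemma monoX c k n : mono c k ^+ n = mono (c ^+ n) (n * k).
Proof.
by elim: n => [|n IH]; rewrite ?mul0n ?mono1 // !exprS IH monoM mulSn.
Qed.

Lemma lead_at_mono c k : lead_at (mono c k) k c.
Proof. by split=> [|j jk] /=; rewrite ?eqxx // ltn_eqF. Qed.

Lemma mono_neq0 c k : c != 0 -> mono c k != 0.
Proof. exact: lead_at_neq0 (lead_at_mono c k). Qed.

(* Substitution of the monomial [c Z^b] for the variable, [b > 0]. *)
Definition dil (c : F) (b : nat) f : S :=
  PowSer (fun n => if (b %| n)%N then c ^+ (n %/ b) * coefs f (n %/ b) else 0).

Lemma coefs_dil c b f n : (0 < b)%N ->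
  coefs (dil c b f) (n * b) = c ^+ n * coefs f n.
Proof. by move=> b0; rewrite /= dvdn_mull // mulnK. Qed.

Lemma coefs_dilN c b f n : ~~ (b %| n)%N -> coefs (dil c b f) n = 0.
Proof. by move=> /negPf /= ->. Qed.

Lemma dilD c b f g : dil c b (f + g) = dil c b f + dil c b g.
Proof.
by apply: powserP => n /=; case: ifP; rewrite ?addr0 // mulrDr.
Qed.

Lemma dilM c b f g : (0 < b)%N -> dil c b (f * g) = dil c b f * dil c b g.
Proof.
move=> b0; apply: powserP => n; rewrite coefsM.
case: (boolP (b %| n)%N) => [/dvdnP[k ->]|bn]; last first.
  rewrite coefs_dilN // big1 // => i _.
  case: (boolP (b %| i)%N) => [bi|bi]; last by rewrite coefs_dilN ?mul0r.
  by rewrite [X in _ * X]coefs_dilN ?mulr0 // dvdn_subl // -ltnS.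
rewrite coefs_dil // coefsM mulr_sumr.
have inj : injective (fun i : 'I_k.+1 => @inord (k * b) (i * b)).
  move=> i j /(congr1 val) /=; rewrite !inordK ?ltnS ?leq_mul2r -1?ltnS ?ltn_ord ?orbT //.
  by move/eqP; rewrite eqn_pmul2r // => /eqP /val_inj.
rewrite (bigID (fun i : 'I_(k * b).+1 => (b %| i)%N)) /= [X in _ + X]big1 => [|i].
  rewrite addr0 (reindex (fun i : 'I_k.+1 => @inord (k * b) (i * b))) /=; last first.
    exists (fun j : 'I_(k * b).+1 => @inord k (j %/ b)) => [i _|j].
      apply: val_inj; rewrite /= inordK inordK ?mulnK ?ltnS ?leq_mul2r -1?ltnS ?ltn_ord ?orbT //.
    rewrite inE => /dvdnP[i ji]; apply: val_inj; rewrite /= ji mulnK //.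
    have ik : (i < k.+1)%N by rewrite ltnS -(leq_pmul2r b0) -ji -ltnS.
    by rewrite (inordK ik) inordK // ltnS leq_pmul2r // -ltnS.
  apply: eq_big => [i|i _].
    by rewrite inordK ?dvdn_mull // ltnS leq_mul2r -ltnS ltn_ord orbT.
  rewrite inordK ?ltnS ?leq_mul2r -1?ltnS ?ltn_ord ?orbT //.
  rewrite dvdn_mull // mulnK // -mulnBl dvdn_mull // mulnK //.
  have -> : c ^+ k = c ^+ i * c ^+ (k - i).
    by rewrite -exprD subnKC // -ltnS.
  by rewrite mulrACA.
by move=> /negPf ->; rewrite mul0r.
Qed.

Lemma dil1 c b : (0 < b)%N -> dil c b 1 = 1.
Proof.
move=> b0; apply: powserP => n; rewrite /= coef1.
case: (boolP (b %| n)%N) => [/dvdnP[k ->]|bn].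
  rewrite mulnK // coef1 muln_eq0 [b == _]gtn_eqF // orbF.
  by case: k => [|k]; rewrite ?mulr0 ?mulr1.
by rewrite coef1; case: n bn => [|n]; rewrite ?dvdn0.
Qed.

Lemma dilX c b f n : (0 < b)%N -> dil c b (f ^+ n) = dil c b f ^+ n.
Proof.
by move=> b0; elim: n => [|n IH]; rewrite ?dil1 // !exprS dilM // IH.
Qed.

Lemma dil_mono c b d k : (0 < b)%N -> dil c b (mono d k) = mono (c ^+ k * d) (k * b).
Proof.
move=> b0; apply: powserP => n /=; case: (boolP (b %| n)%N) => [/dvdnP[j ->]|bn].
  by rewrite mulnK // eqn_pmul2r //; case: eqP => [->|_]; rewrite ?mulr0 //= mulr1n.
by case: eqP bn => // ->; rewrite dvdn_mull.
Qed.

End PowSer.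

(** * Traces of rational functions over the roots of a polynomial *)

Section RationalFunctions.
Variables (R : idomainType) (E : fieldType) (iota : {rmorphism R -> E}).
Hypothesis iota_inj : injective iota.
Variables (Psi : {poly R}) (s : seq E).
Hypothesis Psi_monic : Psi \is monic.
Hypothesis s_uniq : uniq s.
Hypothesis Psi_split : map_poly iota Psi = \prod_(z <- s) ('X - z%:P).
Local Notation "p ^i" := (map_poly iota p) (at level 2, format "p ^i").

(* The restriction of [phi] to the roots is a polynomial over the fraction field
   of [R]; the denominators are cleared. *)
Definition rational_on (phi : E -> E) :=
  exists (H : {poly R}) (d : R), d != 0 /\
    {in s, forall z, iota d * phi z = H^i.[z]}.

Let iota_neq0 d : d != 0 -> iota d != 0.
Proof. by move=> d0; rewrite -(rmorph0 iota) (inj_eq iota_inj). Qed.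

Lemma rational_on_ext phi psi : {in s, phi =1 psi} ->
  rational_on phi -> rational_on psi.
Proof.
move=> e [H [d [d0 Hd]]]; exists H, d; split=> // z zs.
by rewrite -e // Hd.
Qed.

Lemma rational_on_poly H : rational_on (fun z => H^i.[z]).
Proof. by exists H, 1; rewrite oner_neq0; split=> // z _; rewrite rmorph1 mul1r. Qed.

Lemma rational_on1 : rational_on (fun=> 1).
Proof.
by apply: rational_on_ext (rational_on_poly 1) => z _; rewrite rmorph1 hornerC.
Qed.

Lemma rational_onM phi psi : rational_on phi -> rational_on psi ->
  rational_on (fun z => phi z * psi z).
Proof.
move=> [H [d [d0 Hd]]] [K [e [e0 He]]]; exists (H * K), (d * e).
split=> [|z zs]; first exact: mulf_neq0.
by rewrite !rmorphM hornerM /= -Hd // -He // mulrACA.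
Qed.

Lemma rational_onD phi psi : rational_on phi -> rational_on psi ->
  rational_on (fun z => phi z + psi z).
Proof.
move=> [H [d [d0 Hd]]] [K [e [e0 He]]]; exists (e *: H + d *: K), (d * e).
split=> [|z zs]; first exact: mulf_neq0.
rewrite rmorphD hornerD /= !map_polyZ !hornerZ /= -Hd // -He // rmorphM.
by ring.
Qed.

Lemma rational_onX phi n : rational_on phi -> rational_on (fun z => phi z ^+ n).
Proof.
move=> Hphi; elim: n => [|n IH]; first exact: rational_on1.
by apply: rational_on_ext (rational_onM Hphi IH) => z _; rewrite exprS.
Qed.

Lemma rational_on_prod (I : Type) (r : seq I) (phi : I -> E -> E) :
  (forall i, rational_on (phi i)) -> rational_on (fun z => \prod_(i <- r) phi i z).
Proof.
move=> Hphi; elim: r => [|i r IH].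
  by apply: rational_on_ext rational_on1 => z _; rewrite big_nil.
by apply: rational_on_ext (rational_onM (Hphi i) IH) => z _; rewrite big_cons.
Qed.

Lemma rational_on_sum (I : eqType) (r : seq I) (phi : I -> E -> E) :
  {in r, forall i, rational_on (phi i)} ->
  rational_on (fun z => \sum_(i <- r) phi i z).
Proof.
elim: r => [|i r IH] Hphi.
  apply: rational_on_ext (rational_on_poly 0) => z _.
  by rewrite big_nil rmorph0 horner0.
have Hr : {in r, forall i, rational_on (phi i)}.
  by move=> j jr; apply: Hphi; rewrite inE jr orbT.
apply: rational_on_ext (rational_onD (Hphi i (mem_head _ _)) (IH Hr)) => z _.
by rewrite big_cons.
Qed.

(** As [phi] has no zero among the roots, [H] is coprime to [Psi]. A Bezout relation
    [u H + v Psi = c], with [c] a nonzero constant of [R], evaluated at a root gives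
    [1 / phi = d u / c]. *)
Lemma rational_onV phi : {in s, forall z, phi z != 0} ->
  rational_on phi -> rational_on (fun z => (phi z)^-1).
Proof.
move=> phi0 [H [d [d0 Hd]]].
have H0 z : z \in s -> H^i.[z] != 0.
  by move=> zs; rewrite -Hd // mulf_neq0 ?phi0 ?iota_neq0.
have cop : coprimep H Psi.
  rewrite coprimep_def; set g := gcdp H Psi.
  have [/Pdiv.Idomain.dvdpP[[c q] /= c0 Hq] /Pdiv.Idomain.dvdpP[[c' q'] /= c'0 Pq]] :
    g %| H /\ g %| Psi by rewrite dvdp_gcdl dvdp_gcdr.
  have gP : g^i %| \prod_(z <- s) ('X - z%:P).
    rewrite -Psi_split -(dvdpZr _ _ (iota_neq0 c'0)) -map_polyZ Pq rmorphM.
    exact: dvdp_mull.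
  have gc : coprimep g^i (\prod_(z <- s) ('X - z%:P)).
    elim: (s) (fun z => H0 z) => [|z r IH] r0; first by rewrite big_nil coprimep1.
    rewrite big_cons coprimepMr IH ?andbT => [|y yr]; last first.
      by apply: r0; rewrite inE yr orbT.
    rewrite coprimep_XsubC; apply: contra (r0 z (mem_head _ _)) => gz.
    have := congr1 (fun p => (p^i).[z]) Hq.
    rewrite map_polyZ rmorphM hornerM hornerZ (rootP gz) mulr0 => /eqP.
    by rewrite mulf_eq0 (negPf (iota_neq0 c0)).
  move: (coprimepP _ _ gc g^i (dvdpp _) gP).
  by rewrite -size_poly_eq1 size_map_inj_poly // rmorph0.
have /Bezout_coprimepP[[u v]] /= := cop.
rewrite -size_poly_eq1 => /size_poly1P[c c0 uv].
exists (d *: u), c; split=> // z zs.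
have := congr1 (fun p => (p^i).[z]) uv.
rewrite rmorphD !rmorphM hornerD !hornerM /= Psi_split -(Hd z zs) map_polyC hornerC.
rewrite (_ : (\prod_(z <- s) ('X - z%:P)).[z] = 0) ?mulr0 ?addr0; last first.
  by apply/rootP; rewrite root_prod_XsubC.
move=> <-; rewrite map_polyZ hornerZ /= !mulrA mulfK ?phi0 //.
by rewrite mulrC.
Qed.

(** Lagrange interpolation. With [Q_z = Psi / (X - z)] one has [Psi'(z) = Q_z(z)], so [H Psi'] and
    the sum of the [H(z) Q_z] agree at all roots, and the latter is the remainder of the former
    modulo [Psi]. Its coefficient of degree [size s - 1] is the sum of the [H(z)]; it lies in [R]
    because [Psi] is monic. *)
Lemma rational_on_trace phi : rational_on phi ->
  exists g d : R, d != 0 /\ iota d * \sum_(z <- s) phi z = iota g.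
Proof.
move=> [H [d [d0 Hd]]]; case: (posnP (size s)) => [s0|s0].
  exists 0, d; split=> //; case: (s) s0 => // _.
  by rewrite big_nil mulr0 rmorph0.
pose r := Pdiv.Ring.rmodp (H * Psi^`()) Psi.
exists (r`_(size s).-1), d; split=> //.
pose Q z := \prod_(z' <- s | z' != z) ('X - z'%:P).
have PQ z : z \in s -> Psi^i = ('X - z%:P) * Q z.
  by move=> zs; rewrite Psi_split (bigD1_seq z).
have szPsi : size Psi = (size s).+1.
  by rewrite -(size_map_inj_poly iota_inj) ?rmorph0 // Psi_split size_prod_XsubC.
have szQ z : z \in s -> size (Q z) = size s.
  move=> zs; rewrite /Q -big_filter size_prod_XsubC size_filter.
  rewrite -(count_predC (pred1 z) s) count_uniq_mem // zs add1n; congr (_.+1).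
have Q_monic z : Q z \is monic by apply: monic_prod => ? _; apply: monicXsubC.
have rE z : z \in s -> r^i.[z] = H^i.[z] * (Q z).[z].
  move=> zs; have := Pdiv.RingMonic.rdivp_eq Psi_monic (H * Psi^`()).
  move/(congr1 (fun p => (p^i).[z])); rewrite -/r.
  rewrite rmorphD !rmorphM hornerD !hornerM /= -deriv_map (PQ z zs) derivM.
  rewrite hornerD !hornerM derivXsubC hornerXsubC hornerC subrr mul1r.
  by rewrite !(mul0r, mulr0, add0r, addr0) => <-.
pose r0 := \sum_(z <- s) H^i.[z] *: Q z.
have r0E z : z \in s -> r0.[z] = H^i.[z] * (Q z).[z].
  move=> zs; rewrite /r0 horner_sum (bigD1_seq z) //= hornerZ big1_seq ?addr0 //.
  move=> y /andP[yz ys]; rewrite hornerZ (_ : (Q y).[z] = 0) ?mulr0 //.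
  apply/rootP; rewrite /Q -big_filter root_prod_XsubC mem_filter zs andbT.
  by rewrite eq_sym.
have szr0 : (size r0 <= size s)%N.
  apply: leq_trans (size_sum _ _ _) _; apply/bigmax_leqP_seq => z zs _.
  by apply: leq_trans (size_scale_leq _ _) _; rewrite szQ.
have szr : (size r^i <= size s)%N.
  rewrite size_map_inj_poly ?rmorph0 // -ltnS -szPsi.
  by rewrite Pdiv.Ring.ltn_rmodp monic_neq0.
have e : r^i = r0.
  apply/eqP; rewrite -subr_eq0; apply/negPn/negP => nz.
  have := max_poly_roots nz _ s_uniq.
  have -> : all (root (r^i - r0)) s.
    by apply/allP => z zs; rewrite rootE hornerD hornerN rE // r0E // subrr.
  move=> /(_ isT); rewrite ltnNge => /negP; apply.
  by rewrite (leq_trans (size_polyD _ _)) // geq_max szr size_polyN szr0.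
have <- : r^i`_(size s).-1 = iota r`_(size s).-1 by rewrite coef_map.
rewrite e /r0 coef_sum mulr_sumr; apply: eq_big_seq => z zs.
by rewrite coefZ -(szQ z zs) -lead_coefE (monicP (Q_monic z)) mulr1 Hd.
Qed.

End RationalFunctions.

(** * Polynomial rings in one variable are integrally closed *)

Section IntegralClosure.
Variables (F E : fieldType) (iota : {rmorphism {poly F} -> E}).
Hypothesis iota_inj : injective iota.

(** The rational root argument: for [T = g1 / d1] in lowest terms, the monic equation times [d1 ^ n]
    shows [d1 | g1 ^ n], so [d1] is constant. *)
Lemma integral_rational_poly (T : E) (g d : {poly F}) :
  d != 0 -> iota d * T = iota g -> integralOver iota T -> exists G, T = iota G.
Proof.
move=> d0 dT [p p_monic /rootP pT].
pose k := gcdp d g; pose d1 := d %/ k; pose g1 := g %/ k.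
have k0 : k != 0 by rewrite gcdp_eq0 (negPf d0).
have dE : d1 * k = d by rewrite divpK ?dvdp_gcdl.
have gE : g1 * k = g by rewrite divpK ?dvdp_gcdr.
have i0 h : h != 0 -> iota h != 0.
  by move=> h0; rewrite -(rmorph0 iota) (inj_eq iota_inj).
have d1T : iota d1 * T = iota g1.
  by apply: (mulIf (i0 _ k0)); rewrite -[RHS]rmorphM gE -dT -dE rmorphM mulrAC.
have d10 : d1 != 0 by apply: contraNneq d0 => d1z; rewrite -dE d1z mul0r.
have cop : coprimep d1 g1 by rewrite coprimep_div_gcd // d0.
pose n := (size p).-1.
have szp : size p = n.+1 by rewrite prednK // size_poly_gt0 monic_neq0.
have H : \sum_(i < n.+1) p`_i * g1 ^+ i * d1 ^+ (n - i) = 0.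
  apply: iota_inj; rewrite rmorph0 rmorph_sum /=.
  transitivity (iota d1 ^+ n * (map_poly iota p).[T]); last by rewrite pT mulr0.
  rewrite horner_coef size_map_poly_id0; last first.
    by rewrite (monicP p_monic) rmorph1 oner_neq0.
  rewrite szp mulr_sumr; apply: eq_bigr => i _.
  rewrite coef_map !rmorphM !rmorphXn /= -d1T exprMn.
  have -> : iota d1 ^+ n = iota d1 ^+ i * iota d1 ^+ (n - i).
    by rewrite -exprD subnKC // -ltnS.
  by ring.
have : d1 %| g1 ^+ n.
  move: H; rewrite big_ord_recr /= subnn expr0 mulr1.
  have -> : p`_n = 1 by rewrite -(monicP p_monic) lead_coefE.
  rewrite mul1r => /eqP; rewrite addrC addr_eq0 => /eqP ->.
  rewrite dvdpNr; elim/big_ind: _ => [|x y|i _]; [exact: dvdp0|exact: dvdp_add|].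
  apply: dvdp_mull; rewrite -(subnSK (ltn_ord i)) exprS; exact: dvdp_mulr.
move=> dvd; have : coprimep d1 (g1 ^+ n) by rewrite coprimep_expr.
move=> /coprimepP /(_ d1 (dvdpp _) dvd); rewrite -size_poly_eq1.
move=> /size_poly1P[c c0 d1c].
exists (c^-1 *: g1); rewrite -mul_polyC rmorphM -d1T d1c mulrA -rmorphM.
by rewrite -polyCM mulVf // rmorph1 mul1r.
Qed.

End IntegralClosure.

(** * Division polynomials and the trace over the torsion lines *)

Section DivisionPolynomials.
Variables (R : idomainType) (E : fieldType) (iota : {rmorphism R -> E}).
Variables (c : R) (alpha : E).
Hypothesis c_alpha : iota c * alpha = 1.
Local Notation "p ^i" := (map_poly iota p) (at level 2, format "p ^i").

(* The addition formulas in characteristic 2 of a pair of theta functions, along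
   the multiples of one point: [theta_addA] and [theta_addB] express the products
   at [x + y] and [x - y] for [x = d + a] and [y = a]. *)
Record theta_seq (A B : nat -> E) : Prop := ThetaSeq {
  theta_A0 : A 0%N = 1;
  theta_B0 : B 0%N = 0;
  theta_addA : forall a d,
    A (d + a.*2)%N * A d = (A (d + a)%N * A a + B (d + a)%N * B a) ^+ 2;
  theta_addB : forall a d,
    B (d + a.*2)%N * B d = (A (d + a)%N * B a + A a * B (d + a)%N) ^+ 2;
  theta_dblB : forall a, alpha * B a.*2 = (A a * B a) ^+ 2 }.

Lemma theta_seq_dil A B n :
  theta_seq A B -> theta_seq (fun k => A (k * n)%N) (fun k => B (k * n)%N).
Proof.
case=> A0 B0 aA aB dB; split=> [||a d|a d|a]; rewrite ?mul0n //.
- by rewrite !mulnDl -!mul2n -mulnA mul2n.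
- by rewrite !mulnDl -!mul2n -mulnA mul2n.
- by rewrite -mul2n -mulnA mul2n.
Qed.

(** The coefficient [a] may be [0]: a mere degree bound is then also covered, and sums and products
    need no case distinction. *)
Definition top (p : {poly R}) d a := (size p <= d.+1)%N /\ p`_d = a.

Lemma topM p q d e a b : top p d a -> top q e b -> top (p * q) (d + e) (a * b).
Proof.
move=> [szp <-] [szq <-]; split.
  have [->|p0] := eqVneq p 0; first by rewrite mul0r size_poly0.
  have [->|q0] := eqVneq q 0; first by rewrite mulr0 size_poly0.
  by rewrite size_mul //; lia.
rewrite coefM (bigD1 (Ordinal (leq_addr e d : (d < (d + e).+1)%N))) //=.
rewrite addKn big1 ?addr0 // => i id; case: (ltnP d i) => di.
  by rewrite nth_default ?mul0r // (leq_trans szp).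
have {}id : (i < d)%N by rewrite ltn_neqAle di andbT.
by rewrite [q`__]nth_default ?mulr0 // (leq_trans szq) //; lia.
Qed.

Lemma topD p q d a b : top p d a -> top q d b -> top (p + q) d (a + b).
Proof.
move=> [szp <-] [szq <-]; split; last by rewrite coefD.
by rewrite (leq_trans (size_polyD _ _)) // geq_max szp.
Qed.

Lemma top_ltn p d e a : (d < e)%N -> top p d a -> top p e 0.
Proof.
move=> de [szp _]; split; first by rewrite (leq_trans szp) // ltnW.
by rewrite nth_default // (leq_trans szp).
Qed.

Lemma root0_factor (p : {poly R}) : root p 0 -> exists q, p = 'X * q.
Proof. by move/factor_theorem=> [q ->]; exists q; rewrite subr0 mulrC. Qed.

(* On a theta sequence the [n]-th pair evaluates at [A_1 / B_1] to
   [(A_n, B_n) / B_1^(n^2)]. *)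
Definition division_pair n (pb : {poly R} * {poly R}) :=
  [/\ top pb.1 (n ^ 2) 1, top pb.2 (n ^ 2).-1 (odd n)%:R,
      if odd n then root pb.1 0 else root pb.2 0
    & forall A B, theta_seq A B -> A 1%N != 0 -> B 1%N != 0 ->
        pb.1^i.[A 1%N / B 1%N] = A n / B 1%N ^+ (n ^ 2) /\
        pb.2^i.[A 1%N / B 1%N] = B n / B 1%N ^+ (n ^ 2)].

Lemma division_pair0 : division_pair 0 (1, 0).
Proof.
split=> /=; first by split; rewrite ?size_poly1 ?coef1.
- by split; rewrite ?size_poly0 ?coef0.
- exact: root0.
move=> A B AB _ _; rewrite rmorph1 rmorph0 hornerC horner0.
by rewrite (theta_A0 AB) (theta_B0 AB) expr0 divr1 mul0r.
Qed.

Lemma division_pair1 : division_pair 1 ('X, 1).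
Proof.
split=> /=; first by split; rewrite ?size_polyX ?coefX.
- by split; rewrite ?size_poly1 ?coef1.
- by rewrite rootX.
move=> A B AB A0 B0; rewrite map_polyX rmorph1 hornerX hornerC expr1.
by rewrite divff.
Qed.

Lemma division_pair_even n p b : (0 < n)%N -> division_pair n (p, b) ->
  division_pair n.*2 ((p + b) ^+ 4, c *: (p ^+ 2 * b ^+ 2)).
Proof.
move=> n0 [/= tp tb r0 ev].
have n20 : (0 < n ^ 2)%N by rewrite expn_gt0 n0.
split=> /=.
- have tpb : top (p + b) (n ^ 2) 1.
    by rewrite -[1]addr0; apply: topD tp (top_ltn _ tb); rewrite prednK.
  have := topM (topM tpb tpb) (topM tpb tpb).
  rewrite !mulr1 -!expr2 -exprM; congr (top _ _ _).
  by rewrite -mul2n expnMn; lia.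
- have := topM (topM tp tp) (topM tb tb); rewrite -!expr2 !expr1n mul1r => t.
  have tc : top c%:P 0 c by split; rewrite ?coefC // size_polyC; case: eqP.
  have := topM tc t; rewrite mul_polyC odd_double => {}t.
  by apply: top_ltn t; rewrite -mul2n expnMn; lia.
- rewrite odd_double rootE hornerZ hornerM !horner_exp.
  by case: (odd n) r0 => /rootP ->; rewrite expr0n ?(mul0r, mulr0).
move=> A B AB A0 B0; have [pE bE] := ev A B AB A0 B0.
have e4 : ((n.*2) ^ 2 = 4 * n ^ 2)%N by rewrite -mul2n expnMn.
have cal (x y : E) : alpha * x = y -> x = iota c * y.
  by move=> <-; rewrite mulrA c_alpha mul1r.
split.
  rewrite rmorphXn rmorphD horner_exp hornerD pE bE -mulrDl expr_div_n.
  rewrite e4 mulnC exprM; congr (_ / _).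
  have := theta_addA AB n 0; rewrite !add0n (theta_A0 AB) mulr1 => ->.
  (* As [B_0 = 0], the formula for [B] at [d = 0] yields [2 A_n B_n = 0], which turns
     [(A_n^2 + B_n^2)^2] into [(A_n + B_n)^4]. *)
  have := theta_addB AB n 0; rewrite !add0n (theta_B0 AB) mulr0 => /esym/eqP.
  rewrite sqrf_eq0 [A n * _]mulrC -mulr2n -mulr_natl.
  set u := A n; set v := B n => /eqP uv.
  have -> : (u + v) ^+ 4 = (u * u + v * v) ^+ 2 +
     2%:R * (v * u) * (2%:R * (u ^+ 2 + v ^+ 2) + 2%:R * (v * u)) by ring.
  by rewrite uv mul0r addr0.
rewrite map_polyZ rmorphM !rmorphXn hornerZ hornerM !horner_exp pE bE.
rewrite (cal _ _ (theta_dblB AB n)) e4 -mulrA; congr (_ * _).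
rewrite -exprMn mulf_div expr_div_n -exprD -exprM.
by congr (_ / _ ^+ _); lia.
Qed.

Lemma division_pair_odd n p b p' b' : (0 < n)%N ->
  division_pair n (p, b) -> division_pair n.+1 (p', b') ->
  exists q, division_pair n.*2.+1 (q, (p' * b + p * b') ^+ 2).
Proof.
move=> n0 [/= tp tb r0 ev] [/= tp' tb' r0' ev'].
have n20 : (0 < n ^ 2)%N by rewrite expn_gt0 n0.
(* One of [n], [n + 1] is odd and the other even, so both products vanish at 0. The addition formula
   computes [A_(2n+1) A_1], and the factor ['X] permits the division by [A_1]:
   [(w s)^2 / w = w s^2]. *)
have [s sE] : exists s, p' * p + b' * b = 'X * s.
  apply: root0_factor; rewrite rootE hornerD !hornerM /=.
  by case: (odd n) r0 r0' => /rootP -> /rootP ->; rewrite !(mul0r, mulr0) addr0.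
have e2 : ((n.*2.+1) ^ 2 = (2 * (n.+1 ^ 2 + n ^ 2)).-1)%N by rewrite -mul2n; lia.
have ts : top s (n.+1 ^ 2 + n ^ 2).-1 1.
  have : top (p' * p + b' * b) (n.+1 ^ 2 + n ^ 2) (1 + 0).
    apply: topD; first by rewrite -[1]mulr1; apply: topM.
    by apply: top_ltn (topM tb' tb); lia.
  rewrite sE addr0 => -[szs s1].
  have k0 : (0 < n.+1 ^ 2 + n ^ 2)%N by lia.
  split.
    have [->|sn0] := eqVneq s 0; first by rewrite size_poly0.
    by move: szs; rewrite mulrC size_mulX // prednK.
  by move: s1; rewrite coefXM eqn0Ngt k0.
exists ('X * s ^+ 2); split=> /=.
- have tX : top 'X 1 1 by split; rewrite ?size_polyX ?coefX.
  have := topM tX (topM ts ts); rewrite -expr2 !mul1r; congr (top _ _ _); lia.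
- have t : top (p' * b + p * b') (n.+1 ^ 2 + n ^ 2).-1 1.
    have -> : 1 = 1 * (odd n)%:R + 1 * (odd n.+1)%:R :> R.
      by rewrite /= !mul1r; case: (odd n); rewrite ?addr0 ?add0r.
    apply: topD.
      have -> : ((n.+1 ^ 2 + n ^ 2).-1 = n.+1 ^ 2 + (n ^ 2).-1)%N by lia.
      exact: topM.
    have -> : ((n.+1 ^ 2 + n ^ 2).-1 = n ^ 2 + (n.+1 ^ 2).-1)%N by lia.
    exact: topM.
  have := topM t t; rewrite -expr2 mulr1 odd_double; congr (top _ _ _); lia.
- by rewrite odd_double /= rootE hornerM hornerX mul0r.
move=> A B AB A0 B0; have [pE bE] := ev A B AB A0 B0.
have [pE' bE'] := ev' A B AB A0 B0.
set w := A 1%N / B 1%N in pE bE pE' bE' *.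
have w0 : w != 0 by rewrite mulf_neq0 ?invr_eq0.
have dE : ((n.+1 ^ 2 + n ^ 2) * 2 = (n.*2.+1 ^ 2).+1)%N by lia.
have Bd (x y z u : E) : x / B 1%N ^+ (n.+1 ^ 2) * (y / B 1%N ^+ (n ^ 2)) +
    z / B 1%N ^+ (n.+1 ^ 2) * (u / B 1%N ^+ (n ^ 2)) =
    (x * y + z * u) / B 1%N ^+ (n.+1 ^ 2 + n ^ 2).
  by rewrite !mulf_div -exprD -mulrDl.
split.
  apply: (mulfI w0); rewrite rmorphM rmorphXn /= map_polyX hornerM hornerX horner_exp.
  have : (w * s^i.[w]) ^+ 2 = w * (w * s^i.[w] ^+ 2) by rewrite exprMn expr2 mulrA.
  move=> <-.
  have -> : w * s^i.[w] = (p' * p + b' * b)^i.[w].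
    by rewrite sE rmorphM /= map_polyX hornerM hornerX.
  rewrite rmorphD !rmorphM hornerD !hornerM pE pE' bE bE' Bd expr_div_n -exprM dE.
  have := theta_addA AB n 1; rewrite !add1n => <-.
  by rewrite /w exprS mulf_div [A 1%N * _]mulrC.
rewrite rmorphXn rmorphD !rmorphM horner_exp hornerD !hornerM pE pE' bE bE'.
rewrite [A n / _ * _]mulrC Bd expr_div_n -exprM dE.
have := theta_addB AB n 1; rewrite !add1n [A n * B n.+1]mulrC => <-.
by rewrite exprSr -mulf_div divff // mulr1.
Qed.

Lemma division_polys : exists pb, forall n, division_pair n (pb n).
Proof.
suff /choice[pb H] : forall n, exists pb, division_pair n pb by exists pb.
move=> n.
elim/ltn_ind: n => -[_|[_|n IH]]; [by exists (1, 0); apply: division_pair0|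
  by exists ('X, 1); apply: division_pair1|].
case: (boolP (odd n)) => on.
  have nE : (n.+2 = (n.+1./2).*2.+1)%N.
    by rewrite -[in LHS](odd_double_half n.+1) /= on.
  have [|[p b] H] := IH n.+1./2; first by lia.
  have [|[p' b'] H'] := IH (n.+1./2).+1; first by lia.
  rewrite nE; have [|q Hq] := @division_pair_odd _ _ _ _ _ _ H H'; first by lia.
  by exists (q, (p' * b + p * b') ^+ 2).
have nE : (n.+2 = (n.+2./2).*2)%N.
  by rewrite -[in LHS](odd_double_half n.+2) /= negbK (negPf on).
have [|[p b] H] := IH n.+2./2; first by lia.
by rewrite nE; eexists; apply: division_pair_even H; lia.
Qed.

End DivisionPolynomials.

(** * Residues modulo an odd prime, up to sign *)

Section HalfSystem.
Variables (l m : nat).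
Hypothesis lE : l = m.*2.+1.

(** The representative in [0..m] of the class of [k] modulo [l] and sign. *)
Definition half_residue k := let r := (k %% l)%N in if (r <= m)%N then r else (l - r)%N.

Lemma half_residue_leq k : (half_residue k <= m)%N.
Proof.
rewrite /half_residue; case: (leqP (k %% l)) => //; move: (k %% l)%N => r; lia.
Qed.

Lemma half_residue_gt0 k : ~~ (l %| k)%N -> (0 < half_residue k)%N.
Proof.
rewrite /half_residue /dvdn -lt0n => k0; case: (leqP (k %% l)) => // h.
by rewrite subn_gt0 ltn_pmod // lE.
Qed.

Section Symmetric.
Variables (T : Type) (g : nat -> T).
Hypothesis g_per : forall n, g (n + l)%N = g n.
Hypothesis g_refl : forall n, (n <= l)%N -> g (l - n)%N = g n.

Lemma periodic_mod k : g k = g (k %% l)%N.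
Proof.
rewrite {1}(divn_eq k l) addnC; elim: (k %/ l)%N => [|d IH]; first by rewrite addn0.
by rewrite mulSn addnCA addnC g_per.
Qed.

Lemma half_residueE k : g (half_residue k) = g k.
Proof.
rewrite [RHS]periodic_mod /half_residue; case: ifP => // _.
by rewrite g_refl // ltnW // ltn_pmod // lE.
Qed.

Lemma symmetric_opp j k : (l %| j + k)%N -> g j = g k.
Proof.
move=> jk; rewrite [LHS]periodic_mod [RHS]periodic_mod.
have lk : (k %% l < l)%N by rewrite ltn_pmod // lE.
have lj : (j %% l < l)%N by rewrite ltn_pmod // lE.
move: jk; rewrite /dvdn -modnDm -/(dvdn _ _) => /dvdnP[q jk].
have [k0|k0] := posnP (k %% l)%N.
  by rewrite k0; case: q jk => [|q] jk; congr (g _); lia.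
have -> : (j %% l = l - k %% l)%N by case: q jk => [|[|q]]; lia.
by rewrite g_refl // ltnW.
Qed.
End Symmetric.

Hypothesis l_prime : prime l.

Lemma half_residue_mul_inj n : ~~ (l %| n)%N ->
  {in index_iota 1 m.+1 &, injective (fun k => half_residue (k * n))}.
Proof.
move=> ln j k; rewrite !mem_index_iota => /andP[j0 jm] /andP[k0 km].
have l0 : (0 < l)%N by rewrite lE.
have cop : coprime l n by rewrite prime_coprime.
have sgn x y : half_residue x = half_residue y -> (l %| x + y)%N \/ x = y %[mod l].
  rewrite /half_residue; have := ltn_pmod x l0; have := ltn_pmod y l0.
  rewrite /dvdn -modnDm -/(dvdn _ _).
  case: ifP => _; case: ifP => _ xl yl e; [by right| left | left |right; lia].
    by rewrite e subnK ?dvdnn // ltnW.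
  by rewrite -e subnKC ?dvdnn // ltnW.
case/sgn; first by rewrite -mulnDl Gauss_dvdl // => /dvdn_leq; lia.
case: (leqP j k) => jk /eqP; last first.
  rewrite eqn_mod_dvd ?leq_mul2r ?(ltnW jk) ?orbT // -mulnBl Gauss_dvdl //.
  by move=> /dvdn_leq; lia.
rewrite eq_sym eqn_mod_dvd ?leq_mul2r ?jk ?orbT // -mulnBl Gauss_dvdl //.
by move=> /dvdn_leq; lia.
Qed.

(** As in Gauss's lemma on quadratic residues: multiplication by [n] is injective on the nonzero
    classes up to sign, and there are finitely many. *)
Lemma half_residue_perm n : ~~ (l %| n)%N ->
  perm_eq [seq half_residue (k * n) | k <- index_iota 1 m.+1] (index_iota 1 m.+1).
Proof.
move=> ln; set s := index_iota _ _.
have us : uniq [seq half_residue (k * n) | k <- s].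
  by rewrite map_inj_in_uniq ?iota_uniq //; apply: half_residue_mul_inj.
apply: uniq_perm; rewrite ?iota_uniq //.
have ss : {subset [seq half_residue (k * n) | k <- s] <= s}.
  move=> _ /mapP[k ks ->]; rewrite mem_index_iota ltnS half_residue_leq andbT.
  apply: half_residue_gt0; rewrite Euclid_dvdM // negb_or ln andbT.
  by move: ks; rewrite mem_index_iota => /andP[k0 km]; rewrite gtnNdvd //; lia.
by case: (uniq_min_size us ss); rewrite ?size_map.
Qed.

(** Makes sums and products along a torsion line independent of the point chosen to generate it. *)
Lemma big_half_system (T : Type) (idx : T) (op : Monoid.com_law idx) (g : nat -> T) n :
  (forall n, g (n + l)%N = g n) -> (forall n, (n <= l)%N -> g (l - n)%N = g n) ->
  ~~ (l %| n)%N ->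
  \big[op/idx]_(1 <= k < m.+1) g (k * n)%N = \big[op/idx]_(1 <= k < m.+1) g k.
Proof.
move=> gp gr ln; rewrite -[RHS](perm_big _ (half_residue_perm ln)) big_map.
by apply: eq_bigr => k _; rewrite half_residueE.
Qed.

End HalfSystem.

Lemma integral_rootn (R : comNzRingType) (E : fieldType) (iota : {rmorphism R -> E})
    (u : E) n : (0 < n)%N -> integralOver iota (u ^+ n) -> integralOver iota u.
Proof.
move=> n0 un; apply: (@integral_root_monic _ _ _ _ ('X^n - (u ^+ n)%:P)).
- exact: monicXnsubC.
- by rewrite rootE hornerD hornerN hornerC hornerXn subrr.
apply/integral_poly => i; rewrite coefB coefXn coefC.
apply: integral_sub; first exact: integral_nat.
by case: eqP => _ //; apply: mxpoly.integral0.
Qed.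

Lemma integral_exp (R : comNzRingType) (E : fieldType) (iota : {rmorphism R -> E})
    (u : E) n : integralOver iota u -> integralOver iota (u ^+ n).
Proof.
move=> iu; elim: n => [|n IH]; first exact: integral1.
by rewrite exprS; apply: integral_mul.
Qed.

Lemma integral_bigsum (R : comNzRingType) (E : fieldType) (iota : {rmorphism R -> E})
    (I : Type) (r : seq I) (P : pred I) (f : I -> E) :
  (forall i, P i -> integralOver iota (f i)) ->
  integralOver iota (\sum_(i <- r | P i) f i).
Proof.
move=> H; elim/big_ind: _ => //; [exact: mxpoly.integral0|exact: integral_add].
Qed.

Lemma integral_bigprod (R : comNzRingType) (E : fieldType) (iota : {rmorphism R -> E})
    (I : eqType) (r : seq I) (f : I -> E) :
  {in r, forall i, integralOver iota (f i)} ->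
  integralOver iota (\prod_(i <- r) f i).
Proof.
move=> H; rewrite big_seq; elim/big_ind: _ => //; [exact: integral1|exact: integral_mul].
Qed.

(** * The trace over the torsion lines is a polynomial in [1/eta] *)

Section Trace.
Variables (F E : fieldType) (iota : {rmorphism {poly F} -> E}).
Hypothesis iota_inj : injective iota.
Hypothesis E2 : 2%N \in [pchar E].
Variable eta : E.
Hypothesis eta_x : iota 'X * eta = 1.
Variables (l m : nat).
Hypothesis lE : l = m.*2.+1.
Hypothesis m0 : (0 < m)%N.
Hypothesis l_prime : prime l.
Variables (I : finType) (A B : I -> nat -> E).
Hypothesis card_I : #|I| = l.+1.
Hypothesis theta : forall C, theta_seq (eta ^+ 3) (A C) (B C).
Hypothesis A_per : forall C n, A C (n + l)%N = A C n.
Hypothesis B_per : forall C n, B C (n + l)%N = B C n.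
Hypothesis A_refl : forall C n, (n <= l)%N -> A C (l - n)%N = A C n.
Hypothesis B_refl : forall C n, (n <= l)%N -> B C (l - n)%N = B C n.
Hypothesis A_nz : forall C n, (0 < n <= m)%N -> A C n != 0.
Hypothesis B_nz : forall C n, (0 < n <= m)%N -> B C n != 0.
Hypothesis W_inj : forall C D j k, (0 < j <= m)%N -> (0 < k <= m)%N ->
  A C j / B C j = A D k / B D k -> C = D /\ j = k.
Hypothesis r_nz : forall C, \sum_(1 <= k < m.+1) B C k / A C k != 0.

Let c : {poly F} := 'X ^+ 3.
Let c_alpha : iota c * eta ^+ 3 = 1.
Proof. by rewrite rmorphXn -exprMn eta_x expr1n. Qed.

Let eta0 : eta != 0.
Proof.
by apply/eqP => e0; move: eta_x; rewrite e0 mulr0 => /esym/eqP; rewrite oner_eq0.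
Qed.

Let A_neq0 C n : ~~ (l %| n)%N -> A C n != 0.
Proof.
move=> ln; rewrite -(half_residueE lE (A_per C) (A_refl C)); apply: A_nz.
by rewrite half_residue_gt0 // half_residue_leq.
Qed.

Let B_neq0 C n : ~~ (l %| n)%N -> B C n != 0.
Proof.
move=> ln; rewrite -(half_residueE lE (B_per C) (B_refl C)); apply: B_nz.
by rewrite half_residue_gt0 // half_residue_leq.
Qed.

Let small_Ndvd n : (0 < n <= m)%N -> ~~ (l %| n)%N.
Proof. by case/andP=> n0 nm; rewrite gtnNdvd //; lia. Qed.

Let pairs := [seq (C, n) | C <- enum I, n <- index_iota 1 m.+1].
Let W C n := A C n / B C n.
Let roots := [seq W p.1 p.2 | p <- pairs].

Let mem_pairs p : p \in pairs -> (0 < p.2 <= m)%N.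
Proof. by case/allpairsP=> -[C n] /= [_]; rewrite mem_index_iota => ? ->. Qed.

Let roots_uniq : uniq roots.
Proof.
rewrite map_inj_in_uniq ?allpairs_uniq ?enum_uniq ?iota_uniq //; first by case=> ? ? [].
move=> [C j] [D k] /mem_pairs /= jm /mem_pairs /= km.
by case/(W_inj jm km) => -> ->.
Qed.

Let size_roots : size roots = (m.+1 ^ 2 + (m ^ 2).-1)%N.
Proof.
rewrite size_map size_allpairs -cardE card_I size_iota lE.
have : (0 < m ^ 2)%N by rewrite expn_gt0 m0.
by lia.
Qed.

Lemma trace_poly t : (6 %| t * (m * m.+1))%N ->
  exists G, \sum_C (eta ^+ m.-1 / \prod_(1 <= k < m.+1) B C k) ^+ t = iota G.
Proof.
move=> /dvdnP[e te].
have [pb dp] := division_polys c_alpha.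
pose p n := (pb n).1; pose b n := (pb n).2.
have ev C k n : (0 < k <= m)%N ->
    (map_poly iota (p n)).[W C k] = A C (n * k)%N / B C k ^+ (n ^ 2) /\
    (map_poly iota (b n)).[W C k] = B C (n * k)%N / B C k ^+ (n ^ 2).
  move=> km; case: (dp n) => _ _ _ /(_ _ _ (theta_seq_dil k (theta C))).
  by rewrite !mul1n; apply; [apply: A_nz|apply: B_nz].
(* The odd step of the recursion produces [psi ^ 2] for the index [l = 2 m + 1], where
   [B_l = B_0 = 0]. Directly: [(m + 1) k = - m k] modulo [l], so at [W C k] both products agree and
   cancel in characteristic 2. The degree [(m + 1)^2 + m^2 - 1 = m (l + 1)] leaves no room for
   further roots. *)
pose psi := p m.+1 * b m + p m * b m.+1.
have psi_top : top psi (m.+1 ^ 2 + (m ^ 2).-1) 1.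
  case: (dp m) (dp m.+1) => tp tb _ _ [tp' tb' _ _].
  have -> : 1 = 1 * (odd m)%:R + 1 * (odd m.+1)%:R :> {poly F}.
    by rewrite /= !mul1r; case: (odd m); rewrite ?addr0 ?add0r.
  apply: topD; first exact: topM.
  have -> : (m.+1 ^ 2 + (m ^ 2).-1 = m ^ 2 + (m.+1 ^ 2).-1)%N by lia.
  exact: topM.
have size_psi : size psi = (size roots).+1.
  rewrite size_roots; case: psi_top => sz c1; apply/eqP; rewrite eqn_leq sz ltnNge.
  by apply/negP => /(nth_default 0) /eqP; rewrite c1 oner_eq0.
have psi_monic : psi \is monic.
  rewrite monicE lead_coefE size_psi /= size_roots.
  by case: psi_top => _ ->.
have opp C k : A C (m.+1 * k)%N = A C (m * k)%N /\ B C (m.+1 * k)%N = B C (m * k)%N.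
  have dv : (l %| m.+1 * k + m * k)%N.
    by rewrite -mulnDl addSn addnn -lE dvdn_mulr.
  split; first exact: (symmetric_opp lE (A_per C) (A_refl C) dv).
  exact: (symmetric_opp lE (B_per C) (B_refl C) dv).
have psi_root C k : (0 < k <= m)%N -> root (map_poly iota psi) (W C k).
  move=> km; rewrite rootE rmorphD !rmorphM hornerD !hornerM.
  have [-> ->] := ev C k m km; have [-> ->] := ev C k m.+1 km.
  have [-> ->] := opp C k.
  by rewrite [X in X + _]mulrACA [X in _ + X]mulrACA [_^-1 * _]mulrC addrr_pchar2.
have psi_split : map_poly iota psi = \prod_(z <- roots) ('X - z%:P).
  have size_psii : size (map_poly iota psi) = (size roots).+1.
    by rewrite size_map_inj_poly // rmorph0.
  rewrite [LHS](all_roots_prod_XsubC size_psii) ?uniq_rootsE //.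
    by rewrite lead_coef_map_inj ?rmorph0 // (monicP psi_monic) rmorph1 scale1r.
  by apply/allP => _ /mapP[[C k] /mem_pairs /= km ->]; apply: psi_root.
have W_int C n : ~~ (l %| n)%N -> integralOver iota (W C n).
  move=> ln; have -> : W C n = W C (half_residue l m n).
    by rewrite /W (half_residueE lE (A_per C) (A_refl C)) (half_residueE lE (B_per C) (B_refl C)).
  exists psi => //; apply: psi_root.
  by rewrite half_residue_gt0 // half_residue_leq.
pose beta C := \prod_(1 <= k < m.+1) B C k.
have beta0 C : beta C != 0.
  rewrite prodf_seq_neq0; apply/allP => k; rewrite mem_index_iota => km.
  exact: B_nz.
pose T := \sum_C (eta ^+ m.-1 / beta C) ^+ t.
(* [be] interpolates [beta C ^+ t] on the line [C]: the product of the [b n] at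
   [W C k] is [beta C] over a power of [B C k] whose exponent, taken [t] times, is
   the multiple [l * e] of [l], and [bl] interpolates [B C k ^+ l]. Dividing by
   [z * rho z] gives each line total weight [1], even when its number [m] of
   points vanishes in [E]. *)
pose rho w := \sum_(1 <= n < m.+1) (map_poly iota (b n)).[w] / (map_poly iota (p n)).[w].
pose bl w := (map_poly iota (b m)).[w] / (map_poly iota (b m.+1)).[w].
pose be w := (\prod_(1 <= n < m.+1) (map_poly iota (b n)).[w]) ^+ t * bl w ^+ e.
have roots_ind (P : E -> Prop) : (forall C k, (0 < k <= m)%N -> P (W C k)) ->
    {in roots, forall z, P z}.
  by move=> H _ /mapP[[C k] /mem_pairs /= km ->]; apply: H.
have rhoE C k : (0 < k <= m)%N -> rho (W C k) = \sum_(1 <= n < m.+1) B C n / A C n.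
  move=> km; transitivity (\sum_(1 <= n < m.+1) B C (n * k)%N / A C (n * k)%N).
    apply: eq_bigr => n _; have [-> ->] := ev C k n km.
    by rewrite invf_div mulrA divfK // expf_neq0 // B_nz.
  apply: (@big_half_system _ _ lE l_prime _ _ _ (fun n => B C n / A C n)) => [n|n nl|].
  - by rewrite A_per B_per.
  - by rewrite A_refl ?B_refl.
  exact: small_Ndvd.
have blE C k : (0 < k <= m)%N -> bl (W C k) = B C k ^+ l.
  move=> km; rewrite /bl; have [_ ->] := ev C k m km; have [_ ->] := ev C k m.+1 km.
  have [_ ->] := opp C k; rewrite invf_div [LHS]mulrC mulrA divfK; last first.
    by apply: B_neq0; rewrite Euclid_dvdM // negb_or !small_Ndvd // m0 leqnn.
  have -> : (m.+1 ^ 2 = l + m ^ 2)%N by rewrite lE; lia.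
  by rewrite exprD mulfK // expf_neq0 // B_nz.
(* Together with [t m (m + 1) = 6 e] this makes [t] times the sum of squares equal to [l e]; it is
   the point where the divisibility by 6 is spent. *)
have sum_sq : (6 * \sum_(1 <= n < m.+1) n ^ 2 = m * m.+1 * l)%N.
  rewrite lE; elim: (m) => [|n IH]; first by rewrite big_geq.
  by rewrite big_nat_recr //= mulnDr IH; lia.
have beE C k : (0 < k <= m)%N -> be (W C k) = beta C ^+ t.
  move=> km; rewrite /be blE //.
  have -> : \prod_(1 <= n < m.+1) (map_poly iota (b n)).[W C k] =
     beta C / B C k ^+ (\sum_(1 <= n < m.+1) n ^ 2).
    rewrite /beta -(@big_half_system _ _ lE l_prime _ _ _ (B C) k) ?small_Ndvd //; last exact: B_refl.
    rewrite -prodrXr -prodf_div; apply: eq_bigr => n _.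
    by case: (ev C k n km).
  rewrite expr_div_n -!exprM -mulrA [X in _ * X]mulrC.
  have -> : ((\sum_(1 <= n < m.+1) n ^ 2) * t = l * e)%N by nia.
  by rewrite divff ?mulr1 // expf_neq0 // B_nz.
have Tsum : \sum_(z <- roots) (z^-1 * (rho z)^-1 * (be z)^-1) = \sum_C (beta C ^+ t)^-1.
  rewrite big_map big_allpairs -big_enum /=; apply: eq_bigr => C _.
  transitivity (\sum_(1 <= k < m.+1) (B C k / A C k) *
      ((\sum_(1 <= n < m.+1) B C n / A C n)^-1 * (beta C ^+ t)^-1)).
    apply: eq_big_seq => k; rewrite mem_index_iota => km.
    by rewrite rhoE // beE // invf_div mulrA.
  by rewrite -mulr_suml mulrA divff ?mul1r // r_nz.
have rat : rational_on iota roots (fun z => z^-1 * (rho z)^-1 * (be z)^-1).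
  have rb n : rational_on iota roots (fun z => (map_poly iota (b n)).[z]).
    exact: rational_on_poly.
  have inv n : (0 < n <= m)%N -> rational_on iota roots (fun z => (map_poly iota (p n)).[z]^-1).
    move=> nm; apply: (rational_onV iota_inj psi_split _ (rational_on_poly _ _ _)).
    apply: roots_ind => C k km; have [-> _] := ev C k n km.
    rewrite mulf_eq0 negb_or invr_eq0 (expf_neq0 _ (B_nz C km)) andbT.
    by apply: A_neq0; rewrite Euclid_dvdM // negb_or !small_Ndvd.
  apply: rational_onM; first apply: rational_onM.
  - apply: (rational_onV iota_inj psi_split).
      by apply: roots_ind => C k km; rewrite mulf_neq0 ?invr_eq0 ?A_nz ?B_nz.
    apply: rational_on_ext (rational_on_poly iota roots 'X) => z _.
    by rewrite map_polyX hornerX.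
  - apply: (rational_onV iota_inj psi_split).
      by apply: roots_ind => C k km; rewrite rhoE.
    apply: rational_on_sum => n; rewrite mem_index_iota => nm.
    by apply: rational_onM => //; apply: inv.
  apply: (rational_onV iota_inj psi_split).
    by apply: roots_ind => C k km; rewrite beE // expf_neq0.
  apply: rational_onM; apply: rational_onX; first exact: rational_on_prod.
  apply: rational_onM => //; apply: (rational_onV iota_inj psi_split) => //.
  apply: roots_ind => C k km; have [_ ->] := ev C k m.+1 km.
  have [_ ->] := opp C k.
  rewrite mulf_eq0 negb_or invr_eq0 (expf_neq0 _ (B_nz C km)) andbT.
  by apply: B_neq0; rewrite Euclid_dvdM // negb_or !small_Ndvd // m0 leqnn.
have [g [d [d0 dg]]] := rational_on_trace iota_inj psi_monic roots_uniq psi_split rat.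
have Teta : T = eta ^+ (m.-1 * t) * \sum_C (beta C ^+ t)^-1.
  by rewrite mulr_sumr; apply: eq_bigr => C _; rewrite expr_div_n exprM.
apply: (integral_rational_poly iota_inj (d := d * 'X ^+ (m.-1 * t)) (g := g)).
- by rewrite mulf_neq0 // expf_neq0 // polyX_eq0.
- rewrite -/T Teta -dg Tsum rmorphM rmorphXn -!mulrA; congr (_ * _).
  by rewrite mulrA -exprMn eta_x expr1n mul1r.
apply: integral_bigsum => C _; apply: integral_exp.
apply: (@integral_rootn _ _ _ _ 3) => //.
(* Doubling [r] times gives [Y n ^+ (4 ^ r) = P * Y (2 ^ r * n)] with [P] integral;
   for [r = totient l] the two points agree, so a power of [Y n] is integral. *)
pose Y n := eta ^+ 3 / B C n ^+ 3.
have Y0 n : ~~ (l %| n)%N -> Y n != 0.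
  by move=> ln; rewrite mulf_neq0 ?invr_eq0 ?expf_neq0 ?B_neq0.
have YD n : ~~ (l %| n)%N -> Y n ^+ 4 = W C n ^+ 6 * Y n.*2.
  move=> ln; have A0 := A_neq0 C ln; have B0 := B_neq0 C ln.
  have BD : B C n.*2 = (A C n * B C n) ^+ 2 / eta ^+ 3.
    by rewrite -(theta_dblB (theta C)) mulrAC divff ?mul1r // expf_neq0.
  rewrite /Y /W BD; field.
  by rewrite eta0 A0 B0.
have ln2 n : ~~ (l %| n)%N -> ~~ (l %| n.*2)%N.
  move=> ln; rewrite -mul2n Euclid_dvdM // negb_or ln andbT gtnNdvd //.
  by lia.
have Yiter r n : ~~ (l %| n)%N -> exists2 P, integralOver iota P &
    Y n ^+ (4 ^ r) = P * Y (n * 2 ^ r)%N.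
  move=> ln; elim: r => [|r [P intP IH]].
    by exists 1; rewrite ?muln1 ?mul1r //; apply: integral1.
  have lnr : ~~ (l %| n * 2 ^ r)%N.
    by elim: (r) => [|k]; rewrite ?muln1 // expnS mulnCA mul2n; apply: ln2.
  exists (P ^+ 4 * W C (n * 2 ^ r)%N ^+ 6).
    by apply: integral_mul; apply: integral_exp => //; apply: W_int.
  by rewrite expnSr exprM IH exprMn YD // mulrA expnS mulnCA mul2n.
have Y_int n : ~~ (l %| n)%N -> integralOver iota (Y n).
  move=> ln; have [P intP YP] := Yiter (totient l) n ln.
  have l2 : coprime 2 l by rewrite coprime_sym prime_coprime // gtnNdvd //; lia.
  have n2 : (n * 2 ^ totient l = n %[mod l])%N.
    by rewrite -modnMmr (Euler_exp_totient l2) modnMmr muln1.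
  have Yn2 : Y (n * 2 ^ totient l)%N = Y n.
    rewrite /Y (periodic_mod (B_per C)) n2.
    by rewrite -(periodic_mod (B_per C)).
  have t0 : (1 < 4 ^ totient l)%N.
    by rewrite -{1}(expn0 4) ltn_exp2l // totient_gt0 prime_gt0.
  apply: (@integral_rootn _ _ _ _ (4 ^ totient l).-1); first by lia.
  have -> : Y n ^+ (4 ^ totient l).-1 = P => //.
  apply: (mulIf (Y0 n ln)); rewrite -exprSr prednK; last by lia.
  by rewrite YP Yn2.
(* The [m] factors [Y k] carry [eta ^ (3 m)]; the excess [eta ^ 3] is cancelled by [iota c], which
   is integral. *)
have -> : (eta ^+ m.-1 / beta C) ^+ 3 = iota c * \prod_(1 <= k < m.+1) Y k.
  have -> : \prod_(1 <= k < m.+1) Y k = (eta ^+ 3) ^+ m / beta C ^+ 3.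
    by rewrite prodf_div big_const_nat subn1 /= iter_mulr_1 /beta -prodrXl.
  rewrite expr_div_n mulrA; congr (_ / _).
  rewrite -[in LHS]exprM [(m.-1 * 3)%N]mulnC [in LHS]exprM.
  by case: (m) m0 => // k _; rewrite [in RHS]exprS mulrA c_alpha mul1r.
apply: integral_mul; first exact: integral_id.
apply: integral_bigprod => k; rewrite mem_index_iota => km.
exact/Y_int/small_Ndvd.
Qed.
End Trace.

(** * Theta series in characteristic 2 *)

Fixpoint zball (K : nat) : seq int :=
  if K is k.+1 then k.+1%:Z :: - k.+1%:Z :: zball k else [:: 0].

Lemma mem_zball K (N : int) : (N \in zball K) = (`|N| <= K)%N.
Proof.
elim: K => [|K IH]; first by rewrite inE; lia.
by rewrite !inE IH; lia.
Qed.

Lemma zball_uniq K : uniq (zball K).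
Proof. by elim: K => //= K ->; rewrite !inE !mem_zball; lia. Qed.

Definition zpairs K := [seq (N, M) | N <- zball K, M <- zball K].

Lemma mem_zpairs K p : (p \in zpairs K) = (`|p.1| <= K)%N && (`|p.2| <= K)%N.
Proof.
case: p => N M; apply/allpairsP/andP => [[[x y] /= [] + + [-> ->]]|/= [h h']].
  by rewrite !mem_zball.
by exists (N, M); rewrite !mem_zball.
Qed.

Lemma zpairs_uniq K : uniq (zpairs K).
Proof. by rewrite allpairs_uniq ?zball_uniq //; case=> ? ? []. Qed.

Section CharTwo.
Variable F : comNzRingType.
Hypothesis F2 : 2%N \in [pchar F].

Lemma sqrrD_char2 (x y : F) : (x + y) ^+ 2 = x ^+ 2 + y ^+ 2.
Proof. by rewrite sqrrD [x * y *+ 2]mulr2n addrr_pchar2 // addr0. Qed.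

Lemma sqr_sum_char2 (I : Type) (r : seq I) (P : pred I) (f : I -> F) :
  (\sum_(i <- r | P i) f i) ^+ 2 = \sum_(i <- r | P i) f i ^+ 2.
Proof.
elim/big_rec2: _ => [|i y x _ <-]; first by rewrite expr0n.
exact: sqrrD_char2.
Qed.
End CharTwo.

Section Theta.
Variable F : fieldType.
Implicit Types (phi psi : int -> F) (Phi Psi : int -> int -> F).

(** In terms of [x = Z^24], the monomial [Z^(3 N^2)] is [x^(N^2 / 8)], the shape of the terms in
    Jacobi's series for the cube of eta; the scaling keeps all exponents integral. *)
Definition qform (N : int) := (3 * `|N| ^ 2)%N.

Lemma qform_int N : (qform N)%:Z = 3%:Z * N ^+ 2.
Proof. by rewrite /qform PoszM -abszX gez0_abs ?Num.Theory.sqr_ge0. Qed.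

Lemma qformN N : qform (- N) = qform N.
Proof. by rewrite /qform abszN. Qed.

Lemma qform_nat k : qform k%:Z = (3 * k ^ 2)%N.
Proof. by []. Qed.

(* The sum over all integers [N] of [phi N * Z^(3 N^2)]. *)
Definition theta phi : powser F :=
  PowSer (fun k => \sum_(N <- zball k) phi N *+ (qform N == k)).

Definition theta2 Phi : powser F :=
  PowSer (fun k => \sum_(p <- zpairs k) Phi p.1 p.2 *+ (qform p.1 + qform p.2 == k)%N).

Lemma sum_mulrnb (V : zmodType) (I : Type) (r : seq I) (P : pred I) (f : I -> V) :
  \sum_(i <- r) f i *+ P i = \sum_(i <- r | P i) f i.
Proof. by rewrite [RHS]big_mkcond; apply: eq_bigr => i _; case: (P i). Qed.

Lemma qform_leq N : (`|N| <= qform N)%N.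
Proof. by rewrite /qform; case: `|N|%N => // n; nia. Qed.

Lemma coefs_theta K phi k : (k <= K)%N ->
  coefs (theta phi) k = \sum_(N <- zball K) phi N *+ (qform N == k).
Proof.
move=> /subnKC <-; elim: (K - k)%N => [|d IH]; first by rewrite addn0.
have z (N : int) : `|N|%N = (k + d).+1 -> (qform N == k) = false.
  by have := qform_leq N; lia.
by rewrite IH addnS [zball _.+1]/= !big_cons !z ?mulr0n ?add0r //; lia.
Qed.

Lemma coefs_theta2 K Phi k : (k <= K)%N -> coefs (theta2 Phi) k =
  \sum_(p <- zpairs K) Phi p.1 p.2 *+ (qform p.1 + qform p.2 == k)%N.
Proof.
move=> kK /=; rewrite !sum_mulrnb -[LHS]big_filter -[RHS]big_filter; apply: perm_big; apply: uniq_perm.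
- exact/filter_uniq/zpairs_uniq.
- exact/filter_uniq/zpairs_uniq.
move=> [N M]; rewrite !mem_filter !mem_zpairs /=; case: eqP => //= e.
by have := qform_leq N; have := qform_leq M; lia.
Qed.

Lemma thetaM phi psi : theta phi * theta psi = theta2 (fun N M => phi N * psi M).
Proof.
apply: powserP => k; rewrite coefsM (@coefs_theta2 k) // big_allpairs.
transitivity (\sum_(i < k.+1) \sum_(N <- zball k) \sum_(M <- zball k)
   phi N * psi M *+ ((qform N == i) && (qform M == k - i)%N)).
  apply: eq_bigr => i _; have ik : (i <= k)%N by rewrite -ltnS.
  rewrite (coefs_theta phi ik) (coefs_theta psi (leq_subr i k)).
  rewrite mulr_suml; apply: eq_bigr => N _; rewrite mulr_sumr.
  by apply: eq_bigr => M _; rewrite mulrnAl mulrnAr -mulrnA mulnb andbC.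
rewrite exchange_big; apply: eq_bigr => N _; rewrite exchange_big.
apply: eq_bigr => M _; rewrite sumrMnr; congr (_ *+ _).
case: eqP => [e|ne].
  have Nk : (qform N < k.+1)%N by rewrite -e ltnS leq_addr.
  rewrite (bigD1 (Ordinal Nk)) //= eqxx (_ : (k - qform N)%N = qform M); last by rewrite -e addKn.
  rewrite eqxx big1 // => i.
  by rewrite -(inj_eq val_inj) eq_sym /= => /negPf ->.
rewrite big1 // => i _; apply/eqP; rewrite eqb0; apply/negP => /andP[/eqP a /eqP b].
by apply: ne; rewrite a b subnKC // -ltnS.
Qed.

Lemma theta2D Phi Psi : theta2 Phi + theta2 Psi = theta2 (fun N M => Phi N M + Psi N M).
Proof.
apply: powserP => k /=; rewrite -big_split; apply: eq_bigr => p _.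
by rewrite mulrnDl.
Qed.

Lemma thetaD phi psi : theta phi + theta psi = theta (fun N => phi N + psi N).
Proof.
apply: powserP => k /=; rewrite -big_split; apply: eq_bigr => p _.
by rewrite mulrnDl.
Qed.

Lemma eq_theta phi psi : phi =1 psi -> theta phi = theta psi.
Proof. by move=> e; apply: powserP => k; apply: eq_bigr => N _; rewrite e. Qed.

Hypothesis F2 : 2%N \in [pchar F].

Lemma powser_char2 : 2%N \in [pchar (powser F)].
Proof.
apply/andP; split=> //; apply/eqP/powserP => n.
by rewrite mulr2n coefsD addrr_pchar2.
Qed.

(** Frobenius: mixed terms of a square occur twice and cancel. *)
Lemma coefs_sqr (f : powser F) n :
  coefs (f ^+ 2) n = if odd n then 0 else coefs f n./2 ^+ 2.
Proof.
rewrite expr2 coefsM.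
have -> : \sum_(i < n.+1) coefs f i * coefs f (n - i) = (trunc n.+1 f ^+ 2)`_n.
  by rewrite expr2 -(@powser_mul_trunc _ n.+1).
rewrite /trunc poly_def sqr_sum_char2; last first.
  by rewrite inE /= -polyC_natr (pcharf0 F2) polyC0.
rewrite coef_sum; case: ifP => on; last first.
  rewrite (bigD1 (@inord n n./2)) //= inordK ?ltnS ?half_leqif //; last by lia.
  rewrite exprZn coefZ -exprM coefXn big1 ?addr0 => [|i].
    by rewrite (_ : (n == n./2 * 2)%N = true) ?mulr1 //; lia.
  rewrite -(inj_eq val_inj) /= inordK => [ni|]; last by lia.
  rewrite exprZn coefZ -exprM coefXn (_ : (n == i * 2)%N = false) ?mulr0 //.
  by lia.
rewrite big1 // => i _; rewrite exprZn coefZ -exprM coefXn.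
by rewrite (_ : (n == i * 2)%N = false) ?mulr0 //; lia.
Qed.

(* The substitution [x = N + M], [y = N - M], for which
   [x^2 + y^2 = 2 (N^2 + M^2)], turns Frobenius into a product formula. *)
Lemma theta2_sqr Phi Psi :
  (forall N M, Phi (N + M) (N - M) = Psi N M ^+ 2) ->
  (forall x y, ~~ (2 %| x - y)%Z -> Phi x y = 0) ->
  theta2 Psi ^+ 2 = theta2 Phi.
Proof.
move=> PhiPsi Phi0; apply: powserP => k; rewrite coefs_sqr.
have par x y : (qform x + qform y == k)%N -> (2 %| x - y)%Z -> odd k = false.
  move=> /eqP <- /dvdzP[d xy]; have -> : x = y + d * 2 by rewrite -xy addrC subrK.
  suff -> : (qform (y + d * 2) + qform y =
             (qform (y + d) + qform d).*2)%N by rewrite odd_double.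
  by apply/eqP; rewrite -eqz_nat -mul2n PoszM (PoszD (qform _)) (PoszD (qform _)) !qform_int;
    apply/eqP; ring.
case: ifP => ok.
  rewrite (@coefs_theta2 k) // big1 // => -[x y] _ /=.
  case: eqP => [/eqP e|//]; rewrite mulr1n; apply: Phi0; apply/negP => /(par _ _ e).
  by rewrite ok.
rewrite (@coefs_theta2 k./2) // (@coefs_theta2 k) // sqr_sum_char2 //.
transitivity (\sum_(p <- zpairs k./2)
    Psi p.1 p.2 ^+ 2 *+ (qform p.1 + qform p.2 == k./2)%N).
  by apply: eq_bigr => p _; case: eqP; rewrite ?mulr0n ?expr0n.
transitivity (\sum_(p <- zpairs k) Phi p.1 p.2 *+
    ((qform p.1 + qform p.2 == k)%N && (2 %| p.1 - p.2)%Z)); last first.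
  apply: eq_bigr => p _; case: eqP => //= _.
  by case: (boolP (2 %| _)%Z) => // /Phi0 ->; rewrite mul0rn.
rewrite !sum_mulrnb.
pose h (p : int * int) := (p.1 + p.2, p.1 - p.2).
transitivity (\sum_(p <- [seq h p | p <- zpairs k./2 & (qform p.1 + qform p.2 == k./2)%N])
   Phi p.1 p.2).
  by rewrite big_map big_filter; apply: eq_bigr => p _; rewrite -PhiPsi.
transitivity (\sum_(p <- [seq p <- zpairs k | (qform p.1 + qform p.2 == k)%N &&
   (2 %| p.1 - p.2)%Z]) Phi p.1 p.2); last by rewrite big_filter.
have hq p : (qform (h p).1 + qform (h p).2 = 2 * (qform p.1 + qform p.2))%N.
  case: p => N M; apply/eqP; rewrite -eqz_nat PoszM (PoszD (qform _)) (PoszD (qform _)) /=.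
  by apply/eqP; rewrite !qform_int; ring.
apply/perm_big/uniq_perm.
- rewrite map_inj_uniq ?filter_uniq ?zpairs_uniq // => -[N M] [N' M'] [e1 e2].
  by congr (_, _); lia.
- exact/filter_uniq/zpairs_uniq.
move=> [x y]; rewrite mem_filter mem_zpairs /=; apply/mapP/idP.
  move=> [p]; rewrite mem_filter => /andP[/eqP e _] xy.
  have := hq p; rewrite -xy e /= => e2.
  have -> /= : (qform x + qform y == k)%N by lia.
  have [px py] : x = p.1 + p.2 /\ y = p.1 - p.2 by case: xy.
  have := qform_leq x; have := qform_leq y.
  have -> /= : (2 %| x - y)%Z by lia.
  by lia.
move=> /andP[/andP[/eqP e /dvdzP[d xy]] _].
have hyd : h (y + d, d) = (x, y) by rewrite /h /=; congr (_, _); lia.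
exists (y + d, d); last by rewrite hyd.
have e2 : (k = 2 * (qform (y + d) + qform d))%N.
  by rewrite -e; have := hq (y + d, d); rewrite hyd.
have l1 := qform_leq (y + d); have l2 := qform_leq d.
rewrite mem_filter mem_zpairs /=.
by move: (qform _) (qform _) e2 l1 l2 => u v; lia.
Qed.

Lemma big_zball (V : zmodType) (f : int -> V) K :
  \sum_(N <- zball K) f N = f 0 + \sum_(n < K) (f n.+1%:Z + f (- n.+1%:Z)).
Proof.
elim: K => [|K IH] /=; first by rewrite big_seq1 big_ord0 addr0.
by rewrite !big_cons IH big_ord_recr /= addrA addrCA [in RHS]addrC.
Qed.

Lemma thetaN phi : theta (fun N => phi (- N)) = theta phi.
Proof.
apply: powserP => k /=; rewrite !big_zball oppr0; congr (_ + _).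
by apply: eq_bigr => n _; rewrite opprK addrC qformN.
Qed.

(** The terms at [N] and [- N] have equal exponents and coefficients, so they cancel in
    characteristic 2. *)
Lemma theta_even phi : (forall N, phi (- N) = phi N) -> theta phi = mono (phi 0) 0.
Proof.
move=> ev; apply: powserP => k /=; rewrite big_zball big1 ?addr0 => [|n _].
  by rewrite eq_sym.
by rewrite ev qformN addrr_pchar2.
Qed.

Lemma theta_lead phi n : (0 < n)%N ->
  (forall N, (`|N| < n)%N -> phi N = 0) ->
  lead_at (theta phi) (3 * n ^ 2) (phi n%:Z + phi (- n%:Z)).
Proof.
move=> n0 z; have c k : (qform k%:Z == (3 * n ^ 2)%N) = (k == n).
  by rewrite qform_nat eqn_pmul2l // eqn_exp2r.
split=> [|j jn] /=; rewrite big_zball z // mul0rn add0r.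
  have nn : (n.-1 < 3 * n ^ 2)%N by nia.
  rewrite (bigD1 (Ordinal nn)) //= prednK // qformN c eqxx !mulr1n.
  rewrite big1 ?addr0 // => i; rewrite -(inj_eq val_inj) /= => ni.
  rewrite qformN c (_ : (i.+1 == n) = false) ?mulr0n ?addr0 //.
  by apply/negP => /eqP e; case/negP: ni; apply/eqP; exact: (congr1 predn e).
rewrite big1 // => i _; rewrite qformN; case: (ltnP i.+1 n) => h.
  by rewrite !z ?mul0rn ?addr0 // abszN.
have : (j < qform i.+1)%N.
  by rewrite (leq_trans jn) // qform_nat leq_pmul2l // leq_exp2r.
by rewrite ltn_neqAle eq_sym => /andP[/negPf -> _]; rewrite addr0.
Qed.

Lemma theta_lead0 phi : phi 0 != 0 -> lead_at (theta phi) 0 (phi 0).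
Proof. by move=> p0; split=> //=; rewrite big_seq1. Qed.

End Theta.

(** * Theta series at the torsion points and their addition formulas *)

Section TorsionTheta.
Variable F : fieldType.
Variable l : nat.

(** The theta constant that turns out to be [eta^3] ([talpha_cube]). The condition modulo 4 keeps
    one of [N], [- N] for each odd multiple of [l]; with both, the series would vanish in
    characteristic 2. *)
Definition talpha := theta (fun N => ((l%:Z %| N)%Z && (4 %| N - 1)%Z)%:R : F).

Lemma talphaN : talpha = theta (fun N => ((l%:Z %| N)%Z && (4 %| N + 1)%Z)%:R : F).
Proof.
rewrite -thetaN; apply: eq_theta => N; congr (nat_of_bool (_ && _))%:R.
  by rewrite rpredN.
by lia.
Qed.

Hypothesis F2 : 2%N \in [pchar F].
Variables (m : nat) (ze : F).
Hypothesis lE : l = m.*2.+1.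
Hypothesis ze_l2 : ze ^+ (l ^ 2) = 1.
Implicit Types (i j n a b N M : int).

Let ze0 : ze != 0.
Proof.
apply/eqP => z0; move: ze_l2; rewrite z0 expr0n lE /= => /esym/eqP.
by rewrite oner_eq0.
Qed.

Lemma expz_mod k d : ze ^ (k + l%:Z * (l%:Z * d)) = ze ^ k.
Proof.
rewrite expfzDr // mulrA -exprz_exp -PoszM mulnn -exprnP ze_l2.
by rewrite exp1rz mulr1.
Qed.

(* The indices [(i, j, n)] stand for the point [n * (i, j)] of the [l]-torsion:
   [j] shifts the summation index and [i] twists by a root of unity. *)
Definition chi i j n N : F :=
  if (l%:Z %| N - 2 * n * j)%Z then ze ^ (i * (n * N - n ^+ 2 * j)) else 0.

Definition even_part (phi : int -> F) N := if (2 %| N)%Z then phi N else 0.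
Definition odd_part (phi : int -> F) N := if (2 %| N)%Z then 0 else phi N.

Definition tA i j n := theta (even_part (chi i j n)).
Definition tB i j n := theta (odd_part (chi i j n)).

(** The exponent is a quadratic form in [(n, N)], hence satisfies the parallelogram law. The
    supports match because [l] is odd: it divides [u + v] and [u - v] exactly when it divides [u]
    and [v]. *)
Lemma chi_parallelogram i j a b N M :
  chi i j (a + b) (N + M) * chi i j (a - b) (N - M) =
  (chi i j a N * chi i j b M) ^+ 2.
Proof.
rewrite /chi; set u := N - 2 * a * j; set v := M - 2 * b * j.
have -> : N + M - 2 * (a + b) * j = u + v by rewrite /u /v; ring.
have -> : N - M - 2 * (a - b) * j = u - v by rewrite /u /v; ring.
have luv : (l%:Z %| u + v)%Z && (l%:Z %| u - v)%Z = (l%:Z %| u)%Z && (l%:Z %| v)%Z.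
  apply/andP/andP => -[h1 h2]; last by split; [apply: rpredD|apply: rpredB].
  have c2 : coprimez l%:Z 2 by rewrite coprimezE /= lE coprimen2 /= odd_double.
  have hu : (l%:Z %| u)%Z.
    rewrite -(Gauss_dvdzr _ c2); have -> : 2 * u = u + v + (u - v) by ring.
    exact: rpredD.
  by split=> //; rewrite (_ : v = u + v - u); [apply: rpredB|ring].
move: luv; case: (l%:Z %| u + v)%Z; case: (l%:Z %| u - v)%Z => /=;
  case: (l%:Z %| u)%Z; case: (l%:Z %| v)%Z => //= _;
  rewrite ?(mul0r, mulr0, expr0n) //= -!expfzDr // [RHS]expr2 -expfzDr //.
by congr (_ ^ _); ring.
Qed.

(** Apply [theta2_sqr]: [N + M] and [N - M] are odd exactly when one of [N], [M] is even and the
    other odd, which gives the two mixed products. In [addA] equal parities give the other two. *)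
Lemma addB i j a b : tB i j (a + b) * tB i j (a - b) =
  (tA i j a * tB i j b + tA i j b * tB i j a) ^+ 2.
Proof.
rewrite [tA i j b * _]mulrC /tA /tB !thetaM theta2D.
rewrite (@theta2_sqr _ F2 (fun x y => odd_part (chi i j (a + b)) x * odd_part (chi i j (a - b)) y)) //.
- move=> N M; rewrite /odd_part /even_part.
  have -> : (2 %| N - M)%Z = (2 %| N + M)%Z by lia.
  case: (boolP (2 %| N)%Z) => hN; case: (boolP (2 %| M)%Z) => hM;
   rewrite ?(mul0r, mulr0, addr0, add0r) ?expr0n.
  + have -> : (2 %| N + M)%Z by lia.
    by rewrite mul0r.
  + have -> : (2 %| N + M)%Z = false by lia.
    exact: chi_parallelogram.
  + have -> : (2 %| N + M)%Z = false by lia.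
    exact: chi_parallelogram.
  have -> : (2 %| N + M)%Z by lia.
  by rewrite mul0r.
move=> x y xy; rewrite /odd_part.
case: (boolP (2 %| x)%Z) => hx; rewrite ?mul0r //.
by case: (boolP (2 %| y)%Z) => hy; rewrite ?mulr0 //; lia.
Qed.

Lemma addA i j a b : tA i j (a + b) * tA i j (a - b) =
  (tA i j a * tA i j b + tB i j a * tB i j b) ^+ 2.
Proof.
rewrite /tA /tB !thetaM theta2D.
rewrite (@theta2_sqr _ F2 (fun x y => even_part (chi i j (a + b)) x * even_part (chi i j (a - b)) y)) //.
- move=> N M; rewrite /odd_part /even_part.
  have -> : (2 %| N - M)%Z = (2 %| N + M)%Z by lia.
  case: (boolP (2 %| N)%Z) => hN; case: (boolP (2 %| M)%Z) => hM;
   rewrite ?(mul0r, mulr0, addr0, add0r) ?expr0n.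
  + have -> : (2 %| N + M)%Z by lia.
    exact: chi_parallelogram.
  + have -> : (2 %| N + M)%Z = false by lia.
    by rewrite mul0r.
  + have -> : (2 %| N + M)%Z = false by lia.
    by rewrite mul0r.
  have -> : (2 %| N + M)%Z by lia.
  exact: chi_parallelogram.
move=> x y xy; rewrite /even_part.
case: (boolP (2 %| x)%Z) => hx; rewrite ?mul0r //.
by case: (boolP (2 %| y)%Z) => hy; rewrite ?mulr0 //; lia.
Qed.

Lemma chi0 i j N : chi i j 0 N = (l%:Z %| N)%Z%:R.
Proof.
rewrite /chi !(mulr0, mul0r, subr0, oppr0, expr0n, addr0) /= expr0z.
by case: ifP.
Qed.

(** The odd index [x] of [tB] is split by its residue modulo 4 and paired with the form of [talpha]
    supported on the opposite residue. Then [N = (x + y) / 2] is even and [M = (x - y) / 2] is odd,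
    and every such pair occurs once; the parallelogram identity with [b = a] does the rest. *)
Lemma dblB i j a : talpha * tB i j (a + a) = (tA i j a * tB i j a) ^+ 2.
Proof.
pose w r N := if (4 %| N - r)%Z then chi i j (a + a) N else 0.
have -> : tB i j (a + a) = theta (w 1) + theta (w (-1)).
  rewrite thetaD; apply: eq_theta => N; rewrite /odd_part /w opprK.
  have [h|h] := boolP (2 %| N)%Z.
    by rewrite !ifF ?addr0 //; lia.
  have [h1|h1] := boolP (4 %| N - 1)%Z; first by rewrite ifF ?addr0 //; lia.
  by rewrite ifT ?add0r //; lia.
rewrite mulrDr {1}talphaN [_ * theta (w 1)]mulrC [_ * theta (w (-1))]mulrC.
rewrite /tA /tB /talpha !thetaM theta2D.
rewrite -(@theta2_sqr _ F2 _ (fun N M => even_part (chi i j a) N * odd_part (chi i j a) M)) //.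
  move=> N M; rewrite /even_part /odd_part.
  have := chi_parallelogram i j a a N M; rewrite subrr chi0 => e.
  rewrite /w opprK; have [hN|hN] := boolP (2 %| N)%Z; last first.
    rewrite mul0r expr0n.
    have [h4|_] := boolP (4 %| N + M - 1)%Z.
      have -> : (4 %| N - M + 1)%Z = false by lia.
      have -> : (4 %| N + M + 1)%Z = false by lia.
      by rewrite andbF mulr0 mul0r addr0.
    rewrite mul0r add0r; have [h4|_] := boolP (4 %| N + M + 1)%Z; last by rewrite mul0r.
    have -> : (4 %| N - M - 1)%Z = false by lia.
    by rewrite andbF mulr0.
  have [hM|hM] := boolP (2 %| M)%Z.
    rewrite mulr0 expr0n.
    have -> : (4 %| N + M - 1)%Z = false by lia.
    have -> : (4 %| N + M + 1)%Z = false by lia.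
    by rewrite !mul0r addr0.
  rewrite -e; have [h4|h4] := boolP (4 %| N + M - 1)%Z.
    have -> : (4 %| N + M + 1)%Z = false by lia.
    have -> : (4 %| N - M + 1)%Z by lia.
    by rewrite andbT mul0r addr0.
  have -> : (4 %| N + M + 1)%Z by lia.
  have -> : (4 %| N - M - 1)%Z by lia.
  by rewrite andbT mul0r add0r.
move=> x y xy; rewrite /w opprK.
have [h4|h4] := boolP (4 %| x - 1)%Z.
  have -> : (4 %| y + 1)%Z = false by lia.
  have -> : (4 %| x + 1)%Z = false by lia.
  by rewrite andbF mulr0 mul0r addr0.
rewrite mul0r add0r; have [h4'|h4'] := boolP (4 %| x + 1)%Z; last by rewrite mul0r.
have -> : (4 %| y - 1)%Z = false by lia.
by rewrite andbF mulr0.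
Qed.

Lemma tA0 i j : tA i j 0 = 1.
Proof.
rewrite /tA theta_even // => [|N].
  by rewrite /even_part chi0 !dvdz0 /= mono1.
by rewrite /even_part !chi0 !rpredN.
Qed.

Lemma tB0 i j : tB i j 0 = 0.
Proof.
rewrite /tB theta_even // => [|N].
  by rewrite /odd_part dvdz0; apply: powserP => n /=; rewrite mul0rn.
by rewrite /odd_part !chi0 !rpredN.
Qed.

(** The exponent of [ze] changes by a multiple of [l^2]: one factor [l] is the period, the other
    comes from the support condition. This is why [ze] is an [l^2]-th root of unity. *)
Lemma chi_per i j n N : chi i j (n + l%:Z) N = chi i j n N.
Proof.
rewrite /chi.
have -> : N - 2 * (n + l%:Z) * j = N - 2 * n * j - l%:Z * (2 * j) by ring.
rewrite rpredBr ?dvdz_mulr //; case: ifP => // /dvdzP[d e].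
have -> : i * ((n + l%:Z) * N - (n + l%:Z) ^+ 2 * j) =
    i * (n * N - n ^+ 2 * j) + l%:Z * (i * (N - 2 * n * j - l%:Z * j)) by ring.
have -> : l%:Z * (i * (N - 2 * n * j - l%:Z * j)) = l%:Z * (l%:Z * (i * (d - j))).
  by rewrite e; ring.
exact: expz_mod.
Qed.

Lemma chiN i j n N : chi i j (- n) (- N) = chi i j n N.
Proof.
rewrite /chi; have -> : - N - 2 * - n * j = - (N - 2 * n * j) by ring.
rewrite rpredN; case: ifP => // _.
by congr (_ ^ _); ring.
Qed.

Lemma tA_per i j n : tA i j (n + l%:Z) = tA i j n.
Proof. by apply: eq_theta => N; rewrite /even_part chi_per. Qed.

Lemma tB_per i j n : tB i j (n + l%:Z) = tB i j n.
Proof. by apply: eq_theta => N; rewrite /odd_part chi_per. Qed.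

Lemma tAN i j n : tA i j (- n) = tA i j n.
Proof.
rewrite /tA -thetaN; apply: eq_theta => N; by rewrite /even_part chiN rpredN.
Qed.

Lemma tBN i j n : tB i j (- n) = tB i j n.
Proof.
rewrite /tB -thetaN; apply: eq_theta => N; by rewrite /odd_part chiN rpredN.
Qed.

End TorsionTheta.

(** * The Jacobi triple product *)

Section GaussianBinomials.
Variables (R : comNzRingType) (h : R).

Fixpoint gbin (n k : nat) : R :=
  match n, k with
  | _, 0 => 1
  | 0, _.+1 => 0
  | n'.+1, k'.+1 => gbin n' k' + h ^+ k * gbin n' k
  end.

Lemma gbinS n k : gbin n.+1 k.+1 = gbin n k + h ^+ k.+1 * gbin n k.+1.
Proof. by []. Qed.

Lemma gbin0 n : gbin n 0 = 1. Proof. by case: n. Qed.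

Lemma gbin_gt n k : (n < k)%N -> gbin n k = 0.
Proof.
elim: n k => [|n IH] [|k] //= nk.
by rewrite !IH ?mulr0 ?addr0 // ltnW.
Qed.

Lemma gbinn n : gbin n n = 1.
Proof. by elim: n => //= n ->; rewrite gbin_gt // mulr0 addr0. Qed.

(** The second Pascal rule. It is proved by induction since the symmetry of Gaussian binomials is
    not visible in the recursive definition. *)
Lemma gbinS_sym n k : (k <= n)%N ->
  gbin n.+1 k.+1 = gbin n k.+1 + h ^+ (n - k) * gbin n k.
Proof.
elim: n k => [|n IH] k kn.
  by case: k kn => //= _; rewrite !mulr0 mul1r addr0 add0r.
rewrite leq_eqVlt in kn; case/predU1P: kn => [->|kn].
  by rewrite gbinn gbin_gt // subnn expr0 mul1r add0r gbinn.
rewrite ltnS in kn; rewrite gbinS.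
case: k kn => [|k] kn.
  have e1 : gbin n.+1 1 = gbin n 1 + h ^+ n by rewrite IH // subn0 gbin0 mulr1.
  have e2 : gbin n.+1 1 = 1 + h * gbin n 1 by rewrite gbinS gbin0 expr1.
  by rewrite gbin0 subn0 {1}e1 e2 expr1 exprS; ring.
rewrite {1}IH ?(ltnW kn) // {1}(IH k.+1) // !gbinS subSS.
have -> : h ^+ k.+2 * (gbin n k.+2 + h ^+ (n - k.+1) * gbin n k.+1) =
    h ^+ k.+2 * gbin n k.+2 + h ^+ (n - k) * (h ^+ k.+1 * gbin n k.+1).
  by rewrite mulrDr !mulrA -!exprD; congr (_ + h ^+ _ * _); lia.
by ring.
Qed.

Definition qpoch n : R := \prod_(s < n) (1 - h ^+ s.+1).

Lemma qpochS n : qpoch n.+1 = qpoch n * (1 - h ^+ n.+1).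
Proof. exact: big_ord_recr. Qed.

Lemma gbin_qpoch n k : (k <= n)%N -> gbin n k * (qpoch k * qpoch (n - k)) = qpoch n.
Proof.
elim: n k => [|n IH] [|k] //=; rewrite ?mul1r.
- by rewrite /qpoch big_ord0 mulr1.
- by rewrite subn0 {1}/qpoch big_ord0 mul1r.
rewrite ltnS subSS leq_eqVlt => /predU1P[->|kn].
  by rewrite gbinn gbin_gt // mulr0 addr0 mul1r subnn {2}/qpoch big_ord0 mulr1.
have e1 := IH k (ltnW kn); have e2 := IH k.+1 kn.
have nk : (n - k = (n - k.+1).+1)%N by lia.
rewrite [RHS]qpochS.
transitivity (gbin n k * (qpoch k * qpoch (n - k)) * (1 - h ^+ k.+1) +
   h ^+ k.+1 * (1 - h ^+ (n - k)) * (gbin n k.+1 * (qpoch k.+1 * qpoch (n - k.+1)))).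
  by rewrite nk !qpochS; ring.
rewrite e1 e2; have -> : h ^+ n.+1 = h ^+ k.+1 * h ^+ (n - k).
  by rewrite -exprD; congr (_ ^+ _); lia.
by ring.
Qed.

(** This is [u (u - 1) / 2] for the integer [u = k - M] of either sign. *)
Definition jexp (M k : nat) := if (M <= k)%N then 'C(k - M, 2) else 'C((M - k).+1, 2).

Lemma jexpS M k : (jexp M.+1 k.+1 = jexp M k)%N.
Proof. by rewrite /jexp ltnS !subSS. Qed.

Lemma jexp_step M k : (jexp M k.+1 + M = jexp M k + k)%N.
Proof.
rewrite /jexp; case: (leqP M k) => Mk.
  rewrite leqW // subSn // binS bin1.
  by rewrite -addnA; congr (_ + _)%N; lia.
case: ifP => h1.
  have -> : (M = k.+1)%N by lia.
  by rewrite subnn subSnn bin0n binn add1n.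
have -> : ((M - k).+1 = (M - k.+1).+2)%N by lia.
by rewrite [in RHS]binS bin1; lia.
Qed.

Definition jprod N M : {poly R} :=
  (\prod_(s < N) (1 + h ^+ s *: 'X)) * (\prod_(s < M) ('X + (h ^+ s.+1)%:P)).

(** A form of the q-binomial theorem. A further factor of the first product corresponds to the rule
    [gbinS_sym], one of the second to the defining rule of [gbin]. *)
Lemma finite_jacobi N M k : (jprod N M)`_k = gbin (N + M) k * h ^+ jexp M k.
Proof.
rewrite /jprod; elim: M k => [|M IH] k.
  rewrite big_ord0 mulr1 addn0; elim: N k => [|N IH] k.
    by rewrite big_ord0 coef1; case: k => [|k] /=; rewrite ?mulr1 ?mul0r.
  rewrite big_ord_recr /= mulrDr mulr1 coefD IH -scalerAr coefZ coefMX.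
  case: k => [|k] /=; first by rewrite !gbin0 mulr0 addr0.
  rewrite IH; have := jexp_step 0 k; rewrite addn0 => e.
  case: (leqP k N) => kN; last first.
    by rewrite -gbinS !gbin_gt ?mul0r ?mulr0 ?addr0 //; lia.
  rewrite -gbinS gbinS_sym // mulrDl e; congr (_ + _).
  rewrite mulrCA -mulrA [RHS]mulrCA -!exprD; congr (_ * h ^+ _).
  by lia.
rewrite big_ord_recr /= mulrA mulrDr coefD coefMX coefMC !IH addnS.
case: k => [|k] /=.
  rewrite gbin0 add0r !mul1r -exprD; congr (_ ^+ _).
  by rewrite /jexp /= subn0; case: M {IH} => //= M; rewrite !binS !bin1 !bin0; lia.
rewrite jexpS mulrDl; congr (_ + _).
have e : h ^+ jexp M k.+1 * h ^+ M.+1 = h ^+ k.+1 * h ^+ jexp M k.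
  by rewrite -!exprD; congr (_ ^+ _); have := jexp_step M k; lia.
by rewrite -[LHS]mulrA e mulrCA mulrA.
Qed.

(* Multiplied by [w^M], the product below is the Laurent polynomial with
   exponents [-M..N] that tends to the Jacobi triple product. *)
Lemma jprod_eval N M w w' : w * w' = h ->
  (jprod N M).[w] =
  w ^+ M * (\prod_(s < N) (1 + w * h ^+ s) * \prod_(s < M) (1 + w' * h ^+ s)).
Proof.
move=> ww; rewrite hornerM !horner_prod mulrCA; congr (_ * _).
  by apply: eq_bigr => s _; rewrite hornerD hornerC hornerZ hornerX mulrC.
rewrite -[M in w ^+ M]card_ord -prodr_const -big_split; apply: eq_bigr => s _.
by rewrite hornerD hornerX hornerC /= mulrDr mulr1 mulrA ww -exprS.
Qed.

End GaussianBinomials.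

Section Congruence.
Variable F : fieldType.
Local Notation S := (powser F).
Implicit Types (f g h : S) (K : nat).

Definition eqmod K f g := forall k, (k < K)%N -> coefs f k = coefs g k.

Lemma eqmod_eq f g : (forall K, eqmod K f g) -> f = g.
Proof. by move=> H; apply: powserP => n; apply: (H n.+1). Qed.

Lemma eqmod_refl K f : eqmod K f f. Proof. by []. Qed.

Lemma eqmod_sym K f g : eqmod K f g -> eqmod K g f.
Proof. by move=> H k kK; rewrite H. Qed.

Lemma eqmod_trans K f g h : eqmod K f g -> eqmod K g h -> eqmod K f h.
Proof. by move=> H1 H2 k kK; rewrite H1 ?H2. Qed.

Lemma eqmodD K f g f' g' : eqmod K f f' -> eqmod K g g' -> eqmod K (f + g) (f' + g').
Proof. by move=> H1 H2 k kK; rewrite !coefsD H1 ?H2. Qed.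

Lemma eqmodM K f g f' g' : eqmod K f f' -> eqmod K g g' -> eqmod K (f * g) (f' * g').
Proof.
move=> H1 H2 k kK; rewrite !coefsM; apply: eq_bigr => i _.
rewrite H1 ?H2 //; first exact: leq_ltn_trans (leq_subr _ _) kK.
exact: leq_trans (ltn_ord i) kK.
Qed.

Lemma eqmodX K f g n : eqmod K f g -> eqmod K (f ^+ n) (g ^+ n).
Proof. by move=> H; elim: n => // n IH; rewrite !exprS; apply: eqmodM. Qed.

Lemma eqmod_prod K (I : Type) (r : seq I) (P : pred I) (f g : I -> S) :
  (forall i, P i -> eqmod K (f i) (g i)) ->
  eqmod K (\prod_(i <- r | P i) f i) (\prod_(i <- r | P i) g i).
Proof.
by move=> H; elim/big_ind2: _ => // *; apply: eqmodM.
Qed.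

Lemma eqmod_sum K (I : eqType) (r : seq I) (P : pred I) (f g : I -> S) :
  (forall i, P i -> eqmod K (f i) (g i)) ->
  eqmod K (\sum_(i <- r | P i) f i) (\sum_(i <- r | P i) g i).
Proof.
by move=> H; elim/big_ind2: _ => // *; apply: eqmodD.
Qed.

Lemma eqmod_cancel K f g h : coefs f 0 != 0 -> eqmod K (f * g) (f * h) -> eqmod K g h.
Proof.
move=> f0 H k kK; apply/eqP; rewrite -subr_eq0 -coefsB.
have [->|] := eqVneq (g - h) 0; first by rewrite coefs0.
case/lead_at_ex=> j [c c0 lj]; have [kj|jk] := ltnP k j; first by case: lj => _ ->.
have lf : lead_at f 0 (coefs f 0) by [].
have [e _] := lead_atM lf lj; move: e; rewrite add0n mulrBr.
rewrite [coefs (_ - _) j]coefsB H ?subrr; last exact: leq_ltn_trans kK.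
by move/esym/eqP; rewrite mulf_eq0 (negPf f0) (negPf c0).
Qed.

Lemma eqmod_expr0 K h n : coefs h 0 = 0 -> (K <= n)%N -> eqmod K (h ^+ n) 0.
Proof.
move=> h0; elim: n K => [|n IH] K Kn k kK; first by lia.
rewrite exprS coefsM big1 // => i _; have [->|i0] := posnP i; first by rewrite h0 mul0r.
rewrite (IH k) ?mulr0 //; first by lia.
by have := ltn_ord i; lia.
Qed.

Lemma dil_eqmod K c b f g : (0 < b)%N -> eqmod K f g -> eqmod K (dil c b f) (dil c b g).
Proof.
move=> b0 H k kK /=; case: ifP => // _; rewrite H //.
exact: leq_ltn_trans (leq_div _ _) kK.
Qed.
End Congruence.

Section TripleProduct.
Variable F : fieldType.
Local Notation S := (powser F).
Implicit Types (f g h w : S) (K N M : nat).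

(** Passes from a sum over the exponents of a finite product to one over integers; terms off the
    image of [kap] are negligible modulo [Z^K]. *)
Lemma eqmod_reindex K n (G : nat -> S) (I : eqType) (r : seq I) (kap : I -> nat)
    (T : I -> S) :
  uniq r -> {in r &, injective kap} -> {in r, forall v, (kap v < n)%N} ->
  (forall k, (k < n)%N -> k \notin [seq kap v | v <- r] -> eqmod K (G k) 0) ->
  {in r, forall v, eqmod K (G (kap v)) (T v)} ->
  eqmod K (\sum_(k < n) G k) (\sum_(v <- r) T v).
Proof.
move=> ur inj rn G0 GT.
rewrite -(big_mkord predT G) /index_iota subn0 (bigID (mem [seq kap v | v <- r])) /=.
rewrite -[X in eqmod _ _ X]addr0; apply: eqmodD; last first.
  rewrite big_seq_cond; elim/big_ind: _ => // [x y x0 y0|k /andP[]].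
    by rewrite -[0]addr0; apply: eqmodD.
  by rewrite mem_iota => /andP[_ kn]; apply: G0.
rewrite -big_filter (perm_big [seq kap v | v <- r]) /=.
  by rewrite big_map big_seq [X in eqmod _ _ X]big_seq; apply: eqmod_sum.
apply: uniq_perm; rewrite ?filter_uniq ?iota_uniq ?map_inj_in_uniq //.
move=> k; rewrite mem_filter mem_iota add0n /=; case: (boolP (k \in _)) => //=.
by move=> /mapP[v vr ->]; rewrite rn.
Qed.

Lemma qpoch_eqmod h K N : coefs h 0 = 0 -> (K <= N)%N ->
  eqmod K.+1 (qpoch h N) (qpoch h K).
Proof.
move=> h0 /subnKC <-; elim: (N - K)%N => [|d IH]; first by rewrite addn0.
rewrite addnS qpochS -[X in eqmod _ _ X]mulr1; apply: eqmodM => //.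
move=> k kK; rewrite coefsB (eqmod_expr0 (K := K.+1) h0) ?subr0 //.
by rewrite ltnS leq_addr.
Qed.

Lemma coefs_qpoch0 h K : coefs h 0 = 0 -> coefs (qpoch h K) 0 != 0.
Proof.
move=> h0; rewrite (qpoch_eqmod (K := 0) h0) // /qpoch big_ord0 coefs1.
exact: oner_neq0.
Qed.

(** In [gbin h n k * (qpoch h k * qpoch h (n - k)) = qpoch h n] all three products agree with
    [qpoch h K] modulo [Z^K], and this series has a nonzero constant term, so it cancels. *)
Lemma gbin_eqmod h K N n k : coefs h 0 = 0 ->
  (K <= N)%N -> (K <= k)%N -> (K + k <= n)%N -> eqmod K (qpoch h N * gbin h n k) 1.
Proof.
move=> h0 KN Kk Kn; have kn : (k <= n)%N by lia.
have Q a : (K <= a)%N -> eqmod K (qpoch h a) (qpoch h K).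
  by move=> Ka j jK; apply: qpoch_eqmod => //; apply: ltnW.
apply: (@eqmod_cancel _ _ (qpoch h K * qpoch h K)).
  by rewrite coefsM big_ord1 mulf_neq0 // coefs_qpoch0.
apply: (@eqmod_trans _ _ _ (qpoch h N * (gbin h n k * (qpoch h k * qpoch h (n - k))))).
  have -> : qpoch h K * qpoch h K * (qpoch h N * gbin h n k) =
      qpoch h N * (gbin h n k * (qpoch h K * qpoch h K)) by ring.
  apply: eqmodM => //; apply: eqmodM => //.
  by apply: eqmodM; apply: eqmod_sym; apply: Q => //; lia.
rewrite gbin_qpoch // mulr1; apply: eqmodM; apply: Q => //; lia.
Qed.

(** The term [h^(u (u - 1) / 2) w^u] of the triple product; for [u < 0], [w^-1] is traded for
    [w' / h], so that only nonnegative powers remain. *)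
Definition jterm h w w' (u : int) : S :=
  match u with
  | Posz n => h ^+ 'C(n, 2) * w ^+ n
  | Negz n => h ^+ 'C(n.+1, 2) * w' ^+ n.+1
  end.

Lemma leq_bin2 K n : (K < n)%N -> (K <= 'C(n, 2))%N.
Proof. by case: n => // n Kn; rewrite binS bin1; lia. Qed.

Lemma jterm_eqmod0 h w w' K u : coefs h 0 = 0 -> (K < `|u|)%N ->
  eqmod K (jterm h w w' u) 0.
Proof.
have P n x : coefs h 0 = 0 -> (K < n)%N -> eqmod K (h ^+ 'C(n, 2) * x) 0.
  move=> h0 Kn; rewrite -[X in eqmod _ _ X](mul0r x); apply: eqmodM => //.
  by apply: eqmod_expr0 => //; apply: leq_bin2.
by case: u => n /P; apply.
Qed.

Lemma jacobi_triple h w w' K N M : w * w' = h -> w != 0 -> coefs h 0 = 0 ->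
  (2 * K <= N)%N -> (2 * K <= M)%N ->
  eqmod K (qpoch h N * (\prod_(s < N) (1 + w * h ^+ s) * \prod_(s < M) (1 + w' * h ^+ s)))
    (\sum_(u <- zball K) jterm h w w' u).
Proof.
move=> ww w0 h0 NK MK.
have szj : (size (jprod h N M) <= (N + M).+1)%N.
  by apply/leq_sizeP => k k1; rewrite finite_jacobi gbin_gt ?mul0r.
have -> : qpoch h N * (\prod_(s < N) (1 + w * h ^+ s) * \prod_(s < M) (1 + w' * h ^+ s)) =
  \sum_(k < (N + M).+1) qpoch h N * gbin h (N + M) k * jterm h w w' (k%:Z - M%:Z).
  (* Multiplication by [w ^+ M] clears the negative exponents; the index [k] of the polynomial
     stands for [u = k - M]. *)
  apply: (mulfI (expf_neq0 M w0)); rewrite mulrCA -(jprod_eval N M ww).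
  rewrite (horner_coef_wide _ szj) !mulr_sumr; apply: eq_bigr => k _.
  rewrite finite_jacobi.
  suff e : h ^+ jexp M k * w ^+ k = w ^+ M * jterm h w w' (k%:Z - M%:Z).
    by rewrite -[_ * _ * w ^+ k]mulrA e; ring.
  rewrite /jexp; case: (leqP M k) => Mk.
    have -> : k%:Z - M%:Z = (k - M)%N by lia.
    by rewrite /jterm mulrCA -exprD; congr (_ * _ ^+ _); lia.
  have -> : k%:Z - M%:Z = Negz (M - k).-1 by lia.
  rewrite /jterm prednK ?subn_gt0 //.
  have -> : w ^+ M = w ^+ k * w ^+ (M - k) by rewrite -exprD subnKC // ltnW.
  have -> : w ^+ k * w ^+ (M - k) * (h ^+ 'C(M - k, 2) * w' ^+ (M - k)) =
    h ^+ 'C(M - k, 2) * (w * w') ^+ (M - k) * w ^+ k by rewrite exprMn; ring.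
  by rewrite ww -exprD; congr (_ ^+ _ * _); rewrite binS bin1.
apply: (@eqmod_reindex K _ (fun k => qpoch h N * gbin h (N + M) k *
  jterm h w w' (k%:Z - M%:Z)) _ _ (fun u : int => `|(u + M%:Z)%R|%N)).
- exact: zball_uniq.
- by move=> u v; rewrite !mem_zball; lia.
- by move=> u; rewrite mem_zball; lia.
- move=> k kn /mapP knot; rewrite -[0](mulr0 (qpoch h N * gbin h (N + M) k)).
  apply: eqmodM => //; apply: jterm_eqmod0 => //; rewrite ltnNge; apply/negP => kK.
  by apply: knot; exists (k%:Z - M%:Z); rewrite ?mem_zball //; lia.
move=> u; rewrite mem_zball => uK.
have -> : `|(u + M%:Z)%R|%N%:Z - M%:Z = u by lia.
rewrite -[X in eqmod _ _ X]mul1r; apply: eqmodM => //.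
by apply: gbin_eqmod => //; lia.
Qed.

Hypothesis F2 : 2%N \in [pchar F].

(** Jacobi's identity for the cube, reduced modulo 2. The factor [s = 0] of the finite triple
    product is [1 + X], which vanishes at [X = 1]; so the derivative at 1 is the product of the
    remaining factors. In the expanded form the derivative keeps the odd exponents only, written
    [k = M + 2 v + 1], with power [(2 v + 1) (2 v) / 2 = v (2 v + 1)] of [h]. *)
Lemma jacobi_cube h K N : coefs h 0 = 0 -> (4 * K + 2 <= N)%N ->
  eqmod K (qpoch h N ^+ 3) (\sum_(v <- zball K) h ^+ `|v * (2 * v + 1)|).
Proof.
move=> h0 NK; pose M := N.*2.
have S2 := powser_char2 F2.
have S2' : 2%N \in [pchar {poly S}].
  by rewrite inE /= -polyC_natr (pcharf0 S2) polyC0.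
have szj : (size (jprod h N.+1 M) <= (N.+1 + M).+1)%N.
  by apply/leq_sizeP => k k1; rewrite finite_jacobi gbin_gt ?mul0r.
have qE n : qpoch h n = \prod_(s < n) (1 + h ^+ s.+1).
  by apply: eq_bigr => s _; rewrite oppr_pchar2.
have E : qpoch h N * qpoch h M =
    \sum_(k < (N.+1 + M).+1) (gbin h (N.+1 + M) k * h ^+ jexp M k) *+ k.
  pose Q := \prod_(s < N) (1 + h ^+ s.+1 *: 'X) * \prod_(s < M) ('X + (h ^+ s.+1)%:P).
  have PQ : jprod h N.+1 M = (1 + 'X) * Q.
    by rewrite /jprod big_ord_recl expr0 scale1r mulrA.
  have Q1 : Q.[1] = qpoch h N * qpoch h M.
    rewrite /Q hornerM !horner_prod !qE; congr (_ * _); apply: eq_bigr => s _.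
      by rewrite hornerD hornerZ hornerX hornerC mulr1.
    by rewrite hornerD hornerX hornerC.
  transitivity (jprod h N.+1 M)^`().[1]; last first.
    rewrite (horner_coef_wide 1 (n := N.+1 + M)); last first.
      by apply/leq_sizeP => k k1; rewrite coef_deriv finite_jacobi gbin_gt ?mul0r ?mul0rn.
    rewrite [RHS]big_ord_recl mulr0n add0r; apply: eq_bigr => k _.
    by rewrite coef_deriv finite_jacobi expr1n mulr1 /bump /= ?add1n.
  have d1 : (1 + 'X)^`() = 1 :> {poly S}.
    by rewrite derivD derivX -[X in X^`() + _]polyC1 derivC add0r.
  move: Q PQ Q1 => Q PQ <-; rewrite PQ derivM d1 mul1r hornerD hornerM.
  rewrite [(1 + 'X).[1]]hornerD hornerX hornerC.
  by rewrite addrr_pchar2 // mul0r addr0.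
pose G k := qpoch h N * ((gbin h (N.+1 + M) k * h ^+ jexp M k) *+ k).
apply: (@eqmod_trans _ _ _ (\sum_(k < (N.+1 + M).+1) G k)).
  rewrite -mulr_sumr -E exprS expr2; apply: eqmodM => //; apply: eqmodM => //.
  apply: eqmod_sym => k kK; apply: (@qpoch_eqmod h N M h0); first by rewrite /M; lia.
  by lia.
have oddE (x : S) k : x *+ k = if odd k then x else 0.
  rewrite -{1}(odd_double_half k) mulrnDr -mul2n mulrnA (_ : x *+ 2 = 0); last first.
    by rewrite mulr2n addrr_pchar2.
  by rewrite mul0rn addr0; case: (odd k).
apply: (@eqmod_reindex K _ G _ _ (fun v : int => `|(2 * v + 1 + M%:Z)%R|%N)).
- exact: zball_uniq.
- by move=> u v; rewrite !mem_zball /M; lia.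
- by move=> u; rewrite mem_zball /M; lia.
- move=> k kn /mapP knot; rewrite /G oddE; case: ifP => ok; last by rewrite mulr0.
  rewrite mulrA -[X in eqmod _ _ X](mulr0 (qpoch h N * gbin h (N.+1 + M) k)).
  apply: eqmodM => //; apply: eqmod_expr0 => //.
  have [hK|hK] := leqP (K.*2) `|k%:Z - M%:Z|%N.
    rewrite /jexp; case: (leqP M k) => Mk; apply: leq_bin2; move: hK ok; rewrite /M; lia.
  exfalso; apply: knot; exists (((k%:Z - M%:Z - 1) %/ 2)%Z).
    by rewrite mem_zball; move: hK ok; rewrite /M; lia.
  by move: hK ok; rewrite /M; lia.
move=> v; rewrite mem_zball => vK.
set k := `|_|%N; have ok : odd k by rewrite /k /M; lia.
rewrite /G oddE ok mulrA -[X in eqmod _ _ X]mul1r; apply: eqmodM.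
  by apply: gbin_eqmod => //; rewrite /k /M; lia.
have -> // : jexp M k = `|(v * (2 * v + 1))%R|%N.
have b2 n : (2 * 'C(n.+1, 2) = n.+1 * n)%N by rewrite -mul_bin_diag bin1.
rewrite /jexp; case: (leqP M k) => Mk; case: v vK @k ok Mk => x xK k ok Mk.
- have -> : (k - M = (2 * x).+1)%N by rewrite /k; lia.
  have -> : `|(x%:Z * (2 * x%:Z + 1))%R|%N = (x * (2 * x).+1)%N by lia.
  by have := b2 (2 * x)%N; nia.
- by exfalso; move: Mk; rewrite /k; lia.
- by exfalso; move: Mk; rewrite /k /M; lia.
have -> : ((M - k).+1 = (2 * x).+2)%N by rewrite /k /M; lia.
have -> : `|(Negz x * (2 * Negz x + 1))%R|%N = (x.+1 * (2 * x).+1)%N.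
  have -> : 2 * Negz x + 1 = - ((2 * x).+1)%:Z by lia.
  by rewrite NegzE mulrNN abszM.
by have := b2 (2 * x).+1; nia.
Qed.
End TripleProduct.

(** * Theta constants as eta products *)

Section EulerProduct.
Variable F : fieldType.
Local Notation S := (powser F).

Definition euler : S := PowSer (fun k => coefs (qpoch (mono 1 1) k) k).

Lemma euler_eqmod K N : (K <= N)%N -> eqmod K.+1 euler (qpoch (mono 1 1) N).
Proof.
move=> KN k kK; rewrite /= (qpoch_eqmod (K := k) _ (leq_trans _ KN)) //.
Qed.

Lemma dilN c b (f : S) : dil c b (- f) = - dil c b f.
Proof. by apply: powserP => n /=; case: ifP; rewrite ?oppr0 // mulrN. Qed.

Lemma dil_qpoch c b (h : S) N : (0 < b)%N -> dil c b (qpoch h N) = qpoch (dil c b h) N.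
Proof.
move=> b0; elim: N => [|N IH].
  by rewrite [qpoch h 0]big_ord0 [qpoch _ 0]big_ord0 dil1.
by rewrite !qpochS dilM // IH dilD dilN dil1 // dilX.
Qed.

Lemma dil_euler_eqmod c b K N : (0 < b)%N -> (K <= N)%N ->
  eqmod K.+1 (dil c b euler) (qpoch (mono c b) N).
Proof.
move=> b0 KN; have -> : mono c b = dil c b (mono 1 1) :> S.
  by rewrite dil_mono // expr1 mulr1 mul1n.
by rewrite -dil_qpoch //; apply: dil_eqmod => //; apply: euler_eqmod.
Qed.

Lemma coefs_theta_progression (phi : int -> F) (N0 d : int) k K :
  d != 0 -> (forall u, (`|u| <= `|(N0 + d * u)%R|)%N) ->
  (forall N, phi N != 0 -> exists u, N = N0 + d * u) -> (k <= K)%N ->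
  coefs (theta phi) k =
  \sum_(u <- zball K) phi (N0 + d * u) *+ (qform (N0 + d * u) == k).
Proof.
move=> d0 hu supp kK; rewrite (coefs_theta phi kK).
pose P N := (qform N == k) && (phi N != 0).
have E N : phi N *+ (qform N == k) = phi N *+ P N.
  rewrite /P; case: (qform N == k) => //=; case: eqP => [->|_] //.
transitivity (\sum_(N <- zball K | P N) phi N).
  by rewrite -[RHS]sum_mulrnb; apply: eq_bigr => N _; apply: E.
transitivity (\sum_(u <- zball K | P (N0 + d * u)) phi (N0 + d * u)); last first.
  by rewrite -[LHS]sum_mulrnb; apply: eq_bigr => u _; rewrite E.
rewrite -[RHS](big_map (fun u => N0 + d * u) P phi) -[LHS]big_filter -[RHS]big_filter.
apply/perm_big/uniq_perm.
- exact/filter_uniq/zball_uniq.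
- rewrite filter_uniq // map_inj_uniq ?zball_uniq // => u v /addrI.
  exact: mulfI.
move=> N; rewrite !mem_filter; case: (boolP (P N)) => //= /andP[/eqP qN phiN].
rewrite mem_zball (leq_trans (qform_leq N)) ?qN //; symmetry; apply/mapP.
have [u Nu] := supp N phiN; exists u => //; rewrite mem_zball.
by rewrite (leq_trans (hu u)) // -Nu (leq_trans (qform_leq N)) ?qN.
Qed.

(* Completing the square turns a theta series along an arithmetic progression
   into the two-sided sum of the triple product. *)
Lemma theta_product (phi : int -> F) (N0 : int) (d : nat) (a c : F) K N M :
  (1 < d)%N -> (`|(2 * N0)%R| <= d)%N -> c != 0 ->
  (forall n, phi n != 0 -> exists u, n = N0 + d%:Z * u) ->
  (forall u, phi (N0 + d%:Z * u) = a * c ^ u) ->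
  (2 * K <= N)%N -> (2 * K <= M)%N ->
  let h := mono 1 (6 * d ^ 2)%N in
  eqmod K (theta phi) (mono a (qform N0) * (qpoch h N *
    (\prod_(s < N) (1 + mono c `|(3 * d%:Z ^+ 2 + 6 * N0 * d%:Z)%R|%N * h ^+ s) *
     \prod_(s < M) (1 + mono c^-1 `|(3 * d%:Z ^+ 2 - 6 * N0 * d%:Z)%R|%N * h ^+ s)))).
Proof.
move=> d1 dN0 c0 supp phiE NK MK h.
set e := `|_|%N; set e' := `|_|%N.
have eE : e%:Z = 3 * d%:Z ^+ 2 + 6 * N0 * d%:Z by rewrite /e gez0_abs //; nia.
have eE' : e'%:Z = 3 * d%:Z ^+ 2 - 6 * N0 * d%:Z by rewrite /e' gez0_abs //; nia.
have ww : mono c e * mono c^-1 e' = h :> S.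
  rewrite monoM divff //; congr (mono _ _); apply/eqP; rewrite -eqz_nat; apply/eqP.
  by rewrite PoszD eE eE' PoszM -[(d ^ 2)%N%:Z]/(d%:Z ^+ 2); ring.
have d0 : (0 < d)%N by apply: ltnW.
have h0 : coefs h 0 = 0 by rewrite /h /= ltn_eqF ?mulr0n // muln_gt0 expn_gt0 d0.
apply: (@eqmod_trans _ _ _ (mono a (qform N0) *
   \sum_(u <- zball K) jterm h (mono c e) (mono c^-1 e') u)); last first.
  apply: eqmodM => //; apply/eqmod_sym/jacobi_triple => //.
  exact: mono_neq0.
have dZ0 : d%:Z != 0 by rewrite -lt0n in d0 *; lia.
have hu u : (`|u| <= `|(N0 + d%:Z * u)%R|)%N.
  have [->|u0] := eqVneq u 0; first by rewrite absz0.
  by nia.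
move=> k kK; rewrite (coefs_theta_progression dZ0 hu supp (ltnW kK)).
rewrite mulr_sumr coefs_sum; apply: eq_bigr => u _.
suff -> : mono a (qform N0) * jterm h (mono c e) (mono c^-1 e') u =
    mono (a * c ^ u) (qform (N0 + d%:Z * u)) by rewrite phiE /= eq_sym.
have eZ : (e%:Z = 3 * d%:Z ^+ 2 + 6 * N0 * d%:Z) /\ (e'%:Z = 3 * d%:Z ^+ 2 - 6 * N0 * d%:Z).
  by [].
have b2 n : n%:Z * (n%:Z - 1) = 2 * 'C(n, 2)%:Z.
  case: n => // n; have := mul_bin_diag n.+1 1; rewrite bin1 /= => /(congr1 Posz).
  rewrite !PoszM => <-; congr (_ * _); lia.
move: (e) (e') eZ => {e e' eE eE' ww} e e' [eE eE'].
(* Here [3 (N0 + d v)^2 = 3 N0^2 + 6 d^2 (v (v - 1) / 2) + v (3 d^2 + 6 N0 d)], the source of both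
   [h] and the exponent of [w]. *)
have qE v (b : nat) : v * (v - 1) = 2 * b%:Z ->
    (qform (N0 + d%:Z * v))%:Z = (qform N0)%:Z + (b%:Z * (6 * d%:Z ^+ 2) + v * e%:Z).
  move=> vb; rewrite !qform_int eE.
  have -> : 3%:Z * (N0 + d%:Z * v) ^+ 2 = 3%:Z * N0 ^+ 2 + (3 * d%:Z ^+ 2 * (v * (v - 1)) +
     v * (3 * d%:Z ^+ 2 + 6 * N0 * d%:Z)) by ring.
  by rewrite vb; ring.
case: u => n; rewrite /jterm !monoX !monoM expr1n mul1r.
  congr (mono _ _); have := qE n%:Z 'C(n, 2) (b2 n).
  move: (qform _) (qform N0) => q q0 H; apply/eqP; rewrite -eqz_nat; apply/eqP.
  by rewrite H; ring.
congr (mono _ _); first by rewrite NegzE -exprnN exprVn.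
have := qE (Negz n) 'C(n.+2, 2).
have -> : 'C(n.+2, 2) = ('C(n.+1, 2) + n.+1)%N by rewrite binS bin1.
have vb : Negz n * (Negz n - 1) = 2 * ('C(n.+1, 2) + n.+1)%N%:Z.
  have -> : 2 * ('C(n.+1, 2) + n.+1)%N%:Z = n.+1%:Z * (n.+1%:Z - 1) + 2 * n.+1%:Z.
    by rewrite b2; ring.
  by rewrite NegzE; ring.
move=> /(_ vb); move: (qform _) (qform N0) => q q0 H.
apply/eqP; rewrite -eqz_nat; apply/eqP; rewrite H.
have ee : e'%:Z = 6 * d%:Z ^+ 2 - e%:Z by rewrite eE eE'; ring.
have -> : (q0 + ('C(n.+1, 2) * (6 * d ^ 2) + n.+1 * e'))%N%:Z =
    q0%:Z + ('C(n.+1, 2)%:Z * (6 * d%:Z ^+ 2) + n.+1%:Z * e'%:Z) by ring.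
by rewrite ee NegzE; ring.
Qed.

Hypothesis F2 : 2%N \in [pchar F].

Lemma qpoch_char2 (h : S) N : qpoch h N = \prod_(s < N) (1 + h ^+ s.+1).
Proof. by apply: eq_bigr => s _; rewrite oppr_pchar2 // powser_char2. Qed.

End EulerProduct.

Section HalfProducts.
Variables (l m : nat).
Hypothesis lE : l = m.*2.+1.

Lemma prod_half (R : comNzRingType) (x : nat -> R) :
  \prod_(1 <= r < l) x r = \prod_(1 <= k < m.+1) (x k * x (l - k)%N).
Proof.
rewrite (big_cat_nat (n := m.+1)) /=; [|lia|lia].
rewrite big_split /=; congr (_ * _).
rewrite -[m.+1 in LHS]add1n big_addn (_ : (l - m = m.+1)%N); last by lia.
rewrite big_nat_rev; apply: eq_big_nat => k /andP[k0 km].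
by congr (x _); lia.
Qed.

(** Write [1 + z^r y] as [z^r (y + z^(l - r))] and use the factorization of [X^l - 1] at [y]; the
    [z^r] multiply to [z^(l m) = 1] because [l] is odd. *)
Lemma prod_roots (F : fieldType) (R : comNzRingType) (f : {rmorphism F -> R})
    (z : F) (y : R) : l.-primitive_root z -> 2%N \in [pchar R] ->
  \prod_(r < l) (1 + f (z ^+ r) * y) = 1 + y ^+ l.
Proof.
move=> zl R2.
have zN r : (r < l)%N -> f (z ^+ (l - r)) * f (z ^+ r) = 1.
  by move=> rl; rewrite -rmorphM -exprD subnK ?(prim_expr_order zl) ?rmorph1 // ltnW.
have zr : \prod_(r < l) z ^+ r = 1.
  rewrite -expr_sum; have -> : (\sum_(r < l) r = l * m)%N.
    by rewrite -(big_mkord predT id) bin2_sum bin2 lE /= -doubleMr doubleK.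
  by rewrite exprM (prim_expr_order zl) expr1n.
have <- : \prod_(r < l) (y + f (z ^+ r)) = 1 + y ^+ l.
  have := congr1 (fun p => (map_poly f p).[y]) (factor_Xn_sub_1 zl).
  rewrite rmorph_prod horner_prod big_mkord.
  under eq_bigr => r _ do rewrite rmorphB /= map_polyX map_polyC hornerXsubC (oppr_pchar2 R2).
  move=> ->; rewrite rmorphB /= map_polyXn rmorph1.
  by rewrite hornerD hornerN hornerXn hornerC (oppr_pchar2 R2) addrC.
transitivity (\prod_(r < l) (f (z ^+ r) * (y + f (z ^+ (l - r))))).
  by apply: eq_bigr => r _; rewrite mulrDr [_ * f (z ^+ (l - r))]mulrC zN // addrC.
rewrite big_split /= -rmorph_prod zr rmorph1 mul1r (reindex_inj rev_ord_inj) /=.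
transitivity (\prod_(r < l) (y + f (z ^+ r.+1))).
  by apply: eq_bigr => r _; rewrite subKn.
have zl1 : f (z ^+ m.*2.+1) = 1 by rewrite -lE (prim_expr_order zl) rmorph1.
rewrite -(big_mkord predT (fun r => y + f (z ^+ r.+1))).
rewrite -(big_mkord predT (fun r => y + f (z ^+ r))) lE big_nat_recr //= zl1.
by rewrite big_nat_recl //= expr0 rmorph1 mulrC.
Qed.

End HalfProducts.

Section Constants.
Variable F : fieldType.
Definition cst (c : F) : powser F := mono c 0.

Fact cst_is_zmod_morphism : zmod_morphism cst.
Proof. by move=> x y; apply: powserP => n /=; rewrite mulrnBl. Qed.
HB.instance Definition _ :=
  GRing.isZmodMorphism.Build F (powser F) cst cst_is_zmod_morphism.

Fact cst_is_monoid_morphism : monoid_morphism cst.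
Proof. by split=> [|x y]; [apply: mono1|rewrite /cst monoM]. Qed.
HB.instance Definition _ :=
  GRing.isMonoidMorphism.Build F (powser F) cst cst_is_monoid_morphism.
End Constants.

Section ThetaProducts.
Variable F : fieldType.
Hypothesis F2 : 2%N \in [pchar F].
Variables (l m : nat) (ze : F).
Hypothesis lE : l = m.*2.+1.
Hypothesis m0 : (0 < m)%N.
Hypothesis ze_prim : (l ^ 2).-primitive_root ze.
Local Notation S := (powser F).
Local Notation tB := (tB l ze).
Local Notation h := (mono 1 (24 * l ^ 2)%N : S).

Let l0 : (0 < l)%N. Proof. by rewrite lE. Qed.
Let ze0 : ze != 0.
Proof. by rewrite (prim_root_eq0 ze_prim) expn_eq0 lE. Qed.
Let S2 := powser_char2 F2.

Let h0 : coefs h 0 = 0.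
Proof. by rewrite /= ltn_eqF ?mulr0n // muln_gt0 expn_gt0 l0. Qed.

Lemma qpoch_block (g : S) N : qpoch g (N * l) =
  \prod_(s < N) ((1 + g ^+ (s.+1 * l)) * \prod_(1 <= r < l) (1 + g ^+ (s * l + r))).
Proof.
elim: N => [|N IH]; first by rewrite mul0n big_ord0 [qpoch _ _]big_ord0.
rewrite big_ord_recr /= -IH !qpoch_char2 // mulSn addnC big_split_ord /=.
congr (_ * _); rewrite -(big_mkord predT (fun r => 1 + g ^+ (N * l + r).+1)).
rewrite lE big_nat_recr //= mulrC; congr (_ * _).
  by congr (1 + g ^+ _); lia.
rewrite big_add1 /=; apply: eq_bigr => r _; by rewrite addnS.
Qed.

Section Finite.
Variable i : nat.
Let c : F := ze ^+ (2 * i * l).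
Let g : S := mono c (24 * l).

Let c0 : c != 0. Proof. exact: expf_neq0. Qed.
Let cl : c ^+ l = 1.
Proof.
rewrite -exprM (_ : (2 * i * l * l = l ^ 2 * (2 * i))%N); last by lia.
by rewrite exprM (prim_expr_order ze_prim) expr1n.
Qed.
Let gl : g ^+ l = h.
Proof. by rewrite monoX cl; congr (mono _ _); lia. Qed.

(** The odd integers congruent to [2 k] modulo [l] are the [2 k - l + 2 l u], so [theta_product]
    applies. Since [g^l = h], its two products run over the factors [1 + g^r] with [r = k] and
    [r = - k] modulo [l]. *)
Lemma tB_finite k : (0 < k <= m)%N -> exists2 a, a != 0 & forall K N, (2 * K <= N)%N ->
  eqmod K (tB i%:Z 1 k%:Z) (mono a (3 * (l - 2 * k) ^ 2)%N * (qpoch h N *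
     (\prod_(s < N) (1 + g ^+ (s * l + k)) * \prod_(s < N) (1 + g ^+ (s * l + (l - k)))))).
Proof.
move=> /andP[k0 km].
pose N0 : int := 2 * k%:Z - l%:Z.
exists (ze ^ (i%:Z * (k%:Z * N0 - k%:Z ^+ 2 * 1))); first exact: expfz_neq0.
move=> K N NK.
have := @theta_product F (odd_part (chi l ze i%:Z 1 k%:Z)) N0 (2 * l)
  (ze ^ (i%:Z * (k%:Z * N0 - k%:Z ^+ 2 * 1))) (c ^+ k) K N N.
have -> : (6 * (2 * l) ^ 2 = 24 * l ^ 2)%N by rewrite expnMn; lia.
have -> : qform N0 = (3 * (l - 2 * k) ^ 2)%N.
  by rewrite /qform /N0; congr (3 * _ ^ 2)%N; lia.
have e1 : `|(3 * (2 * l)%N%:Z ^+ 2 + 6 * N0 * (2 * l)%N%:Z)%R|%N = (k * (24 * l))%N.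
  have -> : 3 * (2 * l)%N%:Z ^+ 2 + 6 * N0 * (2 * l)%N%:Z = (k * (24 * l))%N%:Z.
    by rewrite /N0; ring.
  by [].
have e2 : `|(3 * (2 * l)%N%:Z ^+ 2 - 6 * N0 * (2 * l)%N%:Z)%R|%N = ((l - k) * (24 * l))%N.
  have -> : 3 * (2 * l)%N%:Z ^+ 2 - 6 * N0 * (2 * l)%N%:Z = ((l - k) * (24 * l))%N%:Z.
    have -> : ((l - k) * (24 * l))%N%:Z = (l%:Z - k%:Z) * (24 * l)%N%:Z.
      by rewrite PoszM subzn //; lia.
    by rewrite /N0; ring.
  by [].
rewrite e1 e2 => H.
have {}H := H _ _ _ _ _ NK NK.
apply: eqmod_trans (H _ _ _ _ _) _ => {H}.
- by lia.
- by rewrite /N0; lia.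
- exact: expf_neq0.
- move=> n; rewrite /odd_part /chi; have [|n2] := boolP (2 %| n)%Z; rewrite ?eqxx //.
  case: ifP => [/dvdzP[q nq] _|]; last by rewrite eqxx.
  have [u qu] : exists u, q = 2 * u - 1.
    exists ((q + 1) %/ 2)%Z; have [/dvdzP[v qv]|] := boolP (2 %| q)%Z; last by lia.
    case/negP: n2; apply/dvdzP; exists (k%:Z + v * l%:Z).
    by rewrite -[n](subrK (2 * k%:Z * 1)) nq qv; ring.
  exists u; rewrite -[n](subrK (2 * k%:Z * 1)) nq qu /N0 PoszM; ring.
- move=> u; rewrite /odd_part /chi.
  have -> : (2 %| N0 + (2 * l)%N%:Z * u)%Z = false.
    have -> : N0 + (2 * l)%N%:Z * u = 2 * (k%:Z + l%:Z * u - m%:Z) - 1.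
      rewrite /N0 PoszM; have -> : l%:Z = 2 * m%:Z + 1 by rewrite lE; lia.
      by ring.
    by lia.
  have -> : (l%:Z %| N0 + (2 * l)%N%:Z * u - 2 * k%:Z * 1)%Z.
    by apply/dvdzP; exists (2 * u - 1); rewrite /N0 PoszM; ring.
  have -> : c ^+ k ^ u = ze ^ ((2 * i * l * k)%N%:Z * u) by rewrite /c -exprM -exprz_exp.
  rewrite -expfzDr //; congr (_ ^ _).
  by rewrite !PoszM; ring.
apply: eqmodM => //; apply: eqmodM => //; apply: eqmodM; apply: eqmod_prod => s _.
  by rewrite -monoX -gl -exprM -exprD [(l * s)%N]mulnC [(k + _)%N]addnC.
have -> : c ^- k = c ^+ (l - k).
  apply: (mulIf (expf_neq0 k c0)); rewrite mulVf ?expf_neq0 // -exprD subnK ?cl //.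
  by lia.
by rewrite -monoX -gl -exprM -exprD [(l * s)%N]mulnC [(l - k + _)%N]addnC.
Qed.

(** For [k = 1..m] the residues [k] and [- k] exhaust the nonzero classes modulo [l]. One of the [m]
    copies of [qpoch h] supplies the class 0 and completes them to [qpoch g]; the other [m - 1]
    copies remain. *)
Lemma beta_finite : exists2 a, a != 0 & \prod_(1 <= k < m.+1) tB i%:Z 1 k%:Z =
  mono a (\sum_(1 <= k < m.+1) 3 * (l - 2 * k) ^ 2)%N *
    dil 1 (24 * l ^ 2) (euler F) ^+ m.-1 * dil c (24 * l) (euler F).
Proof.
have exa k : exists a, (0 < k <= m)%N -> a != 0 /\ forall K N, (2 * K <= N)%N ->
  eqmod K (tB i%:Z 1 k%:Z) (mono a (3 * (l - 2 * k) ^ 2)%N * (qpoch h N *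
     (\prod_(s < N) (1 + g ^+ (s * l + k)) * \prod_(s < N) (1 + g ^+ (s * l + (l - k)))))).
  case: (boolP (0 < k <= m)%N) => km; last by exists 1.
  by have [a a0 aP] := tB_finite km; exists a.
have [a aP] := choice exa.
exists (\prod_(1 <= k < m.+1) a k).
  rewrite prodf_seq_neq0; apply/allP => k; rewrite mem_index_iota => km.
  by have [] := aP k km.
apply: eqmod_eq => K; pose N := (2 * K)%N.
have E1 : eqmod K (\prod_(1 <= k < m.+1) tB i%:Z 1 k%:Z)
  (\prod_(1 <= k < m.+1) (mono (a k) (3 * (l - 2 * k) ^ 2)%N * (qpoch h N *
     (\prod_(s < N) (1 + g ^+ (s * l + k)) * \prod_(s < N) (1 + g ^+ (s * l + (l - k))))))).
  rewrite big_seq [X in eqmod _ _ X]big_seq; apply: eqmod_prod => k.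
  by rewrite mem_index_iota => km; have [_] := aP k km; apply.
apply: eqmod_trans E1 _; rewrite big_split [X in eqmod _ (_ * X)]big_split /=.
have -> : \prod_(1 <= k < m.+1) mono (a k) (3 * (l - 2 * k) ^ 2)%N =
    mono (\prod_(1 <= k < m.+1) a k) (\sum_(1 <= k < m.+1) 3 * (l - 2 * k) ^ 2)%N :> S.
  elim/big_rec3: _ => [|k x y z _ ->]; first by rewrite mono1.
  by rewrite monoM.
rewrite -mulrA; apply: eqmodM => //.
rewrite prodr_const_nat subn1 /= -{1}(prednK m0) exprSr -mulrA.
apply: eqmodM.
  apply: eqmodX => j jK; apply: eqmod_sym (leqW jK).
  by apply: dil_euler_eqmod; rewrite ?muln_gt0 ?expn_gt0 ?l0 // /N; lia.
have -> : qpoch h N * \prod_(1 <= k < m.+1) (\prod_(s < N) (1 + g ^+ (s * l + k)) *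
     \prod_(s < N) (1 + g ^+ (s * l + (l - k)))) = qpoch g (N * l).
  rewrite qpoch_block [RHS]big_split /=; congr (_ * _).
    by rewrite qpoch_char2 //; apply: eq_bigr => s _; rewrite -gl -exprM mulnC.
  under eq_bigr => k _ do rewrite -big_split /=.
  rewrite exchange_big; apply: eq_bigr => s _.
  by rewrite (prod_half lE (fun r => 1 + g ^+ (s * l + r))).
move=> j jK; apply: eqmod_sym (leqW jK).
by apply: dil_euler_eqmod; rewrite ?muln_gt0 ?l0 // /N; nia.
Qed.

End Finite.
Let z : F := ze ^+ (2 * l).

Let z_prim : l.-primitive_root z.
Proof.
have zl : l.-primitive_root (ze ^+ l).
  have := dvdn_prim_root ze_prim (dvdn_exp (isT : 0 < 2)%N (dvdnn l)).
  by rewrite -{1}mulnn mulnK.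
by rewrite /z mulnC exprM (prim_root_exp_coprime _ zl) coprime2n lE /= odd_double.
Qed.

Let z0 : z != 0. Proof. exact: expf_neq0. Qed.

Lemma tB_infinite k : (0 < k <= m)%N -> exists2 a, a != 0 & forall K N, (2 * K <= N)%N ->
  eqmod K (tB 1 0 k%:Z) (mono a (3 * l ^ 2)%N * (qpoch h N.+1 *
     (\prod_(s < N.+1) (1 + cst (z ^+ k) * h ^+ s) *
      \prod_(s < N) (1 + cst (z ^+ (l - k)) * h ^+ s.+1)))).
Proof.
move=> /andP[k0 km].
exists (ze ^ (- (k * l)%N%:Z)); first exact: expfz_neq0.
move=> K N NK.
have := @theta_product F (odd_part (chi l ze 1 0 k%:Z)) (- l%:Z) (2 * l)
  (ze ^ (- (k * l)%N%:Z)) (z ^+ k) K N.+1 N.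
have -> : (6 * (2 * l) ^ 2 = 24 * l ^ 2)%N by rewrite expnMn; lia.
have -> : qform (- l%:Z) = (3 * l ^ 2)%N by rewrite qformN.
(* The exponent 0 makes the factor [s = 0] the constant [1 + z ^+ k], whence the one extra factor in
   the first product; [beta_infinite] moves it into the leading coefficient. *)
have e1 : `|(3 * (2 * l)%N%:Z ^+ 2 + 6 * - l%:Z * (2 * l)%N%:Z)%R|%N = 0%N.
  by have -> : 3 * (2 * l)%N%:Z ^+ 2 + 6 * - l%:Z * (2 * l)%N%:Z = 0 by ring.
have e2 : `|(3 * (2 * l)%N%:Z ^+ 2 - 6 * - l%:Z * (2 * l)%N%:Z)%R|%N = (24 * l ^ 2)%N.
  by have -> : 3 * (2 * l)%N%:Z ^+ 2 - 6 * - l%:Z * (2 * l)%N%:Z = (24 * l ^ 2)%N%:Z by ring.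
rewrite e1 e2 => H; have {}H := H _ _ _ _ _ (leqW NK) NK.
apply: eqmod_trans (H _ _ _ _ _) _ => {H}.
- by lia.
- by lia.
- exact: expf_neq0.
- move=> n; rewrite /odd_part /chi; have [|n2] := boolP (2 %| n)%Z; rewrite ?eqxx //.
  case: ifP => [/dvdzP[q nq] _|]; last by rewrite eqxx.
  rewrite mulr0 subr0 in nq.
  have [u qu] : exists u, q = 2 * u - 1.
    exists ((q + 1) %/ 2)%Z; have [/dvdzP[v qv]|] := boolP (2 %| q)%Z; last by lia.
    by case/negP: n2; apply/dvdzP; exists (v * l%:Z); rewrite nq qv; ring.
  by exists u; rewrite nq qu PoszM; ring.
- move=> u; rewrite /odd_part /chi.
  have -> : (2 %| - l%:Z + (2 * l)%N%:Z * u)%Z = false.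
    have -> : - l%:Z + (2 * l)%N%:Z * u = 2 * (l%:Z * u - m%:Z) - 1.
      rewrite PoszM; have -> : l%:Z = 2 * m%:Z + 1 by rewrite lE; lia.
      by ring.
    by lia.
  have -> : (l%:Z %| - l%:Z + (2 * l)%N%:Z * u - 2 * k%:Z * 0)%Z.
    by apply/dvdzP; exists (2 * u - 1); rewrite PoszM; ring.
  have -> : z ^+ k ^ u = ze ^ ((2 * l * k)%N%:Z * u) by rewrite /z -exprM -exprz_exp.
  rewrite -expfzDr //; congr (_ ^ _).
  by rewrite !PoszM; ring.
apply: eqmodM => //; apply: eqmodM => //; apply: eqmodM; apply: eqmod_prod => s _ //.
have -> : (z ^+ k)^-1 = z ^+ (l - k).
  apply: (mulIf (expf_neq0 k z0)); rewrite mulVf ?expf_neq0 // -exprD subnK.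
    by rewrite (prim_expr_order z_prim).
  by lia.
by rewrite exprS mulrA monoM mulr1.
Qed.

(** For each [s >= 1] the factors [1 + z^r h^s] over nonzero [r] modulo [l], together with [1 + h^s]
    from one copy of [qpoch h], multiply to [1 + h^(s l)] by [prod_roots]. *)
Lemma beta_infinite : exists2 a, a != 0 & \prod_(1 <= k < m.+1) tB 1 0 k%:Z =
  mono a (m * (3 * l ^ 2))%N *
    dil 1 (24 * l ^ 2) (euler F) ^+ m.-1 * dil 1 (24 * l ^ 3) (euler F).
Proof.
have exa k : exists a, (0 < k <= m)%N -> a != 0 /\ forall K N, (2 * K <= N)%N ->
  eqmod K (tB 1 0 k%:Z) (mono a (3 * l ^ 2)%N * (qpoch h N.+1 *
     (\prod_(s < N.+1) (1 + cst (z ^+ k) * h ^+ s) *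
      \prod_(s < N) (1 + cst (z ^+ (l - k)) * h ^+ s.+1)))).
  case: (boolP (0 < k <= m)%N) => km; last by exists 1.
  by have [a a0 aP] := tB_infinite km; exists a.
have [a aP] := choice exa.
exists (\prod_(1 <= k < m.+1) (a k * (1 + z ^+ k))).
  rewrite prodf_seq_neq0; apply/allP => k; rewrite mem_index_iota => km.
  have [a0 _] := aP k km; rewrite mulf_neq0 //=.
  rewrite addr_eq0 oppr_pchar2 // eq_sym -(prim_order_dvd z_prim) gtnNdvd //; lia.
apply: eqmod_eq => K; pose N := (2 * K)%N.
have E1 : eqmod K (\prod_(1 <= k < m.+1) tB 1 0 k%:Z)
  (\prod_(1 <= k < m.+1) (mono (a k * (1 + z ^+ k)) (3 * l ^ 2)%N * (qpoch h N.+1 *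
     (\prod_(s < N) (1 + cst (z ^+ k) * h ^+ s.+1) *
      \prod_(s < N) (1 + cst (z ^+ (l - k)) * h ^+ s.+1))))).
  rewrite big_seq [X in eqmod _ _ X]big_seq; apply: eqmod_prod => k.
  rewrite mem_index_iota => km; have [_ H] := aP k km.
  apply: eqmod_trans (H K N (leqnn _)) _; rewrite big_ord_recl expr0 mulr1.
  have -> : mono (a k * (1 + z ^+ k)) (3 * l ^ 2) =
      mono (a k) (3 * l ^ 2) * (1 + cst (z ^+ k)).
    by rewrite -(rmorph1 (@cst F)) -rmorphD /= monoM addn0.
  by rewrite -!mulrA [qpoch _ _ * _]mulrCA [_ * (qpoch _ _ * _)]mulrA.
apply: eqmod_trans E1 _; rewrite big_split [X in eqmod _ (_ * X)]big_split /=.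
have -> : \prod_(1 <= k < m.+1) mono (a k * (1 + z ^+ k)) (3 * l ^ 2)%N =
    mono (\prod_(1 <= k < m.+1) (a k * (1 + z ^+ k))) (m * (3 * l ^ 2))%N :> S.
  have -> : (m * (3 * l ^ 2) = \sum_(1 <= k < m.+1) 3 * l ^ 2)%N.
    by rewrite sum_nat_const_nat subn1.
  elim/big_rec3: _ => [|k x y b _ ->]; first by rewrite mono1.
  by rewrite monoM.
rewrite -mulrA; apply: eqmodM => //.
rewrite prodr_const_nat subn1 /= -{1}(prednK m0) exprSr -mulrA.
have Q : eqmod K (qpoch h N.+1) (qpoch h N).
  by move=> j jK; rewrite (qpoch_eqmod (K := N) h0) // /N; lia.
apply: eqmodM.
  apply: eqmodX; apply: eqmod_trans Q _ => j jK; apply: eqmod_sym (leqW jK).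
  by apply: dil_euler_eqmod; rewrite ?muln_gt0 ?expn_gt0 ?l0 // /N; lia.
apply: eqmod_trans (eqmodM Q (@eqmod_refl _ _ _)) _.
have -> : qpoch h N * \prod_(1 <= k < m.+1) (\prod_(s < N) (1 + cst (z ^+ k) * h ^+ s.+1) *
     \prod_(s < N) (1 + cst (z ^+ (l - k)) * h ^+ s.+1)) = qpoch (mono 1 (24 * l ^ 3)) N.
  rewrite !qpoch_char2 //.
  under [X in _ * X]eq_bigr => k _ do rewrite -big_split /=.
  rewrite exchange_big -big_split /=; apply: eq_bigr => s _.
  rewrite -(prod_half lE (fun r => 1 + cst (z ^+ r) * h ^+ s.+1)).
  have -> : mono 1 (24 * l ^ 3) ^+ s.+1 = (h ^+ s.+1) ^+ l.
    by rewrite !monoX !expr1n; congr (mono _ _); lia.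
  rewrite -(@prod_roots l m lE _ _ (@cst F) z (h ^+ s.+1) z_prim S2).
  rewrite -(big_mkord predT (fun r => 1 + cst (z ^+ r) * h ^+ s.+1)).
  by rewrite [in RHS]big_ltn // expr0 rmorph1 mul1r.
move=> j jK; apply: eqmod_sym (leqW jK).
by apply: dil_euler_eqmod; rewrite ?muln_gt0 ?expn_gt0 ?l0 // /N; lia.
Qed.

(** For [N = l (4 v + 1)] one has [3 N^2 = 3 l^2 + 24 l^2 v (2 v + 1)], the exponents of
    [jacobi_cube] at [h = Z^(24 l^2)]. *)
Lemma talpha_cube : talpha F l = (mono 1 (l ^ 2) * dil 1 (24 * l ^ 2) (euler F)) ^+ 3.
Proof.
(* Up to the symmetry [N -> - N] the residue 1 modulo 4 may be replaced by that of [l], so that [l]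
   itself starts the progression. *)
have -> : talpha F l = theta (fun N => ((l%:Z %| N)%Z && (4 %| N - l%:Z)%Z)%:R : F).
  have [l1|l3] : (4 %| l%:Z - 1)%Z \/ (4 %| l%:Z + 1)%Z by lia.
    by apply: eq_theta => N; congr (nat_of_bool (_ && _))%:R; lia.
  by rewrite talphaN; apply: eq_theta => N; congr (nat_of_bool (_ && _))%:R; lia.
set phi := fun N : int => _.
have lZ0 : l%:Z != 0 by lia.
have d0 : 4 * l%:Z != 0 by rewrite mulf_neq0.
have hu u : (`|u| <= `|(l%:Z + 4 * l%:Z * u)%R|)%N.
  have -> : l%:Z + 4 * l%:Z * u = l%:Z * (4 * u + 1) by ring.
  by rewrite abszM -{1}[`|u|%N]mul1n leq_mul //; lia.
have supp N : phi N != 0 -> exists u, N = l%:Z + 4 * l%:Z * u.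
  rewrite /phi; case: (boolP (l%:Z %| N)%Z) => [/dvdzP[q ->]|]; last by rewrite eqxx.
  case: (boolP (4 %| _)%Z) => [h4 _|]; last by rewrite eqxx.
  suff /dvdzP[u qu] : (4 %| q - 1)%Z.
    by exists u; rewrite -[q](subrK 1) qu; ring.
  have c4 : coprimez 4 l%:Z by rewrite coprimezE -[`|4|%N]/(2 ^ 2)%N coprime_pexpl // coprime2n lE /= odd_double.
  by rewrite -(Gauss_dvdzl _ c4) mulrBl mul1r.
have phi1 u : phi (l%:Z + 4 * l%:Z * u) = 1.
  rewrite /phi addrAC subrr add0r.
  have -> : (l%:Z %| l%:Z + 4 * l%:Z * u)%Z.
    by apply/dvdzP; exists (1 + 4 * u); ring.
  by have -> : (4 %| 4 * l%:Z * u)%Z by apply/dvdzP; exists (l%:Z * u); ring.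
apply: eqmod_eq => K; pose N := (4 * K + 2)%N.
rewrite exprMn monoX expr1n.
apply: (@eqmod_trans _ _ _ (mono 1 (3 * l ^ 2) * \sum_(v <- zball K) h ^+ `|(v * (2 * v + 1))%R|%N)).
  move=> k kK; rewrite (coefs_theta_progression d0 hu supp (ltnW kK)).
  rewrite mulr_sumr coefs_sum; apply: eq_bigr => v _.
  rewrite phi1 monoX expr1n monoM mulr1 /= eq_sym; congr (1 *+ (_ == _)).
  apply/eqP; rewrite -eqz_nat qform_int.
  have v0 : `|(v * (2 * v + 1))%R|%N%:Z = v * (2 * v + 1) by rewrite gez0_abs //; nia.
  move: v0; set q := absz _ => v0; apply/eqP.
  transitivity (3 * l%:Z ^+ 2 + q%:Z * (24 * l%:Z ^+ 2)); last by ring.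
  by rewrite v0; ring.
apply: eqmodM => //; apply: eqmod_trans (eqmod_sym (jacobi_cube F2 h0 (leqnn N))) _.
apply: eqmodX => j jK; apply: eqmod_sym (leqW jK).
by apply: dil_euler_eqmod; rewrite ?muln_gt0 ?expn_gt0 ?l0 // /N; lia.
Qed.

End ThetaProducts.

(** * Leading terms *)

Section Leading.
Variable F : fieldType.
Hypothesis F2 : 2%N \in [pchar F].
Variables (l m : nat) (ze : F).
Hypothesis lE : l = m.*2.+1.
Hypothesis l_prime : prime l.
Hypothesis ze_prim : (l ^ 2).-primitive_root ze.
Local Notation S := (powser F).
Local Notation tA := (tA l ze).
Local Notation tB := (tB l ze).

Let l0 : (0 < l)%N. Proof. by rewrite lE. Qed.
Let ze0 : ze != 0.
Proof. by rewrite (prim_root_eq0 ze_prim) expn_eq0 lE. Qed.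

Let zt := ze ^+ l.
Let zt_prim : l.-primitive_root zt.
Proof.
have := dvdn_prim_root ze_prim (dvdn_exp (isT : 0 < 2)%N (dvdnn l)).
by rewrite -{1}mulnn mulnK.
Qed.
Let zt0 : zt != 0. Proof. exact: expf_neq0. Qed.

Lemma tA_infinite_lead n : lead_at (tA 1 0 n%:Z) 0 1.
Proof.
have e : even_part (chi l ze 1 0 n%:Z) 0 = 1.
  by rewrite /even_part /chi !(mulr0, subr0) !dvdz0.
by rewrite -e; apply: theta_lead0; rewrite e oner_neq0.
Qed.

Lemma tB_infinite_lead n :
  lead_at (tB 1 0 n%:Z) (3 * l ^ 2) (zt ^+ n + zt ^- n).
Proof.
have ol : (2 %| l%:Z)%Z = false by rewrite lE; lia.
have -> : zt ^+ n + zt ^- n = odd_part (chi l ze 1 0 n%:Z) l%:Z +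
    odd_part (chi l ze 1 0 n%:Z) (- l%:Z).
  rewrite /odd_part /chi !rpredN ol !(mulr0, subr0) rpredN dvdzz !mul1r mulrN.
  by rewrite -PoszM mulnC /zt -exprM -exprnP -exprnN.
apply: theta_lead => // N Nl; rewrite /odd_part /chi mulr0 subr0.
case: ifP => // N2; case: ifP => // lN.
have N0 : N = 0 by apply/eqP; rewrite -absz_eq0; move: lN; rewrite dvdzE; case: `|N|%N Nl => // k kl /dvdn_leq; lia.
by move: N2; rewrite N0 dvdz0.
Qed.

Section Finite.
Variables (i n : nat).
Hypothesis nm : (0 < n <= m)%N.

Let ol : (2 %| l%:Z)%Z = false. Proof. by rewrite lE; lia. Qed.

(** The support is [2 n + 2 l Z], and [2 n < l] makes [2 n] its only element of least absolute
    value. For [tB] the support is [2 n - l + 2 l Z], with least element [2 n - l]. *)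
Lemma tA_finite_lead : lead_at (tA i%:Z 1 n%:Z) (12 * n ^ 2) (ze ^ (i * n ^ 2)%N%:Z).
Proof.
have -> : (12 * n ^ 2 = 3 * (2 * n) ^ 2)%N by rewrite expnMn; lia.
have -> : ze ^ (i * n ^ 2)%N%:Z = even_part (chi l ze i%:Z 1 n%:Z) (2 * n)%N%:Z +
    even_part (chi l ze i%:Z 1 n%:Z) (- (2 * n)%N%:Z).
  rewrite /even_part /chi.
  have -> : (2 %| (2 * n)%N%:Z)%Z by lia.
  have -> : (2 %| - (2 * n)%N%:Z)%Z by lia.
  have -> : (2 * n)%N%:Z - 2 * n%:Z * 1 = 0 by rewrite PoszM; ring.
  rewrite dvdz0 ifF ?addr0; first by congr (_ ^ _); rewrite !PoszM; ring.
  have -> : - (2 * n)%N%:Z - 2 * n%:Z * 1 = - ((2 ^ 2) * n)%N%:Z by rewrite !PoszM; ring.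
  rewrite rpredN dvdzE /= Gauss_dvdr ?gtnNdvd //; try lia.
  by rewrite coprime_pexpr // coprimen2 lE /= odd_double.
apply: theta_lead => // [|N Nn]; first by lia.
rewrite /even_part /chi; case: ifP => // N2; case: ifP => // /dvdzP[q qN].
have [q1|q1] : q = -1 \/ (q >= 0 \/ q <= -2)%R by lia.
  by move: N2 qN; rewrite q1; lia.
exfalso; nia.
Qed.

Lemma tB_finite_lead : lead_at (tB i%:Z 1 n%:Z) (3 * (l - 2 * n) ^ 2)
  (ze ^ (i%:Z * (n%:Z ^+ 2 - n%:Z * l%:Z))).
Proof.
have ln : (2 * n < l)%N by lia.
have n0E : (l - 2 * n)%N%:Z = l%:Z - 2 * n%:Z by rewrite -subzn ?PoszM // ltnW.
have -> : ze ^ (i%:Z * (n%:Z ^+ 2 - n%:Z * l%:Z)) =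
    odd_part (chi l ze i%:Z 1 n%:Z) (l - 2 * n)%N%:Z +
    odd_part (chi l ze i%:Z 1 n%:Z) (- (l - 2 * n)%N%:Z).
  rewrite /odd_part /chi n0E.
  have -> : (2 %| l%:Z - 2 * n%:Z)%Z = false by lia.
  have -> : (2 %| - (l%:Z - 2 * n%:Z))%Z = false by lia.
  have -> : - (l%:Z - 2 * n%:Z) - 2 * n%:Z * 1 = - l%:Z by ring.
  have -> : (l%:Z %| l%:Z - 2 * n%:Z - 2 * n%:Z * 1)%Z = false.
    have -> : l%:Z - 2 * n%:Z - 2 * n%:Z * 1 = l%:Z - ((2 ^ 2) * n)%N%:Z by rewrite !PoszM; ring.
    rewrite rpredBl ?dvdzz // dvdzE /= Gauss_dvdr ?gtnNdvd //; try lia.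
    by rewrite coprime_pexpr // coprimen2 lE /= odd_double.
  by rewrite rpredN dvdzz add0r; congr (_ ^ _); ring.
apply: theta_lead => // [|N Nn]; first by lia.
rewrite /odd_part /chi; case: ifP => // N2; case: ifP => // /dvdzP[q qN].
have [q1|[q1|q1]] : q = 0 \/ q = -1 \/ (q >= 1 \/ q <= -2)%R by lia.
- by move: N2 qN; rewrite q1; lia.
- by move: qN; rewrite q1; lia.
exfalso; nia.
Qed.
End Finite.

(* The [l + 1] lines of the [l]-torsion plane; [None] is the line at infinity. *)
Definition line_slope (C : option 'I_l) : int * int :=
  if C is Some i then (i%:Z, 1) else (1, 0).
Definition lineA C n := tA (line_slope C).1 (line_slope C).2 n%:Z.
Definition lineB C n := tB (line_slope C).1 (line_slope C).2 n%:Z.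

Let sum_zt : \sum_(1 <= k < m.+1) (zt ^+ k + zt ^- k) = 1.
Proof.
have ztV k : (0 < k < m.+1)%N -> zt ^- k = zt ^+ (l - k).
  move=> km; apply: (mulIf (expf_neq0 k zt0)); rewrite mulVf ?expf_neq0 // -exprD.
  by rewrite subnK ?(prim_expr_order zt_prim) //; lia.
transitivity (\sum_(1 <= k < l) zt ^+ k).
  transitivity (\sum_(1 <= k < m.+1) (zt ^+ k + zt ^+ (l - k))).
    by apply: eq_big_nat => k km; rewrite ztV.
  rewrite big_split /= [RHS](big_cat_nat (n := m.+1)) /=; [|lia|lia].
  congr (_ + _); rewrite -[m.+1 in RHS]add1n big_addn (_ : (l - m = m.+1)%N); last by lia.
  rewrite [RHS]big_nat_rev; apply: eq_big_nat => k /andP[k0 km].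
  by congr (_ ^+ _); lia.
have zt1 : zt - 1 != 0.
  rewrite subr_eq0; apply/eqP => zt1; have := prim_order_dvd zt_prim 1.
  by rewrite expr1 zt1 eqxx dvdn1; have := prime_gt1 l_prime; lia.
have z0 : 1 + \sum_(1 <= k < l) zt ^+ k = 0.
  transitivity (\sum_(0 <= k < l) zt ^+ k); first by rewrite [RHS]big_ltn.
  apply: (mulfI zt1); rewrite mulr0 big_mkord -subrX1 (prim_expr_order zt_prim).
  by rewrite subrr.
by move/eqP: z0; rewrite addrC addr_eq0 oppr_pchar2 // => /eqP.
Qed.

Let ztn_neq0 n : (0 < n <= m)%N -> zt ^+ n + zt ^- n != 0.
Proof.
move=> nm; rewrite addr_eq0 oppr_pchar2 //; apply/eqP => e.
have : zt ^+ (2 * n) == 1 by rewrite mul2n -addnn exprD {1}e mulVf // expf_neq0.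
by rewrite -(prim_order_dvd zt_prim) gtnNdvd //; lia.
Qed.

Lemma lineA_neq0 C n : (0 < n <= m)%N -> lineA C n != 0.
Proof.
move=> nm; case: C => [i|].
  by apply: lead_at_neq0 (tA_finite_lead i nm) _; apply: expfz_neq0.
by apply: lead_at_neq0 (tA_infinite_lead n) _; apply: oner_neq0.
Qed.

Lemma lineB_neq0 C n : (0 < n <= m)%N -> lineB C n != 0.
Proof.
move=> nm; case: C => [i|].
  by apply: lead_at_neq0 (tB_finite_lead i nm) _; apply: expfz_neq0.
by apply: lead_at_neq0 (tB_infinite_lead n) _; apply: ztn_neq0.
Qed.

(** The leading term of [A / B] determines the point. On a finite line the order [12 l j - 3 l^2]
    gives [j], and the coefficient [zt^(i j)] then gives [i]. At infinity the order is [- 3 l^2],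
    and the coefficient [1 / (zt^k + zt^-k)] gives [k]. *)
Lemma ratio_inj C D j k : (0 < j <= m)%N -> (0 < k <= m)%N ->
  lineA C j * lineB D k = lineA D k * lineB C j -> C = D /\ j = k.
Proof.
move=> jm km; have l3 : (2 < l)%N by lia.
have sq x : (0 < x <= m)%N -> (3 * (l - 2 * x) ^ 2 + 12 * l * x = 3 * l ^ 2 + 12 * x ^ 2)%N.
  move=> xm; have /subnKC : (2 * x <= l)%N by lia.
  by set y := (l - _)%N => <-; ring.
case: C => [i|]; case: D => [i'|] e.
- have := lead_atM (tA_finite_lead i jm) (tB_finite_lead i' km).
  rewrite [X in lead_at X]e => L.
  have [] := lead_at_inj L (lead_atM (tA_finite_lead i' km) (tB_finite_lead i jm)).
  + by rewrite mulf_neq0 ?expfz_neq0.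
  + by rewrite mulf_neq0 ?expfz_neq0.
  have := sq j jm; have := sq k km => sk sj ex co.
  have jk : j = k.
    apply/eqP; rewrite -(eqn_pmul2l (_ : 0 < 12 * l)%N) ?muln_gt0 //; apply/eqP.
    by move: sj sk ex; move: ((l - 2 * j) ^ 2)%N ((l - 2 * k) ^ 2)%N => u v; lia.
  split=> //; move: co; rewrite -jk => co.
  have zsh (a : 'I_l) : ze ^ (a%:Z * (j%:Z ^+ 2 - j%:Z * l%:Z)) * (zt ^+ j) ^+ a =
      ze ^ (a * j ^ 2)%N%:Z.
    have -> : (zt ^+ j) ^+ a = ze ^ (l * j * a)%N%:Z by rewrite /zt -!exprM mulnA.
    by rewrite -expfzDr //; congr (_ ^ _); ring.
  have ee : (zt ^+ j) ^+ i == (zt ^+ j) ^+ i'.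
    have nz : ze ^ (i%:Z * (j%:Z ^+ 2 - j%:Z * l%:Z)) *
        ze ^ (i'%:Z * (j%:Z ^+ 2 - j%:Z * l%:Z)) != 0.
      by rewrite mulf_neq0 ?expfz_neq0.
    apply/eqP; apply: (mulfI nz); by rewrite mulrAC zsh co -(zsh i') mulrC mulrA.
  have cj : l.-primitive_root (zt ^+ j).
    by rewrite (prim_root_exp_coprime _ zt_prim) coprime_sym prime_coprime // gtnNdvd //; lia.
  move: ee; rewrite (eq_prim_root_expr cj) /= !modn_small // => /eqP /val_inj -> //.
- have := lead_atM (tA_finite_lead i jm) (tB_infinite_lead k).
  rewrite [X in lead_at X]e => L.
  have [] := lead_at_inj L (lead_atM (tA_infinite_lead k) (tB_finite_lead i jm)).
  + by rewrite mulf_neq0 ?expfz_neq0 ?ztn_neq0.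
  + by rewrite mulf_neq0 ?oner_neq0 ?expfz_neq0.
  have := sq j jm; have : (0 < 12 * l * j)%N by rewrite !muln_gt0 l0; case/andP: jm.
  by move: ((l - 2 * j) ^ 2)%N => u; lia.
- have := lead_atM (tA_infinite_lead j) (tB_finite_lead i' km).
  rewrite [X in lead_at X]e => L.
  have [] := lead_at_inj L (lead_atM (tA_finite_lead i' km) (tB_infinite_lead j)).
  + by rewrite mulf_neq0 ?oner_neq0 ?expfz_neq0.
  + by rewrite mulf_neq0 ?expfz_neq0 ?ztn_neq0.
  have := sq k km; have : (0 < 12 * l * k)%N by rewrite !muln_gt0 l0; case/andP: km.
  by move: ((l - 2 * k) ^ 2)%N => u; lia.
have := lead_atM (tA_infinite_lead j) (tB_infinite_lead k).
rewrite [X in lead_at X]e => L.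
have [] := lead_at_inj L (lead_atM (tA_infinite_lead k) (tB_infinite_lead j)).
- by rewrite mul1r ztn_neq0.
- by rewrite mul1r ztn_neq0.
rewrite !mul1r => _ co; split=> //.
have zV x : zt ^- x * zt ^+ x = 1 by rewrite mulVf ?expf_neq0.
(* With [x = zt^k] and [y = zt^j], in characteristic 2 the sum [(x + 1/x) + (y + 1/y)] is
   [(x + y) (x y + 1) / (x y)]; the factor [x y + 1] is nonzero since [0 < k + j < l]. *)
have : (zt ^+ k + zt ^+ j) * (zt ^+ (k + j) + 1) = 0.
  have -> : (zt ^+ k + zt ^+ j) * (zt ^+ (k + j) + 1) =
     (zt ^+ k + zt ^- k) * (zt ^+ k * zt ^+ j) + (zt ^+ j + zt ^- j) * (zt ^+ k * zt ^+ j).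
    rewrite [X in _ = X + _]mulrDl [X in _ = _ + X]mulrDl [zt ^- k * _]mulrA zV.
    by rewrite [zt ^- j * _]mulrCA zV exprD; ring.
  by rewrite co addrr_pchar2.
move/eqP; rewrite mulf_eq0 !addr_eq0 !oppr_pchar2 // => /orP[|].
  by rewrite (eq_prim_root_expr zt_prim) !modn_small //; [move/eqP|lia|lia].
by rewrite -(prim_order_dvd zt_prim) gtnNdvd //; lia.
Qed.

(** This is the sum of the [B / A] along a line, with denominators cleared. On a finite line the
    orders decrease strictly in [k], so the term [k = m] dominates. At infinity all orders are equal
    and the leading coefficients add up to 1. *)
Lemma ratio_sum_neq0 C : \sum_(1 <= k < m.+1) lineB C k * \prod_(1 <= j < m.+1 | j != k) lineA C j != 0.
Proof.
case: C => [i|]; last first.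
  suff [e _] : lead_at (\sum_(1 <= k < m.+1) lineB None k * \prod_(1 <= j < m.+1 | j != k)
      lineA None j) (3 * l ^ 2) 1.
    by apply: contra_eq_neq e => ->; rewrite eq_sym oner_neq0.
  have L k : lead_at (lineB None k * \prod_(1 <= j < m.+1 | j != k) lineA None j)
      (3 * l ^ 2) (zt ^+ k + zt ^- k).
    rewrite -[(3 * _)%N]addn0 -[zt ^+ k + _]mulr1; apply: lead_atM; first exact: tB_infinite_lead.
    have := lead_at_prod (index_iota 1 m.+1) (P := fun j => j != k)
      (f := fun j => lineA None j) (fun j _ => tA_infinite_lead j).
    by rewrite !big1_eq.
  split=> [|n nl]; rewrite coefs_sum.
    by rewrite -sum_zt; apply: eq_bigr => k _; have [] := L k.
  by apply: big1 => k _; have [_ ->] := L k.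
pose a k := (3 * (l - 2 * k) ^ 2 + \sum_(1 <= j < m.+1 | j != k) 12 * j ^ 2)%N.
have L k : (0 < k <= m)%N -> exists2 c, c != 0 &
    lead_at (lineB (Some i) k * \prod_(1 <= j < m.+1 | j != k) lineA (Some i) j) (a k) c.
  move=> km; eexists; last first.
    apply: lead_atM; first exact: tB_finite_lead.
    rewrite big_seq_cond [X in lead_at _ X]big_seq_cond; apply: lead_at_prod => j /andP[jm _].
    apply: tA_finite_lead; by rewrite mem_index_iota in jm.
  by rewrite mulf_neq0 ?expfz_neq0 // prodf_seq_neq0; apply/allP => j _; rewrite expfz_neq0 // implybT.
pose St := (\sum_(1 <= j < m.+1) 12 * j ^ 2)%N.
have aE k : (0 < k <= m)%N -> (a k + 12 * l * k = 3 * l ^ 2 + St)%N.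
  move=> km; have /subnKC : (2 * k <= l)%N by lia.
  have -> : St = (12 * k ^ 2 + \sum_(1 <= j < m.+1 | j != k) 12 * j ^ 2)%N.
    by rewrite /St (bigD1_seq k) ?iota_uniq ?mem_index_iota.
  by rewrite /a; set y := (l - _)%N => <-; ring.
have m0 : (0 < m)%N by have := prime_gt1 l_prime; lia.
have mm : (0 < m <= m)%N by rewrite m0 leqnn.
have [c c0 [cm _]] := L m mm.
apply: contra_neq c0 => e; rewrite -cm.
have /(congr1 (fun f => coefs f (a m))) := e.
rewrite big_nat_recr //= coefs_sum big_nat big1 ?add0r // => k /andP[k0 km].
have [|c' _ [_ ->]] // := L k; first by rewrite k0 ltnW.
have := aE k; have := aE m mm; rewrite k0 (ltnW km) => em /(_ isT) ek.
have : (12 * l * k < 12 * l * m)%N by rewrite ltn_pmul2l // muln_gt0.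
by lia.
Qed.

End Leading.

(** * The parity recurrence *)

Lemma coefs0M (F : fieldType) (f g : powser F) :
  coefs (f * g) 0 = coefs f 0 * coefs g 0.
Proof. by rewrite coefsM big_ord1. Qed.

Lemma coefs0X (F : fieldType) (f : powser F) n : coefs (f ^+ n) 0 = coefs f 0 ^+ n.
Proof. by elim: n => [|n IH]; rewrite ?expr0 ?coefs1 // !exprS coefs0M IH. Qed.

Lemma coefs_euler0 (F : fieldType) : coefs (euler F) 0 = 1.
Proof. by rewrite /= /qpoch big_ord0 coefs1. Qed.

Lemma coefs_dil0 (F : fieldType) (c : F) b f : coefs (dil c b f) 0 = coefs f 0.
Proof.
rewrite -[LHS]/(if (b %| 0)%N then c ^+ (0 %/ b) * coefs f (0 %/ b) else 0).
by rewrite dvdn0 div0n expr0 mul1r.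
Qed.

Lemma big_option (V : nmodType) (I : finType) (f : option I -> V) :
  \sum_C f C = f None + \sum_i f (Some i).
Proof.
rewrite (bigD1 None) //=; congr (_ + _).
by rewrite (reindex_omap Some id) => [|[]] //; apply: eq_bigl => i; rewrite eqxx.
Qed.

(** * Evaluation at [1/eta] in the fraction field of power series *)

Section Specialization.
Variable F : fieldType.
Local Notation S := (powser F).
Local Notation E := {fraction S}.
Local Notation "f %:F" := (@tofrac S f).
Variable h : S.
Hypothesis h_neq0 : h != 0.
Hypothesis h0 : coefs h 0 = 0.

(* Evaluation at [1 / h]. *)
Definition eval_inv : {rmorphism {poly F} -> E} :=
  (horner_eval (h%:F^-1) \o map_poly (@tofrac S \o @cst F)).

Lemma eval_invE (G : {poly F}) D : (size G <= D.+1)%N ->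
  eval_inv G = \sum_(k < D.+1) (cst G`_k)%:F * h%:F^-1 ^+ k.
Proof.
move=> sG; rewrite /eval_inv /= /horner_eval (@horner_coef_wide _ D.+1).
  by apply: eq_bigr => k _; rewrite coef_map.
by rewrite size_map_poly.
Qed.

Lemma eval_inv_X : eval_inv 'X * h%:F = 1.
Proof.
by rewrite /eval_inv /= /horner_eval map_polyX hornerX mulVf // tofrac_eq0.
Qed.

Lemma eval_inv_clear (G : {poly F}) D : (size G <= D.+1)%N ->
  h%:F ^+ D * eval_inv G = (\sum_(k < D.+1) cst G`_k * h ^+ (D - k))%:F.
Proof.
move=> sG; rewrite (eval_invE sG) mulr_sumr rmorph_sum; apply: eq_bigr => k _.
have kD : (k <= D)%N by rewrite -ltnS.
rewrite rmorphM rmorphXn /= mulrCA; congr (_ * _).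
rewrite -{1}(subnK kD) exprD -mulrA -exprMn divff ?expr1n ?mulr1 //.
by rewrite tofrac_eq0.
Qed.

(** After multiplication by [h] to the degree of [G], only the leading coefficient survives at
    [Z = 0], because [h] vanishes there. *)
Lemma eval_inv_inj : injective eval_inv.
Proof.
apply: raddf_inj => G G0; apply/eqP/negPn/negP => nz.
have sG : (0 < size G)%N by rewrite size_poly_gt0.
have := eval_inv_clear (leqSpred (size G)); rewrite G0 mulr0.
move/esym/eqP; rewrite tofrac_eq0 => /eqP /(congr1 (fun f => coefs f 0)).
rewrite big_ord_recr coefsD coefs_sum big1 ?add0r; last first.
  by move=> i _; rewrite coefs0M coefs0X h0 expr0n subn_eq0 [(_ <= widen_ord _ _)%N]leqNgt /= ltn_ord mulr0.
rewrite coefs0M coefs0X subnn expr0 mulr1 /= mulr1n -/(lead_coef G) => /eqP.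
by rewrite lead_coef_eq0 (negPf nz).
Qed.

(** Brings a negative power of an eta product back to power series: [v] is the multipartition series
    inverse to [u ^+ t], and [Z^M] clears the pole. *)
Lemma frac_term a N M (u v : S) t : a != 0 -> u != 0 ->
  u ^+ t * v = 1 -> (N * t <= M)%N ->
  (mono 1 M)%:F * (mono a N * u)%:F^-1 ^+ t =
  (mono (a^-1 ^+ t) (M - N * t) * v)%:F.
Proof.
move=> a0 u0 uv NM.
have nz : mono a N * u != 0 by rewrite mulf_neq0 ?mono_neq0.
have nz' : (mono a N * u)%:F ^+ t != 0 by rewrite expf_neq0 // tofrac_eq0.
apply: (mulIf nz'); rewrite exprVn mulfVK //.
rewrite -rmorphXn -rmorphM /= exprMn mulrACA [v * _]mulrC uv mulr1.
by rewrite monoX monoM [(t * N)%N]mulnC subnK // exprVn mulVf // expf_neq0.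
Qed.

End Specialization.

Section Key.
Variable F : fieldType.
Hypothesis F2 : 2%N \in [pchar F].
Variables (l m : nat) (ze : F).
Hypothesis lE : l = m.*2.+1.
Hypothesis l_prime : prime l.
Hypothesis ze_prim : (l ^ 2).-primitive_root ze.
Local Notation S := (powser F).
Local Notation E := {fraction S}.
Local Notation "f %:F" := (@tofrac S f).
Local Notation lineA := (@lineA F l ze).
Local Notation lineB := (@lineB F l ze).

Let l0 : (0 < l)%N. Proof. by rewrite lE. Qed.
Let m0 : (0 < m)%N. Proof. by have := prime_gt1 l_prime; lia. Qed.
Let ze1 : ze ^+ (l ^ 2) = 1. Proof. exact: prim_expr_order. Qed.

Let eu : S := dil 1 (24 * l ^ 2) (euler F).
Let etaS : S := mono 1 (l ^ 2) * eu.
Let eta : E := etaS%:F.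
Local Notation ev := (eval_inv etaS).

Lemma dil_euler_neq0 c b : dil c b (euler F) != 0.
Proof.
apply: contraNneq (oner_neq0 F) => /(congr1 (fun f => coefs f 0)).
by rewrite coefs_dil0 coefs_euler0 => ->.
Qed.

Let etaS_neq0 : etaS != 0.
Proof. by rewrite mulf_neq0 ?mono_neq0 ?oner_neq0 ?dil_euler_neq0. Qed.

Let etaS0 : coefs etaS 0 = 0.
Proof. by rewrite /etaS coefs_monoM expn_gt0 l0. Qed.

Let fA C n : E := (lineA C n)%:F.
Let fB C n : E := (lineB C n)%:F.

Let tofrac_char2 : 2%N \in [pchar E].
Proof.
apply/andP; split=> //; apply/eqP.
by rewrite -(rmorph_nat (@tofrac S)) (pcharf0 (powser_char2 F2)) rmorph0.
Qed.

Let talphaE : talpha F l = etaS ^+ 3.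
Proof. exact: (talpha_cube F2 lE m0 ze_prim). Qed.

Let theta_f C : theta_seq (eta ^+ 3) (fA C) (fB C).
Proof.
split.
- by rewrite /fA /lineA (tA0 l F2) rmorph1.
- by rewrite /fB /lineB (tB0 l F2) rmorph0.
- move=> a d; have := addA F2 lE ze1 (line_slope C).1 (line_slope C).2 (d + a)%:Z a%:Z.
  have -> : (d + a)%:Z + a%:Z = (d + a.*2)%:Z by lia.
  have -> : (d + a)%:Z - a%:Z = d%:Z by lia.
  by move/(congr1 (@tofrac S)); rewrite !(rmorphM, rmorphD, rmorphXn).
- move=> a d; have := addB F2 lE ze1 (line_slope C).1 (line_slope C).2 (d + a)%:Z a%:Z.
  have -> : (d + a)%:Z + a%:Z = (d + a.*2)%:Z by lia.
  have -> : (d + a)%:Z - a%:Z = d%:Z by lia.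
  by move/(congr1 (@tofrac S)); rewrite !(rmorphM, rmorphD, rmorphXn).
- move=> a; have := dblB F2 lE ze1 (line_slope C).1 (line_slope C).2 a%:Z.
  have -> : a%:Z + a%:Z = a.*2%:Z by lia.
  rewrite talphaE.
  by rewrite /eta /fA /fB -(rmorphXn (@tofrac S)) -!(rmorphM (@tofrac S)) -(rmorphXn (@tofrac S)) => ->.
Qed.

Let A_per C n : fA C (n + l) = fA C n.
Proof. by rewrite /fA /lineA PoszD (tA_per lE ze1). Qed.

Let B_per C n : fB C (n + l) = fB C n.
Proof. by rewrite /fB /lineB PoszD (tB_per lE ze1). Qed.

Let A_refl C n : (n <= l)%N -> fA C (l - n) = fA C n.
Proof.
move=> nl; rewrite /fA /lineA -subzn // addrC.
by rewrite (tA_per lE ze1) tAN.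
Qed.

Let B_refl C n : (n <= l)%N -> fB C (l - n) = fB C n.
Proof.
move=> nl; rewrite /fB /lineB -subzn // addrC.
by rewrite (tB_per lE ze1) tBN.
Qed.

Let A_nz C n : (0 < n <= m)%N -> fA C n != 0.
Proof. by move=> nm; rewrite tofrac_eq0; exact: (lineA_neq0 F2 lE l_prime ze_prim). Qed.

Let B_nz C n : (0 < n <= m)%N -> fB C n != 0.
Proof. by move=> nm; rewrite tofrac_eq0; exact: (lineB_neq0 F2 lE l_prime ze_prim). Qed.

Let W_inj C D j k : (0 < j <= m)%N -> (0 < k <= m)%N ->
  fA C j / fB C j = fA D k / fB D k -> C = D /\ j = k.
Proof.
move=> jm km /eqP; rewrite (eqr_div _ _ (B_nz C jm) (B_nz D km)).
by rewrite -!rmorphM tofrac_eq => /eqP; exact: (ratio_inj F2 lE l_prime ze_prim).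
Qed.

Let r_nz C : \sum_(1 <= k < m.+1) fB C k / fA C k != 0.
Proof.
apply: contraNneq (ratio_sum_neq0 F2 lE l_prime ze_prim C) => r0.
rewrite -tofrac_eq0 rmorph_sum /=; apply/eqP.
transitivity ((\sum_(1 <= k < m.+1) fB C k / fA C k) *
  \prod_(1 <= j < m.+1) fA C j); last by rewrite r0 mul0r.
rewrite mulr_suml; apply: eq_big_nat => k km.
rewrite [in RHS](bigD1_seq k) ?mem_index_iota ?iota_uniq //= mulrA divfK.
  by rewrite rmorphM rmorph_prod.
exact: A_nz.
Qed.

Let cardI : #|{: option 'I_l}| = l.+1.
Proof. by rewrite card_option card_ord. Qed.

Let quotE (P w : S) N x : P = mono x (l ^ 2 * m.-1 + N) * eu ^+ m.-1 * w ->
  eta ^+ m.-1 / P%:F = (mono x N * w)%:F^-1.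
Proof.
move=> ->.
have -> : mono x (l ^ 2 * m.-1 + N) * eu ^+ m.-1 * w = etaS ^+ m.-1 * (mono x N * w).
  rewrite exprMn monoX expr1n mulrACA monoM mul1r mulnC; ring.
rewrite rmorphM rmorphXn invfM mulrA divff ?mul1r //.
by rewrite expf_neq0 // tofrac_eq0.
Qed.

(** The [l - 2 k] are the odd numbers below [2 m], so the sum is [4 m^3 - m]. It is split into the
    order of [eta^(m-1)] and the order [l] of [eta(zeta Z^(1/l))]. *)
Lemma exponent_finite :
  (\sum_(1 <= k < m.+1) 3 * (l - 2 * k) ^ 2 = l ^ 2 * m.-1 + l)%N.
Proof.
have -> : (\sum_(1 <= k < m.+1) 3 * (l - 2 * k) ^ 2 =
  \sum_(0 <= k < m) 3 * (2 * k + 1) ^ 2)%N.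
  rewrite big_nat_rev big_add1 /=; apply: eq_big_nat => k km.
  by congr (3 * _ ^ 2)%N; lia.
have H n : (\sum_(0 <= k < n) 3 * (2 * k + 1) ^ 2 + n = 4 * n ^ 3)%N.
  elim: n => [|n IH]; first by rewrite big_nil.
  by rewrite big_nat_recr //=; move: IH; set s := \sum_(_ <= _ < _) _; nia.
have := H m; set s := \sum_(_ <= _ < _) _.
case: m lE m0 => // n lE' _ /=; rewrite lE'; nia.
Qed.

Lemma trace_identity t : (6 %| t * (m * m.+1))%N ->
  exists (G : {poly F}) (a : F) (b : 'I_l -> F) (c : 'I_l -> F),
  [/\ a != 0, (forall i, b i != 0) &
      (mono a (l ^ 3) * dil 1 (24 * l ^ 3) (euler F))%:F^-1 ^+ t +
      \sum_i (mono (b i) l * dil (c i) (24 * l) (euler F))%:F^-1 ^+ t =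
      ev G].
Proof.
move=> ht.
have [G GE] := trace_poly (@eval_inv_inj _ _ etaS_neq0 etaS0) tofrac_char2
  (eval_inv_X etaS_neq0) lE m0 l_prime cardI theta_f A_per B_per
  A_refl B_refl A_nz B_nz W_inj r_nz ht.
have [a a0 aE] := beta_infinite F2 lE m0 ze_prim.
have := fun i : 'I_l => beta_finite F2 lE m0 ze_prim i.
move/(@fin_all_exists2 _ _ _ _) => [b b0 bE].
exists G, a, b, (fun i => ze ^+ (2 * i * l)); split=> //.
have prodE C : \prod_(1 <= k < m.+1) fB C k = (\prod_(1 <= k < m.+1) lineB C k)%:F.
  by rewrite rmorph_prod.
rewrite -GE big_option /= !prodE; congr (_ ^+ _ + _).
  apply/esym/quotE; rewrite [LHS]aE -/eu; congr (mono _ _ * _ * _).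
  by move: m0; rewrite lE; nia.
apply: eq_bigr => i _; congr (_ ^+ _).
by rewrite prodE; apply/esym/quotE; rewrite [LHS]bE -/eu exponent_finite.
Qed.
End Key.

Lemma coefs_monoMD (F : fieldType) (c : F) k (f : powser F) n :
  coefs (mono c k * f) (k + n) = c * coefs f n.
Proof. by rewrite coefs_monoM ltnNge leq_addr addKn. Qed.

Section Recurrence.
Variable F : fieldType.
Hypothesis F2 : 2%N \in [pchar F].
Variables (l m : nat) (ze : F).
Hypothesis lE : l = m.*2.+1.
Hypothesis l_prime : prime l.
Hypothesis ze_prim : (l ^ 2).-primitive_root ze.
Variable P : nat -> powser F.
Hypothesis P_euler : forall k, P k * euler F ^+ k = 1.
Local Notation S := (powser F).
Local Notation "f %:F" := (@tofrac S f).

Let l0 : (0 < l)%N. Proof. by rewrite lE. Qed.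

Let dil_P c b k : (0 < b)%N -> dil c b (euler F) ^+ k * dil c b (P k) = 1.
Proof. by move=> b0; rewrite -dilX // -dilM // mulrC P_euler dil1. Qed.

Lemma coefs_P0 k : coefs (P k) 0 = 1.
Proof.
have := congr1 (fun f => coefs f 0) (P_euler k).
by rewrite coefs0M coefs0X coefs_euler0 expr1n mulr1 coefs1.
Qed.

(** The trace identity times [Z^(l^2 D)]; taking [D] at least [l t] and the degree of [G] clears
    every pole. *)
Lemma powser_identity t : (6 %| t * (m * m.+1))%N ->
  exists (G : {poly F}) (a : F) (b c : 'I_l -> F) (D : nat),
  [/\ a != 0, (size G <= D.+1)%N, (l * t <= D)%N &
      mono a (l ^ 2 * (D - l * t)) * dil 1 (24 * l ^ 3) (P t) +
      \sum_i mono (b i) (l ^ 2 * D - l * t) * dil (c i) (24 * l) (P t) =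
      \sum_(k < D.+1) mono G`_k (l ^ 2 * (D - k)) * dil 1 (24 * l ^ 2) (P k)].
Proof.
move=> ht.
have [G [a [b [c [a0 b0 GE]]]]] := trace_identity F2 lE l_prime ze_prim ht.
pose D := maxn (size G) (l * t); exists G, (a^-1 ^+ t), (fun i => (b i)^-1 ^+ t), c, D.
have sG : (size G <= D.+1)%N by rewrite leqW // leq_maxl.
have ltD : (l * t <= D)%N by rewrite leq_maxr.
have l3 : (l ^ 3 * t = l ^ 2 * (l * t))%N by rewrite expnSr mulnA.
split=> //; first by rewrite expf_neq0 // invr_neq0.
apply/eqP; rewrite -tofrac_eq; apply/eqP; move/(congr1 (fun f => (mono 1 (l ^ 2 * D))%:F * f)): GE.
rewrite (eval_invE _ sG) mulrDr !mulr_sumr rmorphD !rmorph_sum /=.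
rewrite (@frac_term _ _ _ _ _ (dil 1 (24 * l ^ 3) (P t))) ?dil_euler_neq0 //; first last.
- by rewrite l3 leq_mul2l ltD orbT.
- by rewrite dil_P // muln_gt0 expn_gt0 l0.
rewrite l3 -mulnBr.
move=> GE.
have -> : \sum_i (mono ((b i)^-1 ^+ t) (l ^ 2 * D - l * t) * dil (c i) (24 * l) (P t))%:F =
  \sum_i (mono 1 (l ^ 2 * D))%:F *
    (mono (b i) l * dil (c i) (24 * l) (euler F))%:F^-1 ^+ t.
  apply: eq_bigr => i _.
  rewrite (@frac_term _ _ _ _ _ (dil (c i) (24 * l) (P t))) ?dil_euler_neq0 //.
    by rewrite dil_P // muln_gt0 l0.
  by nia.
rewrite GE; apply: eq_bigr => k _.
rewrite mulrCA (@frac_term _ _ _ _ _ (dil 1 (24 * l ^ 2) (P k))) ?oner_neq0 ?dil_euler_neq0 //.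
- by rewrite -rmorphM /= /cst mulrA monoM invr1 expr1n mulr1 add0n mulnBr.
- by rewrite dil_P // muln_gt0 expn_gt0 l0.
- by rewrite leq_mul2l -ltnS ltn_ord orbT.
Qed.

(** The line at infinity has the deepest pole, so it fixes the degree [l t] of [G]; this is how
    [P (l * t)] enters. Comparing one further coefficient leaves three possible partners for a
    nonzero coefficient of [P (l * t)]: the line at infinity, the finite lines, and the lower terms
    of [G]. *)
Lemma recurrence t n : (0 < t)%N -> (6 %| t * (m * m.+1))%N ->
  coefs (P (l * t)) n != 0 ->
  [\/ (l %| n)%N && (coefs (P t) (n %/ l) != 0),
      exists2 n', (24 * n' + t * (l ^ 2).-1 = 24 * (l * n))%N & coefs (P t) n' != 0 |
      exists2 j, [&& 0 < j, 24 * j <= l * t & j <= n]%N &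
        coefs (P (l * t - 24 * j)) (n - j) != 0].
Proof.
move=> t0 ht Pn0; have [G [a [b [c [D [a0 sG ltD E]]]]]] := powser_identity ht.
pose Q (k : 'I_D.+1) N :=
  coefs (mono G`_k (l ^ 2 * (D - k)) * dil 1 (24 * l ^ 2) (P k)) N.
have rhsE N : coefs (\sum_(k < D.+1) mono G`_k (l ^ 2 * (D - k)) *
    dil 1 (24 * l ^ 2) (P k)) N = \sum_k Q k N by rewrite coefs_sum.
have l2 : (0 < l ^ 2)%N by rewrite expn_gt0 l0.
have b1 : (0 < 24 * l)%N by rewrite muln_gt0 l0.
have b2 : (0 < 24 * l ^ 2)%N by rewrite muln_gt0 l2.
have b3 : (0 < 24 * l ^ 2 * l)%N by rewrite muln_gt0 b2 l0.
have Q0 (k : 'I_D.+1) N : (N < l ^ 2 * (D - k))%N -> Q k N = 0.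
  by rewrite /Q coefs_monoM => ->.
have Qlow (k : 'I_D.+1) : Q k (l ^ 2 * (D - k))%N = G`_k.
  by rewrite /Q coefs_monoM ltnn subnn coefs_dil0 coefs_P0 mulr1.
have lhs2 N : (N < l ^ 2 * D - l * t)%N -> coefs
    (\sum_i mono (b i) (l ^ 2 * D - l * t) * dil (c i) (24 * l) (P t)) N = 0.
  by move=> h; rewrite coefs_sum big1 // => i _; rewrite coefs_monoM h.
(* Descending induction on [k]: in degree [l^2 (D - k)] the left side has not started, and on the
   right only the constant term of [P k] is left. *)
have degG k : (l * t < k)%N -> G`_k = 0.
  have [N kN] := ubnP (D - k); elim: N k kN => // N IH k kN ltk.
  have [Dk|kD] := ltnP D k; first by rewrite nth_default // (leq_trans sG).
  have := congr1 (fun f => coefs f (l ^ 2 * (D - k))) E.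
  rewrite coefsD rhsE coefs_monoM lhs2; last by nia.
  have -> : (l ^ 2 * (D - k) < l ^ 2 * (D - l * t))%N by rewrite ltn_pmul2l //; lia.
  rewrite (bigD1 (inord k : 'I_D.+1)) // big1 => [|i /andP[_ ik]].
    by have := Qlow (inord k); rewrite inordK // => ->; rewrite /= !addr0 => <-.
  have {}ik : (i : nat) != k by apply: contraNneq ik => <-; rewrite inord_val.
  have [ilt|igt] := ltnP i k; first by apply: Q0; rewrite ltn_pmul2l //; lia.
  rewrite /Q IH ?coefs_monoM ?mul0r ?if_same //; have := ltn_ord i; lia.
(* In the lowest degree of the line at infinity the finite lines have not started yet, so this
   coefficient equals [a]. *)
have GA : G`_(l * t) != 0.
  have := congr1 (fun f => coefs f (l ^ 2 * (D - l * t))) E.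
  rewrite coefsD rhsE coefs_monoM ltnn subnn coefs_dil0 coefs_P0 mulr1 lhs2; last first.
    have : (l * t < l ^ 2 * (l * t))%N by rewrite ltn_Pmull ?muln_gt0 ?l0 // -(exp1n 2) ltn_exp2r ?prime_gt1.
    have : (l ^ 2 * (l * t) <= l ^ 2 * D)%N by rewrite leq_mul2l ltD orbT.
    by rewrite mulnBr; lia.
  rewrite addr0 (bigD1 (inord (l * t) : 'I_D.+1)) // big1 => [|i /andP[_ ik]].
    by have := Qlow (inord (l * t)); rewrite inordK // => ->; rewrite /= addr0 => <-.
  have {}ik : (i : nat) != (l * t)%N by apply: contraNneq ik => <-; rewrite inord_val.
  have [ilt|igt] := ltnP i (l * t); first by apply: Q0; rewrite ltn_pmul2l //; lia.
  by rewrite /Q degG ?coefs_monoM ?mul0r ?if_same //; lia.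
apply: contrapT => none.
have no1 : ~~ ((l %| n)%N && (coefs (P t) (n %/ l) != 0)).
  by apply/negP => h; apply: none; apply: Or31.
have no2 n' : (24 * n' + t * (l ^ 2).-1 = 24 * (l * n))%N -> coefs (P t) n' = 0.
  by move=> h; apply/eqP/negPn/negP => h'; apply: none; apply: Or32; exists n'.
have no3 j : [&& 0 < j, 24 * j <= l * t & j <= n]%N ->
    coefs (P (l * t - 24 * j)) (n - j) = 0.
  by move=> h; apply/eqP/negPn/negP => h'; apply: none; apply: Or33; exists j.
(* The degree in which the term [k = l t] of the right side shows the coefficient [n] of
   [P (l * t)]. *)
pose N := (l ^ 2 * (D - l * t) + 24 * l ^ 2 * n)%N.
have := congr1 (fun f => coefs f N) E.
rewrite coefsD rhsE [in LHS]/N coefs_monoMD.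
have -> : coefs (dil 1 (24 * l ^ 3) (P t)) (24 * l ^ 2 * n) = 0.
  have [|h] := boolP (24 * l ^ 3 %| 24 * l ^ 2 * n)%N; last by rewrite coefs_dilN.
  have -> : (24 * l ^ 3 = 24 * l ^ 2 * l)%N by rewrite -mulnA -expnSr.
  rewrite dvdn_pmul2l // => ln.
  move: no1; rewrite ln andTb negbK => /eqP h.
  have -> : (24 * l ^ 2 * n = n %/ l * (24 * l ^ 2 * l))%N.
    by rewrite -{1}(divnK ln); ring.
  by rewrite coefs_dil // h mulr0.
rewrite mulr0 add0r coefs_sum big1 => [|i _]; last first.
  rewrite coefs_monoM; case: ltnP => // hN.
  have [/dvdnP[q hq]|h] := boolP (24 * l %| N - (l ^ 2 * D - l * t))%N; last first.
    by rewrite coefs_dilN ?mulr0.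
  rewrite hq coefs_dil // no2 ?mulr0 //.
  apply/eqP; rewrite -(eqn_pmul2r l0); apply/eqP.
  have e1 : (l ^ 2 * (D - l * t) + l ^ 2 * (l * t) = l ^ 2 * D)%N.
    by rewrite -mulnDr subnK.
  have e2 : (t * (l ^ 2).-1 * l + l * t = l ^ 2 * (l * t))%N.
    by rewrite mulnAC -[(t * l * _)%N]mulnC -{1}(mul1n (l * t)%N) [(l * t)%N]mulnC -mulnDl addn1 prednK.
  move: hq hN e1 e2; rewrite /N mulnDl.
  have -> : (24 * q * l = q * (24 * l))%N by ring.
  have -> : (24 * (l * n) * l = 24 * l ^ 2 * n)%N by ring.
  move: (l ^ 2 * D)%N (l ^ 2 * (D - l * t))%N (l ^ 2 * (l * t))%N => x y z.
  move: (q * _)%N (24 * _ * n)%N (t * _ * l)%N (l * t)%N; lia.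
rewrite (bigD1 (inord (l * t) : 'I_D.+1)) // big1 => [|i /andP[_ ik]].
  rewrite /Q inordK // /N coefs_monoMD Monoid.mulm1 [(24 * l ^ 2 * n)%N]mulnC.
  rewrite coefs_dil // expr1n mul1r => /esym/eqP.
  by rewrite mulf_eq0 (negPf GA) (negPf Pn0).
have {}ik : (i : nat) != (l * t)%N by apply: contraNneq ik => <-; rewrite inord_val.
have [ilt|igt] := ltnP i (l * t); last first.
  by rewrite /Q degG ?coefs_monoM ?mul0r ?if_same //; lia.
rewrite /Q coefs_monoM; case: ltnP => // hN.
have [/dvdnP[q hq]|h] := boolP (24 * l ^ 2 %| N - l ^ 2 * (D - i))%N; last first.
  by rewrite coefs_dilN ?mulr0.
rewrite hq coefs_dil //.
have jE : (24 * n + i = 24 * q + l * t)%N.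
  apply/eqP; rewrite -(eqn_pmul2l l2); apply/eqP.
  have e1 : (l ^ 2 * (D - l * t) + l ^ 2 * (l * t) = l ^ 2 * D)%N.
    by rewrite -mulnDr subnK.
  have e2 : (l ^ 2 * (D - i) + l ^ 2 * i = l ^ 2 * D)%N.
    by rewrite -mulnDr subnK // -ltnS.
  have -> : (l ^ 2 * (24 * n + i) = 24 * l ^ 2 * n + l ^ 2 * i)%N by ring.
  have -> : (l ^ 2 * (24 * q + l * t) = q * (24 * l ^ 2) + l ^ 2 * (l * t))%N by ring.
  move: hq hN e1 e2; rewrite /N.
  move: (l ^ 2 * D)%N (l ^ 2 * (D - l * t))%N (l ^ 2 * (l * t))%N => x y z.
  move: (q * _)%N (24 * _ * n)%N (l ^ 2 * i)%N (l ^ 2 * (D - i))%N; lia.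
have iE : (i = l * t - 24 * (n - q) :> nat)%N by lia.
have qE : (q = n - (n - q))%N by lia.
rewrite qE iE no3 ?mulr0 //; lia.
Qed.
End Recurrence.

(** By Euler's theorem [n] divides [2 ^ totient n - 1], the order of the cyclic multiplicative group
    of the field with [2 ^ totient n] elements. *)
Lemma exists_primitive_root_char2 n : odd n ->
  exists (F : fieldType) (z : F), 2%N \in [pchar F] /\ n.-primitive_root z.
Proof.
move=> n_odd; have n0 : (0 < n)%N by case: n n_odd.
have [F F2 cardF] := @pPrimePowerField 2 (totient n) isT (etrans (totient_gt0 n) n0).
have M0 : (0 < #|F|.-1)%N by rewrite -subn1 subn_gt0 finNzRing_gt1.
have M1 : (0 < #|F|)%N by apply: leq_trans M0 (leq_pred _).
have rootsF : all (#|F|.-1).-unity_root (enum (predC1 (0 : F))).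
  apply/allP => x; rewrite mem_enum inE unity_rootE => x0.
  by apply/eqP/(mulfI x0); rewrite -exprS prednK // expf_card mulr1.
have [|z _ z_prim] := hasP (has_prim_root M0 rootsF (enum_uniq _) _).
  by rewrite -cardE cardC1.
exists F, (z ^+ (#|F|.-1 %/ n)); split=> //.
suff n_dvd : (n %| #|F|.-1)%N by exact: (dvdn_prim_root z_prim n_dvd).
rewrite cardF -subn1 -eqn_mod_dvd ?expn_gt0 //.
by apply/eqP/Euler_exp_totient; rewrite coprime2n.
Qed.

(** * Reduction of the multipartition series modulo 2 *)

Section Reduction.
Variable F : fieldType.
Hypothesis F2 : 2%N \in [pchar F].
Local Notation S := (powser F).

Definition of_fps (f : fps) : S := PowSer (fun n => (f n)%:~R).

Lemma of_fps_mul f g : of_fps (fps_mul f g) = of_fps f * of_fps g.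
Proof.
apply: powserP => n; rewrite coefsM /= rmorph_sum.
by apply: eq_bigr => i _; rewrite rmorphM.
Qed.

Lemma of_fps_one : of_fps fps_one = 1.
Proof. by apply: powserP => n; rewrite coefs1 /= rmorph_nat. Qed.

Lemma of_fps_exp f t : of_fps (fps_exp f t) = of_fps f ^+ t.
Proof.
elim: t => [|t IH]; first by rewrite expr0 -of_fps_one.
by rewrite exprS -IH -of_fps_mul.
Qed.

Lemma of_fps_one_sub_q i : (0 < i)%N -> of_fps (one_sub_q i) = 1 - mono 1 i.
Proof.
by move=> i0; apply: powserP => n; rewrite coefsB coefs1 /= rmorphB !rmorph_nat.
Qed.

Lemma of_fps_inv_one_sub_q i t : (0 < i)%N ->
  of_fps (fps_inv (fps_exp (one_sub_q i) t)) * (1 - mono 1 i) ^+ t = 1.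
Proof.
move=> i0; rewrite -of_fps_one_sub_q // -of_fps_exp mulrC -of_fps_mul -of_fps_one.
apply: powserP => n /=; congr (_%:~R); apply: fps_mulV.
exact: fps_exp_one_sub_q0.
Qed.

Lemma of_fps_partial_prod f n :
  of_fps (fps_partial_prod f n) = \prod_(1 <= i < n.+1) of_fps (f i).
Proof.
by rewrite /fps_partial_prod (big_morph of_fps of_fps_mul of_fps_one).
Qed.

Definition multipartition_mod t : S := of_fps (multipartition t).

(** The [n]-th partial product inverts the first [n] factors of the Euler product exactly, hence
    [euler F ^+ t] modulo [Z^(n+1)]. Cancelling this unit shows that the partial products [k] and
    [N >= k] have the same coefficient of [Z^k]. *)
Lemma multipartition_mod_euler t : multipartition_mod t * euler F ^+ t = 1.
Proof.
pose Q n := of_fps (fps_partial_prod (fun i => fps_inv (fps_exp (one_sub_q i) t)) n).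
have QE n : eqmod n.+1 (Q n * euler F ^+ t) 1.
  have QI : Q n * qpoch (mono 1 1) n ^+ t = 1.
    rewrite /Q of_fps_partial_prod /qpoch -(big_mkord predT (fun s => 1 - mono 1 1 ^+ s.+1)).
    rewrite big_add1 /= -prodrXl -big_split /= big1_seq // => i /andP[_].
    by move=> _; rewrite monoX expr1n muln1 of_fps_inv_one_sub_q.
  rewrite -[X in eqmod _ _ X]QI.
  by apply: eqmodM; [exact: eqmod_refl | exact/eqmodX/euler_eqmod].
have E0 : coefs (euler F ^+ t) 0 != 0.
  by rewrite coefs0X coefs_euler0 expr1n oner_neq0.
apply: eqmod_eq => N; apply: eqmod_trans (_ : eqmod N (Q N * euler F ^+ t) 1).
  apply: eqmodM; last exact: eqmod_refl.
  move=> k kN; rewrite -[LHS]/(coefs (Q k) k).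
  apply: (eqmod_cancel E0 (K := k.+1)) => //; rewrite ![_ ^+ t * _]mulrC.
  apply: eqmod_trans (QE k) _; apply: eqmod_sym => j jk.
  by rewrite QE // (leq_trans jk) // ltnW.
by move=> k kN; rewrite QE // ltnW.
Qed.

Lemma coefs_multipartition_mod t n :
  (coefs (multipartition_mod t) n != 0) = ~~ (2 %| multipartition t n)%Z.
Proof.
rewrite -[coefs _ _]/((multipartition t n)%:~R : F); congr (~~ _).
rewrite dvdzE (dvdn_pcharf F2) {1}[multipartition t n]intEsign rmorphM /=.
by rewrite rmorph_sign mulf_eq0 signr_eq0.
Qed.
End Reduction.

(** * Density *)

Definition p_odd t n := ~~ (2 %| multipartition t n)%Z.

(** The product [m (m + 1)] is even, and for a prime [l >= 5] it is divisible by 3 because 3 does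
    not divide [l = 2 m + 1]; for [l = 3] the factor 3 must come from [t]. *)
Lemma p_odd_recurrence l t n : prime l -> odd l -> (0 < t)%N ->
  (5 <= l)%N || (3 %| t)%N -> p_odd (l * t) n ->
  [\/ (l %| n)%N && p_odd t (n %/ l),
      exists2 n', (24 * n' + t * (l ^ 2).-1 = 24 * (l * n))%N & p_odd t n' |
      exists2 j, [&& 0 < j, 24 * j <= l * t & j <= n]%N &
        p_odd (l * t - 24 * j) (n - j)].
Proof.
move=> l_prime l_odd t0 hl.
have lE : l = l./2.*2.+1 by rewrite -[LHS]odd_double_half l_odd.
have [F [z [F2 z_prim]]] : exists (F : fieldType) (z : F),
    2%N \in [pchar F] /\ (l ^ 2).-primitive_root z.
  by apply: exists_primitive_root_char2; rewrite oddX l_odd orbT.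
have six : (6 %| t * (l./2 * l./2.+1))%N.
  rewrite (@Gauss_dvd 2 3) // !dvdn2 /= !oddM /= andbN andbF /=.
  case/orP: hl => [l5|h3]; last by rewrite dvdn_mulr.
  apply: dvdn_mull; rewrite Euclid_dvdM //.
  have : ~~ (3 %| l)%N by rewrite dvdn_prime2 //; lia.
  by rewrite [in X in X -> _]lE; move: (l./2) => m; lia.
have := @recurrence F F2 l l./2 z lE l_prime z_prim _ (multipartition_mod_euler F) t n t0 six.
rewrite !coefs_multipartition_mod // => H /H [h|[n' e]|[j e]].
- by apply: Or31.
- by rewrite coefs_multipartition_mod // => h; apply: Or32; exists n'.
- by rewrite coefs_multipartition_mod // => h; apply: Or33; exists j.
Qed.

(** Natural density zero with [1 / k] for epsilon, stated without real numbers so that the induction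
    stays in arithmetic. *)
Definition density_zero (Q : pred nat) :=
  forall k, exists N0, forall N, (N0 <= N)%N -> (k * count Q (seq.iota 0 N) <= N)%N.

(** The elements of [R] below [N] inject into those of [Q] below [c N]; the loss of a factor [c] is
    made up by using [c k] for [k]. *)
Lemma density_zero_inj (Q R : pred nat) (f : nat -> nat) c : (0 < c)%N ->
  (forall n, R n -> Q (f n)) -> {in R &, injective f} ->
  (forall n, R n -> (f n <= c * n)%N) -> density_zero Q -> density_zero R.
Proof.
move=> c0 RQ f_inj fc dQ k; have [N0 hN0] := dQ (c * k)%N.
exists N0 => N NN0.
have cnt : (count R (seq.iota 0 N) <= count Q (seq.iota 0 (c * N)))%N.
  rewrite -!size_filter -(size_map f); apply: uniq_leq_size.
    rewrite map_inj_in_uniq ?filter_uniq ?iota_uniq // => x y.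
    by rewrite !mem_filter => /andP[? _] /andP[? _]; exact: f_inj.
  move=> y /mapP[n]; rewrite mem_filter mem_iota => /andP[Rn /= nN] ->.
  rewrite mem_filter RQ // mem_iota /=; apply: leq_ltn_trans (fc n Rn) _.
  by rewrite ltn_pmul2l.
rewrite -(leq_pmul2l c0) mulnA (leq_trans _ (hN0 (c * N)%N _)) //.
  by rewrite leq_mul2l cnt orbT.
by rewrite (leq_trans NN0) // leq_pmull.
Qed.

Lemma density_zero_sub (Q R : pred nat) : (forall n, R n -> Q n) ->
  density_zero Q -> density_zero R.
Proof. by move=> RQ; apply: (density_zero_inj (f := id) (c := 1)) => // n _; rewrite mul1n. Qed.

Lemma density_zero0 : density_zero pred0.
Proof. by move=> k; exists 0%N => N _; rewrite count_pred0 muln0. Qed.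

Lemma density_zeroU (Q R : pred nat) : density_zero Q -> density_zero R ->
  density_zero (predU Q R).
Proof.
move=> dQ dR k; have [M hM] := dQ (k * 2)%N; have [N hN] := dR (k * 2)%N.
exists (maxn M N) => K; rewrite geq_max => /andP[/hM h1 /hN h2].
have : (k * count (predU Q R) (seq.iota 0 K) <=
    k * count Q (seq.iota 0 K) + k * count R (seq.iota 0 K))%N.
  by rewrite -mulnDr leq_mul2l -count_predUI leq_addr orbT.
by move: h1 h2; rewrite -!mulnA ![(2 * _)%N]mulnC !mulnA; lia.
Qed.

Lemma density_zero_has (Q : nat -> pred nat) s :
  (forall j, j \in s -> density_zero (Q j)) ->
  density_zero (fun n => has (Q^~ n) s).
Proof.
elim: s => [|j s IH] h /=; first exact: density_zero0.
apply: (density_zeroU (h j (mem_head _ _)) (IH _)) => i si.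
by apply: h; rewrite inE si orbT.
Qed.

(** Strong induction on [A] through the recurrence. Both [t] and the [A - 24 j] are again odd with
    the same gcd with 3, so the induction hypothesis covers every partner function. *)
Lemma density_zero_p_odd d A : d \in [:: 1; 3]%N -> density_zero (p_odd d) ->
  odd A -> gcdn A 3 = d -> density_zero (p_odd A).
Proof.
move=> d13 dd; elim/ltn_ind: A => A IH A_odd A_gcd.
have dA : (d %| A)%N by rewrite -A_gcd dvdn_gcdl.
have [B AE] := dvdnP dA.
have [B1|B_neq1] := eqVneq B 1%N; first by rewrite AE B1 mul1n.
have B_odd : odd B by move: A_odd; rewrite AE oddM => /andP[].
have B0 : (0 < B)%N by case: (B) B_odd.
have d0 : (0 < d)%N by move: d13; rewrite !inE => /orP[] /eqP ->.
(* The prime is taken from [A / d] so that [d] stays in [t]: for [d = 3] this gives [3 | t] even if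
   [l = 3], and for [d = 1] the odd prime [l] is not 3, hence at least 5. *)
set l := pdiv B.
have l_prime : prime l by apply: pdiv_prime; lia.
have l_dvd : (l %| B)%N := pdiv_dvd B.
have l_odd : odd l by exact: dvdn_odd l_dvd B_odd.
pose t := (d * (B %/ l))%N.
have ltE : A = (l * t)%N by rewrite AE /t mulnCA [(l * _)%N]mulnC divnK // mulnC.
have t_odd : odd t by move: A_odd; rewrite ltE oddM => /andP[].
have t0 : (0 < t)%N by case: (t) t_odd.
have l1 := prime_gt1 l_prime.
have gcd_t : gcdn t 3 = d.
  move: d13; rewrite !inE => /orP[] /eqP dE; last by rewrite /t dE gcdnC gcdnMr.
  have : (gcdn t 3 %| gcdn A 3)%N.
    rewrite dvdn_gcd dvdn_gcdr andbT (dvdn_trans (dvdn_gcdl _ _)) //.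
    by rewrite ltE dvdn_mull.
  by rewrite A_gcd dE dvdn1 => /eqP.
have hl : (5 <= l)%N || (3 %| t)%N.
  move: d13; rewrite !inE => /orP[] /eqP dE; last by rewrite /t dE dvdn_mulr ?orbT.
  have : l != 3.
    by apply/eqP => l3; move: A_gcd; rewrite dE ltE l3 gcdnC gcdnMr.
  by move: l_odd l1; case: (l) => [|[|[|[|[|?]]]]].
have tA : (t < A)%N by rewrite ltE -[X in (X < _)%N]mul1n ltn_pmul2r.
have dt := IH t tA t_odd gcd_t.
have dj j : (0 < j)%N -> (24 * j <= A)%N -> density_zero (p_odd (A - 24 * j)).
  move=> j0 jA; apply: IH; first by lia.
    by rewrite oddB // oddM /= A_odd.
  have AE' : A = (8 * j * 3 + (A - 24 * j))%N by lia.
  by rewrite -A_gcd [in RHS]AE' [RHS]gcdnC gcdnMDl gcdnC.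
pose Q1 : pred nat := fun n => (l %| n)%N && p_odd t (n %/ l).
pose e := (t * (l ^ 2).-1)%N.
pose Q2 : pred nat := fun n => [&& e <= 24 * (l * n), 24 %| 24 * (l * n) - e &
   p_odd t ((24 * (l * n) - e) %/ 24)]%N.
pose Q3 j : pred nat := fun n => (j <= n)%N && p_odd (A - 24 * j) (n - j).
pose J := [seq j <- seq.iota 1 A | 24 * j <= A]%N.
apply: (@density_zero_sub (predU Q1 (predU Q2 (fun n => has (Q3^~ n) J)))).
  move=> n; rewrite {1}ltE => /(p_odd_recurrence l_prime l_odd t0 hl).
  case=> [h|[n' e' h]|[j /and3P[j0 jA jn] h]]; first by apply/orP; left.
    apply/orP; right; apply/orP; left.
    by rewrite /Q2 -e' leq_addl addnK dvdn_mulr // mulKn.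
  apply/orP; right; apply/orP; right; apply/hasP; exists j.
    by rewrite mem_filter mem_iota ltE jA j0; lia.
  by rewrite /Q3 jn ltE.
apply: density_zeroU.
  refine (density_zero_inj (f := fun n => (n %/ l)%N) (c := 1) _ _ _ _ dt) => //.
  - by move=> n /andP[].
  - move=> x y /andP[lx _] /andP[ly _] xy.
    by rewrite -(divnK lx) xy divnK.
  - by move=> n _; rewrite mul1n leq_div.
apply: density_zeroU.
  refine (density_zero_inj (f := fun n => ((24 * (l * n) - e) %/ 24)%N) (c := l) _ _ _ _ dt).
  - exact: ltnW.
  - by move=> n /and3P[].
  - move=> x y /and3P[ex dx _] /and3P[ey dy _] /(congr1 (muln^~ 24)).
    rewrite !divnK // => xy; apply/eqP; rewrite -(eqn_pmul2l (ltnW l1)); lia.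
  - by move=> n /and3P[_ dn _]; rewrite leq_divLR //; lia.
apply: density_zero_has => j; rewrite mem_filter mem_iota => /andP[jA /andP[j0 _]].
refine (density_zero_inj (f := fun n => (n - j)%N) (c := 1) _ _ _ _ (dj j j0 jA)) => //.
- by move=> n /andP[].
- by move=> x y /andP[jx _] /andP[jy _]; lia.
- by move=> n _; rewrite mul1n leq_subr.
Qed.

Section Density.
Variable R : realType.

Lemma odd_countE t N :
  odd_count t (N%:R : R) = count (p_odd t) (seq.iota 0 N.+1).
Proof.
rewrite /odd_count natrK cardE /enum_mem size_filter -enumT.
transitivity (count (preim (@nat_of_ord N.+1) (p_odd t)) (enum 'I_N.+1)).
  apply: eq_count => n /=; apply/idP/idP.
    by rewrite inE => /andP[].
  by move=> h; rewrite in_setE /= ler_nat -ltnS ltn_ord.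
by rewrite -count_map val_enum_ord.
Qed.

Lemma odd_ratio_cvg t : odd_density_exists R t ->
  (odd_ratio t (n.+1%:R : R)) @[n --> \oo] --> odd_density R t.
Proof.
move=> dt; have Soo : (n.+1%:R : R) @[n --> \oo] --> +oo.
  apply/cvgryPge => M; exists (Num.truncn M) => // n /= Mn.
  by apply/ltW/(lt_le_trans (truncnS_gt M)); rewrite ler_nat.
exact: (cvg_comp _ _ Soo dt).
Qed.

Lemma odd_density_ge0 t : odd_density_exists R t -> 0 <= odd_density R t.
Proof.
move=> dt; apply: limr_ge; first exact: dt.
near=> x; apply: divr_ge0; first exact: ler0n.
near: x; exact: nbhs_pinfty_ge.
Unshelve. all: by end_near.
Qed.

Lemma odd_density_eq0 t : odd_density_exists R t ->
  odd_density R t = 0 -> density_zero (p_odd t).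
Proof.
move=> /odd_ratio_cvg ct d0 k; move: ct; rewrite d0 => /cvgr0Pnorm_lt.
move=> /(_ (k.+1%:R^-1)) /=.
have k0 : 0 < k.+1%:R^-1 :> R by rewrite invr_gt0.
(* The ratio at [N + 1] counts the [N + 2] integers [0..N+1], whence the shift by two. *)
move=> /(_ k0) [N0 _ hN]; exists N0.+2 => -[//|[//|N]] NN.
have := hN N NN; rewrite /odd_ratio odd_countE ger0_norm; last first.
  by rewrite divr_ge0.
rewrite ltr_pdivrMr // ltr_pdivlMl // -natrM ltr_nat => h.
apply: leq_trans (leqnSn _); apply: leq_trans (ltnW h).
by rewrite leq_mul2r leqnSn orbT.
Qed.

Lemma density_zero_odd_density t : odd_density_exists R t ->
  density_zero (p_odd t) -> odd_density R t <= 0.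
Proof.
move=> /odd_ratio_cvg ct dz; apply/ler_addgt0Pr => e e0; rewrite add0r.
(* The 2 absorbs the quotient [(N + 2) / (N + 1)], the count running over one integer more than the
   denominator. *)
have [N0 hN] := dz (Num.truncn (2 / e)).+1.
rewrite -(cvg_lim _ ct) //; apply: limr_le; first by apply: cvgP ct.
exists N0 => // N NN /=; rewrite /odd_ratio odd_countE.
rewrite ler_pdivrMr //.
have := hN N.+2 (leq_trans NN (leqW (leqnSn N))).
set c := count _ _; rewrite -(ler_nat R) natrM => h.
have h1 : 2 / e * c%:R <= N.+2%:R.
  apply: le_trans h; apply: ler_wpM2r => //; apply/ltW/truncnS_gt.
rewrite mulrAC ler_pdivrMr // in h1.
have h2 : N.+2%:R <= 2 * N.+1%:R :> R by rewrite -natrM ler_nat; lia.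
have := ler_wpM2r (ltW e0) h2; lra.
Qed.

End Density.

Theorem theorem4 (R : realType) :
  ((exists A : nat,
      [/\ (0 < A)%N,
          A = 1 %[mod 6] \/ A = 5 %[mod 6],
          odd_density_pos R A
        & forall i : nat, (0 < i)%N -> (i <= A)%N ->
            i = 1 %[mod 6] \/ i = 5 %[mod 6] -> odd_density_exists R i]) ->
   odd_density_pos R 1)
  /\
  ((exists A : nat,
      [/\ (0 < A)%N,
          A = 3 %[mod 6],
          odd_density_pos R A
        & forall i : nat, (0 < i)%N -> (i <= A)%N ->
            i = 3 %[mod 6] -> odd_density_exists R i]) ->
   odd_density_pos R 3).
Proof.
(* By contradiction: a zero limit at [d] would force density zero, hence a limit at most 0, at
   [A]. *)
have main d A : d \in [:: 1; 3]%N -> odd A -> gcdn A 3 = d ->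
    odd_density_pos R A -> odd_density_exists R d -> odd_density_pos R d.
  move=> d13 A_odd A_gcd [eA posA] ed; split=> //.
  rewrite lt_def odd_density_ge0 // andbT; apply/eqP => d0.
  have dA := density_zero_p_odd d13 (odd_density_eq0 ed d0) A_odd A_gcd.
  by have := density_zero_odd_density eA dA; rewrite leNgt posA.
split=> -[A [A0 A6 posA ex]].
- apply: (main 1%N A) posA _ => //; last by apply: ex => //; left.
  + by lia.
  + by apply/eqP; rewrite -/(coprime A 3) coprime_sym prime_coprime //; case: A6; lia.
- apply: (main 3 A) posA _ => //; last by apply: ex => //; lia.
  + by lia.
  + by apply/gcdn_idPr; lia.
Qed.
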